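(* Let $d\in\mathbb N$, $r>0$, $1\le n_1\le n_2$, $\varepsilon\in(0,1]$, $p\in[1,2]$, $\alpha,\beta\in(0,1)$ with $\alpha+\beta\le1/2$, and suppose $n_1\varepsilon^2\ge C\log\{1/(\alpha\beta)\}$ for a suitable absolute constant $C>0$. (i) There exist a non-interactive $\varepsilon$-LDP mechanism and a test $\phi$, both constructed without knowledge of the smoothness $s$, such that $\mathbb P(\phi=1)\le\alpha$ whenever $f_X=f_Y$, and for every $s>0$ there is a constant $C_{r,s,d}>0$ depending only on $r,s,d$ such that $\mathbb P(\phi=0)\le\beta$ for all $f_X,f_Y\in\mathcal F_{s,r,d}$ with $$\|f_X-f_Y\|_p\ge C_{r,s,d}\Big(\frac{\log(n_1\varepsilon^2)[\log\{\log(n_1\varepsilon^2)/(\alpha\beta)\}]^2}{n_1\varepsilon^2}\Big)^{2s/(4s+3d)}.$$ (ii) There exist a sequentially interactive $\varepsilon$-LDP mechanism and a test $\phi$, both constructed without knowledge of $s$, such that $\mathbb P(\phi=1)\le\alpha$ whenever $f_X=f_Y$, and for every $s>0$ there is $C'_{r,s,d}>0$ such that $\mathbb P(\phi=0)\le\beta$ for all $f_X,f_Y\in\mathcal F_{s,r,d}$ with $$\|f_X-f_Y\|_p\ge C'_{r,s,d}\Big(\frac{\log(n_1\varepsilon^2)[\log(n_2/\beta)\log\{\log(n_1\varepsilon^2)/(\alpha\beta)\}]^2}{n_1\varepsilon^2}\Big)^{2s/(4s+2d)}.$$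
   Context: Data: $X_1,\dots,X_{n_1}$ i.i.d. with density $f_X$ and $Y_1,\dots,Y_{n_2}$ i.i.d. with density $f_Y$ on $[0,1]^d$, independent; the test is a function of the privatized outputs. Trigonometric basis: $\varphi_0\equiv1$, $\varphi_{2j-1}(x)=\sqrt2\sin(2\pi jx)$, $\varphi_{2j}(x)=\sqrt2\cos(2\pi jx)$, $\varphi_{\mathbf l}(\mathbf x)=\prod_{j=1}^d\varphi_{l_j}(x_j)$ for $\mathbf l\in\mathbb N_0^d$. $\mathcal S_{s,r,d}=\{f=1+\sum_{\mathbf l\ne\mathbf 0}\theta_{\mathbf l}\varphi_{\mathbf l}:\sum_{\mathbf l}\|\mathbf l\|_2^{2s}\theta_{\mathbf l}^2\le r^2\}$ and $\mathcal F_{s,r,d}$ its subset of probability densities. Mechanisms: two-sample sequentially interactive mechanisms release $Z_i\sim Q_{X,i}(\cdot\mid X_i,Z_{1:i-1},W_{1:i-1})$, $W_i\sim Q_{Y,i}(\cdot\mid Y_i,Z_{1:i-1},W_{1:i-1})$ for $i\le n_1$ and $W_j\sim Q_{Y,j}(\cdot\mid Y_j,Z_{1:n_1},W_{1:j-1})$ for $j>n_1$; $\varepsilon$-LDP means each conditional satisfies $Q(S\mid x,\text{past})\le e^{\varepsilon}Q(S\mid x',\text{past})$ for all $S,x,x'$ and past; non-interactive means each depends only on its own raw datum. *)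

(* Defs.v *)
From HB Require Import structures.
From mathcomp Require Import all_boot all_order all_algebra.
From mathcomp Require Import all_classical all_reals all_analysis.
From mathcomp Require Import measurable_realfun.
Set Implicit Arguments. Unset Strict Implicit. Unset Printing Implicit Defensive.
Import Order.TTheory GRing.Theory Num.Theory.
Local Open Scope classical_set_scope.
Local Open Scope ring_scope.

Section defs.
Variable R : realType.

Definition cube (d : nat) : set (d.-tuple R) :=
  [set x | forall j : 'I_d, 0 <= tnth x j <= 1].

(* Lebesgue integral over [0,1]^d of a function with values in \bar R,
   computed as iterated one-dimensional Lebesgue integrals over [0,1]
   (all integrands used below are nonnegative, so by Tonelli this is the
   integral against d-dimensional Lebesgue measure on [0,1]^d). *)
Fixpoint int_cube (k : nat) : (k.-tuple R -> \bar R) -> \bar R :=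
  match k with
  | 0 => fun g => g [tuple]
  | k'.+1 => fun g =>
      (\int[@lebesgue_measure R]_(x in `[0%R, 1%R])
          int_cube (fun t => g [tuple of x :: t]))%E
  end.

Definition is_density (d : nat) (f : d.-tuple R -> R) : Prop :=
  measurable_fun [set: d.-tuple R] f /\
  (forall x, cube x -> 0 <= f x) /\
  int_cube (fun x => (f x)%:E) = 1%E.

Definition lp_dist (d : nat) (p : R) (f g : d.-tuple R -> R) : \bar R :=
  poweR (int_cube (fun x => (`|f x - g x| `^ p)%:E)) p^-1.

Definition trig1 (k : nat) (x : R) : R :=
  if k == 0%N then 1
  else if odd k then Num.sqrt 2 * sin (2 * pi * (k.+1./2)%:R * x)
  else Num.sqrt 2 * cos (2 * pi * (k./2)%:R * x).

Definition trig (d : nat) (l : d.-tuple nat) (x : d.-tuple R) : R :=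
  \prod_(j < d) trig1 (tnth l j) (tnth x j).

Definition nonzero_idx (d : nat) (l : d.-tuple nat) : bool :=
  [exists j : 'I_d, tnth l j != 0%N].

Definition idx_norm (d : nat) (l : d.-tuple nat) : R :=
  Num.sqrt (\sum_(j < d) ((tnth l j)%:R) ^+ 2).

Definition ord_idx (d N : nat) (l : d.-tuple 'I_N) : d.-tuple nat :=
  map_tuple (@nat_of_ord N) l.

Definition trig_partial (d : nat) (theta : d.-tuple nat -> R) (N : nat)
    (x : d.-tuple R) : R :=
  1 + \sum_(l : d.-tuple 'I_N.+1 | nonzero_idx (ord_idx l))
        theta (ord_idx l) * trig (ord_idx l) x.

Definition sobolev_S (s r : R) (d : nat) (f : d.-tuple R -> R) : Prop :=
  exists theta : d.-tuple nat -> R,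
    (forall N : nat,
       \sum_(l : d.-tuple 'I_N.+1 | nonzero_idx (ord_idx l))
          idx_norm (ord_idx l) `^ (2 * s) * theta (ord_idx l) ^+ 2 <= r ^+ 2) /\
    ((fun N : nat => int_cube (fun x => ((f x - trig_partial theta N x) ^+ 2)%:E))
       @ \oo --> 0%E).

Definition sobolev_F (s r : R) (d : nat) (f : d.-tuple R -> R) : Prop :=
  sobolev_S s r f /\ is_density f.

Section mechanisms.
Variables (d n1 n2 : nat) (dT : measure_display) (T : measurableType dT).

(* A family of channels: Q i x zs ws is the law of the i-th release (index i
   counted from 0) given the raw datum x and the (full) record of releases
   zs (the Z's) and ws (the W's); its allowed dependence on the past is
   expressed by [causal] / [non_interactive] below. *)
Definition channels := nat -> d.-tuple R -> n1.-tuple T -> n2.-tuple T ->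
  probability T R.

Definition channels_measurable (Q : channels) : Prop :=
  forall (i : nat) (A : set T), measurable A ->
    measurable_fun [set: d.-tuple R * (n1.-tuple T * n2.-tuple T)]
      (fun p => Q i p.1 p.2.1 p.2.2 A).

Definition channels_ldp (eps : R) (Q : channels) : Prop :=
  forall (i : nat) (x x' : d.-tuple R) (zs : n1.-tuple T) (ws : n2.-tuple T)
         (A : set T),
    cube x -> cube x' -> measurable A ->
    (Q i x zs ws A <= (expR eps)%:E * Q i x' zs ws A)%E.

(* the i-th (0-based) channel only depends on Z_{1:i} and W_{1:i}
   (1-based), i.e. on the coordinates of index < i *)
Definition causal (Q : channels) : Prop :=
  forall (i : nat) (x : d.-tuple R) (zs zs' : n1.-tuple T)
         (ws ws' : n2.-tuple T) (A : set T),
    (forall k : 'I_n1, (k < i)%N -> tnth zs k = tnth zs' k) ->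
    (forall k : 'I_n2, (k < i)%N -> tnth ws k = tnth ws' k) ->
    Q i x zs ws A = Q i x zs' ws' A.

Definition non_interactive (Q : channels) : Prop :=
  forall (i : nat) (x : d.-tuple R) (zs zs' : n1.-tuple T)
         (ws ws' : n2.-tuple T) (A : set T),
    Q i x zs ws A = Q i x zs' ws' A.

(* sequentially interactive eps-LDP mechanism (QX for the X-sample, QY for
   the Y-sample); Z_i ~ QX (i-1), W_j ~ QY (j-1) *)
Definition seq_interactive_ldp (eps : R) (QX QY : channels) : Prop :=
  [/\ channels_measurable QX /\ channels_measurable QY,
      channels_ldp eps QX /\ channels_ldp eps QY &
      causal QX /\ causal QY].

Definition non_interactive_ldp (eps : R) (QX QY : channels) : Prop :=
  [/\ channels_measurable QX /\ channels_measurable QY,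
      channels_ldp eps QX /\ channels_ldp eps QY &
      non_interactive QX /\ non_interactive QY].

Definition upd (n : nat) (t : n.-tuple T) (i : nat) (v : T) : n.-tuple T :=
  [tuple (if val j == i then v else tnth t j) | j < n].

Section law.
Variables (QX QY : channels) (fX fY : d.-tuple R -> R)
          (g : n1.-tuple T * n2.-tuple T -> \bar R).

(* second phase: W_j for j = n1+1 .. n2 (1-based), m steps remaining *)
Fixpoint phase2 (m : nat) (zs : n1.-tuple T) (ws : n2.-tuple T) : \bar R :=
  match m with
  | 0 => g (zs, ws)
  | m'.+1 =>
      int_cube (fun y => ((fY y)%:E *
        \int[QY (n2 - m)%N y zs ws]_w phase2 m' zs (upd ws (n2 - m)%N w))%E)
  end.

(* first phase: (Z_i, W_i) for i = 1 .. n1, drawn conditionally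
   independently given the past; m steps remaining *)
Fixpoint phase1 (m : nat) (zs : n1.-tuple T) (ws : n2.-tuple T) : \bar R :=
  match m with
  | 0 => phase2 (n2 - n1)%N zs ws
  | m'.+1 =>
      int_cube (fun x => ((fX x)%:E *
        int_cube (fun y => ((fY y)%:E *
          \int[QX (n1 - m)%N x zs ws]_z \int[QY (n1 - m)%N y zs ws]_w
             phase1 m' (upd zs (n1 - m)%N z) (upd ws (n1 - m)%N w))%E))%E)
  end.

Definition expect_out : \bar R :=
  phase1 n1 [tuple point | _ < n1] [tuple point | _ < n2].
End law.

Definition prob_reject (QX QY : channels) (fX fY : d.-tuple R -> R)
    (Phi : set (n1.-tuple T * n2.-tuple T)) : \bar R :=
  expect_out QX QY fX fY (fun o => (\1_Phi o)%:E).

Definition prob_accept (QX QY : channels) (fX fY : d.-tuple R -> R)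
    (Phi : set (n1.-tuple T * n2.-tuple T)) : \bar R :=
  expect_out QX QY fX fY (fun o => (\1_(~` Phi) o)%:E).

Definition test_measurable (Phi : set (n1.-tuple T * n2.-tuple T)) : Prop :=
  @measurable _ (n1.-tuple T * n2.-tuple T)%type Phi.

End mechanisms.
End defs.

(* Main.v *)
(* Every user releases a single bit with success probability (1 + (eps / 4) u) / 2, where
   |u| <= 1; this is eps-LDP and the law of the releases only depends on the means of u.
   For predictable weights c the process exp (sum_i (c_i (Z_i - W_i) - 8 c_i^2)) is a
   supermartingale when fX = fY, so Markov's inequality and a union bound over the levels
   nu < V ~ log (n1 eps^2) control the type I error without any knowledge of f.
   At level nu a first block of users estimates the Fourier coefficients of fX - fY with
   frequencies below 2^nu. In the non-interactive test a second block probes the same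
   coefficients and is weighted by the first block's estimates, which yields an unbiased
   quadratic statistic. In the interactive test the second block releases the clipped
   estimate of fX - fY evaluated at its own datum, so that its mean difference is close to
   the squared norm of fX - fY up to scaling. Smoothness is only used to find a level whose
   Fourier energy exceeds the detection threshold. *)

Require Import Defs.
From HB Require Import structures.
From mathcomp Require Import all_boot all_order all_algebra.
From mathcomp Require Import all_classical all_reals all_analysis.
From mathcomp Require Import measurable_realfun ring lra zify.
Import Order.TTheory GRing.Theory Num.Theory.
Import numFieldNormedType.Exports.
Local Open Scope classical_set_scope.
Local Open Scope ring_scope.
Set Implicit Arguments.
Unset Strict Implicit.
Unset Printing Implicit Defensive.

(** Both error bounds rest on exponential moments. Under the alternative the supermartingale,
    centred by the true drifts, is run with negated weights: a function [G] of the releases is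
    exhibited with mean at most [beta] and value at least 1 wherever the statistic misses its
    threshold. [G] sums three exponential terms, each given a third of [beta], so that only a
    deterministic inequality is left where [G < 1].

    The obstacle in the interactive test is the clipping level. It is fixed without knowing
    [fX - fY], must not distort the signal and must not drown it, yet the signal may exceed the
    threshold by any factor. The remedy is to raise the resolution: the users per coordinate drop by
    [2 ^ d] per level while the energy stays bounded, so at the finest level that still passes, the
    signal is only a constant factor too large. The factor [ln (n2 / beta)] of the rate is the
    clipping depth [l]: it makes the clipping bias, of order [exp (- l)], beat both the noise scale
    and [1 / beta].

    The terms [3 d] and [2 d] reflect the energy required over [M = 2 ^ (nu d)] coordinates,
    [M ^ (3/2) z] and [M z], where [z] is [1 / (n1 eps^2)] up to logarithms. *)

Section cube_measure.
Context {R : realType}.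

(* [R] and [measurableTypeR R] carry different canonical measurable structures; pushing
   forward along the identity moves the uniform law from the latter to the former. *)
Definition borel_id (x : measurableTypeR R) : R := x.

Lemma measurable_borel_id : measurable_fun setT borel_id.
Proof. exact: (@measurable_id _ (measurableTypeR R)). Qed.

HB.instance Definition _ :=
  isMeasurableFun.Build _ _ _ _ borel_id measurable_borel_id.

Definition unif01 : probability R R :=
  [the probability _ _ of distribution
    [the probability (measurableTypeR R) R of uniform_prob (@ltr01 R)] borel_id].

Lemma int_unif01 (f : R -> \bar R) : measurable_fun setT f ->
  (forall x, 0 <= f x)%E ->
  (\int[unif01]_x f x = \int[@lebesgue_measure R]_(x in `[0%R, 1%R]) f x)%E.
Proof.
move=> mf f0; rewrite /unif01 ge0_integral_distribution//.
by rewrite integral_uniform// subr0 invr1 mul1e.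
Qed.

Definition cons_pair k (p : R * k.-tuple R) : k.+1.-tuple R :=
  [tuple of p.1 :: p.2].

Lemma measurable_cons_pair k : measurable_fun setT (@cons_pair k).
Proof. by apply: measurable_cons; [exact: measurable_fst|exact: measurable_snd]. Qed.

HB.instance Definition _ k :=
  isMeasurableFun.Build _ _ _ _ (@cons_pair k) (@measurable_cons_pair k).

(** Built one coordinate at a time, as [int_cube] is, so that comparing the two takes one
    application of Tonelli per coordinate. *)
Fixpoint cube_prob (k : nat) : probability (k.-tuple R) R :=
  match k with
  | 0 => [the probability _ _ of \d_([tuple] : 0.-tuple R)]
  | k'.+1 => [the probability _ _ of
      distribution [the probability _ _ of (unif01 \x cube_prob k')%E]
        (@cons_pair k')]
  end.

Lemma int_cubeE k (f : k.-tuple R -> \bar R) : measurable_fun setT f ->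
  (forall x, 0 <= f x)%E -> int_cube f = (\int[cube_prob k]_x f x)%E.
Proof.
elim: k f => [|k IH] f mf f0 /=.
  by rewrite integral_dirac// diracT mul1e.
have mfc : measurable_fun setT (f \o @cons_pair k).
  exact: measurableT_comp mf (@measurable_cons_pair k).
rewrite ge0_integral_distribution//.
have fc0 z : (0 <= (f \o @cons_pair k) z)%E by exact: f0.
rewrite (fubini_tonelli1 (f \o @cons_pair k))//.
transitivity (\int[unif01]_x fubini_F (cube_prob k) (f \o @cons_pair k) x)%E; last first.
  by [].
rewrite int_unif01.
- apply: eq_integral => x _; rewrite IH//.
  exact: (measurableT_comp mfc (measurable_pair1 x)).
- exact: (@measurable_fun_fubini_tonelli_F _ _ _ _ _ (cube_prob k) _ mfc fc0).
- by move=> x; exact: integral_ge0.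
Qed.

Lemma eq_int_cube k (f g : k.-tuple R -> \bar R) :
  (forall x, cube x -> f x = g x) -> int_cube f = int_cube g.
Proof.
elim: k f g => [|k IH] f g fg /=; first by apply: fg; case.
apply: eq_integral => x; rewrite inE/= in_itv/= => x01; apply: IH => t ct.
apply: fg => j; case: (unliftP ord0 j) => [i|] ->; last by rewrite tnth0.
by rewrite tnthS; exact: ct.
Qed.

End cube_measure.

(** [1 - x <= expR (- x)] gives [expR x <= 1 / (1 - x)], and [(1 - x) (1 + x + 2 x^2) = 1 + x^2 (1 -
    2 x)] is at least 1. *)
Lemma expR_le_quad {R : realType} (x : R) : x <= 2^-1 ->
  expR x <= 1 + x + 2 * x ^+ 2.
Proof.
move=> x2; have h1 : 0 < 1 - x by lra.
have := expR_ge1Dx (- x); rewrite expRN => h2.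
have h3 : expR x <= (1 - x)^-1.
  by rewrite -[expR x]invrK lef_pV2 ?posrE ?invr_gt0 ?expR_gt0.
apply: (le_trans h3); rewrite -[_^-1]mul1r ler_pdivrMr//; nra.
Qed.

(** The linear term is kept apart because it vanishes on averaging a centred variable; a bound on
    [x ^ 2] then suffices for the Laplace transform. Past 1/2 already [x <= 2 x ^ 2]. *)
Lemma expR_le_subgauss {R : realType} (x : R) : expR x <= x + expR (2 * x ^+ 2).
Proof.
have [x2|x2] := leP x (2^-1).
  apply: (le_trans (expR_le_quad x2)).
  have := expR_ge1Dx (2 * x ^+ 2); lra.
have : expR x <= expR (2 * x ^+ 2) by rewrite ler_expR; nra.
by lra.
Qed.

(** * Sequential binary releases *)

Section bit_average.
Context {R : realType}.
Implicit Types (p q a c : R) (g h : bool -> R).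

Definition ebit p g : R := p * g true + (1 - p) * g false.

Lemma ebitD p g h : ebit p (fun b => g b + h b) = ebit p g + ebit p h.
Proof. by rewrite /ebit; ring. Qed.

Lemma ebitZ p a g : ebit p (fun b => a * g b) = a * ebit p g.
Proof. by rewrite /ebit; ring. Qed.

Lemma ebit_cst p a : ebit p (fun=> a) = a.
Proof. by rewrite /ebit; ring. Qed.

Lemma le_ebit p g h : 0 <= p <= 1 -> (forall b, g b <= h b) ->
  ebit p g <= ebit p h.
Proof.
move=> /andP[p0 p1] gh; rewrite /ebit lerD// ler_wpM2l// ?subr_ge0//.
Qed.

Lemma eq_ebit p g h : g =1 h -> ebit p g = ebit p h.
Proof. by move=> gh; rewrite /ebit !gh. Qed.

(** [z - w - (p - q)] is centred and at most 2 in absolute value, so twice the square of the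
    exponent is at most [8 c ^ 2]. This is the origin of the 8 in all the statistics. *)
Lemma ebit_mgf p q c : 0 <= p <= 1 -> 0 <= q <= 1 ->
  ebit p (fun z => ebit q (fun w => expR (c * (z%:R - w%:R - (p - q)))))
    <= expR (8 * c ^+ 2).
Proof.
move=> p01 q01.
set t := fun z w : bool => c * (z%:R - w%:R - (p - q)).
apply: (@le_trans _ _
  (ebit p (fun z => ebit q (fun w => t z w + expR (8 * c ^+ 2))))).
  apply: le_ebit => // z; apply: le_ebit => // w; apply: (le_trans (expR_le_subgauss _)).
  rewrite lerD2l ler_expR /t exprMn mulrCA.
  rewrite [leRHS]mulrC ler_wpM2l ?sqr_ge0//.
  have : (z%:R - w%:R - (p - q) : R) ^+ 2 <= 4.
    by case: z; case: w => /=; move: p01 q01 => /andP[? ?] /andP[? ?]; nra.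
  lra.
by rewrite /ebit /t le_eqVlt; apply/orP; left; apply/eqP; set E := expR _ => /=; ring.
Qed.

End bit_average.

Section bit_process.
Context {R : realType} {n1 n2 : nat}.
Local Notation zst := (n1.-tuple bool).
Local Notation wst := (n2.-tuple bool).
Implicit Types (g h : zst * wst -> R) (zs : zst) (ws : wst).

(** [nth] with a default keeps indices plain naturals; past the end of a tuple both sides are
    [false] and the condition is void. *)
Definition causal_fun (c : nat -> zst -> wst -> R) : Prop :=
  forall i zs zs' ws ws',
    (forall k, (k < i)%N -> nth false zs k = nth false zs' k) ->
    (forall k, (k < i)%N -> nth false ws k = nth false ws' k) ->
    c i zs ws = c i zs' ws'.

Lemma nth_upd n (t : n.-tuple bool) i v k : (i < n)%N ->
  nth false (upd t i v) k = if k == i then v else nth false t k.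
Proof.
move=> ltin; have [ltkn|lenk] := ltnP k n.
  by rewrite -[LHS](tnth_nth _ _ (Ordinal ltkn)) tnth_mktuple/= (tnth_nth false).
rewrite !nth_default ?size_tuple//.
by case: eqP => // ki; rewrite -ki ltnNge lenk in ltin.
Qed.

Variables pX pY : nat -> zst -> wst -> R.
Hypothesis pX01 : forall i zs ws, 0 <= pX i zs ws <= 1.
Hypothesis pY01 : forall i zs ws, 0 <= pY i zs ws <= 1.

(** Mirrors [phase2], as [bit_phase1] mirrors [phase1], after datum and channel are integrated out:
    only the conditional success probabilities of the bits remain, and expectations become finite
    averages. [expect_out_rr] proves the agreement. *)
Fixpoint bit_phase2 (m : nat) zs ws g : R :=
  match m with
  | 0 => g (zs, ws)
  | m'.+1 => ebit (pY (n2 - m)%N zs ws)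
      (fun w => bit_phase2 m' zs (upd ws (n2 - m)%N w) g)
  end.

Fixpoint bit_phase1 (m : nat) zs ws g : R :=
  match m with
  | 0 => bit_phase2 (n2 - n1)%N zs ws g
  | m'.+1 => ebit (pX (n1 - m)%N zs ws) (fun z =>
      ebit (pY (n1 - m)%N zs ws) (fun w =>
        bit_phase1 m' (upd zs (n1 - m)%N z) (upd ws (n1 - m)%N w) g))
  end.

Definition bit_expect g : R :=
  bit_phase1 n1 [tuple point | _ < n1] [tuple point | _ < n2] g.

Lemma bit_expectD g h :
  bit_expect (fun o => g o + h o) = bit_expect g + bit_expect h.
Proof.
suff H m zs ws : bit_phase1 m zs ws (fun o => g o + h o) = bit_phase1 m zs ws g + bit_phase1 m zs ws h by exact: H.
elim: m zs ws => [|m IH] zs ws /=.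
  elim: (n2 - n1)%N ws => [|k IH] ws //=.
  by rewrite -ebitD; apply: eq_ebit => w; rewrite IH.
rewrite -ebitD; apply: eq_ebit => z; rewrite -ebitD; apply: eq_ebit => w.
by rewrite IH.
Qed.

Lemma bit_expectZ a g : bit_expect (fun o => a * g o) = a * bit_expect g.
Proof.
suff H m zs ws : bit_phase1 m zs ws (fun o => a * g o) = a * bit_phase1 m zs ws g by exact: H.
elim: m zs ws => [|m IH] zs ws /=.
  elim: (n2 - n1)%N ws => [|k IH] ws //=.
  by rewrite -ebitZ; apply: eq_ebit => w; rewrite IH.
rewrite -ebitZ; apply: eq_ebit => z; rewrite -ebitZ; apply: eq_ebit => w.
by rewrite IH.
Qed.

Lemma le_bit_expect g h : (forall o, g o <= h o) ->
  bit_expect g <= bit_expect h.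
Proof.
move=> gh; suff H m zs ws : bit_phase1 m zs ws g <= bit_phase1 m zs ws h by exact: H.
elim: m zs ws => [|m IH] zs ws /=.
  by elim: (n2 - n1)%N ws => [|k IH] ws //=; apply: le_ebit.
by apply: le_ebit => // z; apply: le_ebit.
Qed.

Lemma bit_expect_sum (I : Type) (r : seq I) (F : I -> zst * wst -> R) :
  bit_expect (fun o => \sum_(i <- r) F i o) = \sum_(i <- r) bit_expect (F i).
Proof.
elim: r => [|i r IH].
  rewrite big_nil -[RHS](mul0r (bit_expect (fun=> 0))) -bit_expectZ.
  by congr bit_expect; apply/funext => o; rewrite big_nil mul0r.
rewrite big_cons -IH -bit_expectD; congr bit_expect; apply/funext => o.
by rewrite big_cons.
Qed.

(** A finite average commutes with any integral. This serves the clipping bias, which is averaged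
    over a data point as well as over the releases. *)
Lemma Rintegral_bit_expect d (T : measurableType d)
    (mu : {measure set T -> \bar R}) (F : zst * wst -> T -> R) :
  (forall o, mu.-integrable setT (EFin \o F o)) ->
  mu.-integrable setT (EFin \o (fun x => bit_expect (fun o => F o x))) /\
  \int[mu]_x bit_expect (fun o => F o x) = bit_expect (fun o => \int[mu]_x F o x).
Proof.
move=> iF; rewrite /bit_expect.
have ebitP p (G : bool -> T -> R) (g : bool -> R) :
    (forall b, mu.-integrable setT (EFin \o G b) /\ \int[mu]_x G b x = g b) ->
    mu.-integrable setT (EFin \o (fun x => ebit p (G ^~ x))) /\
    \int[mu]_x ebit p (G ^~ x) = ebit p g.
  move=> GP; have [iT eT] := GP true; have [iN eN] := GP false; split.
    apply: (@integrableD _ _ _ _ _ measurableT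
      (EFin \o (fun x => p * G true x)) (EFin \o (fun x => (1 - p) * G false x))).
      by apply: (@eq_integrable _ _ _ _ _ measurableT
        (fun x => p%:E * (EFin \o G true) x)%E) => //; exact: integrableZl.
    by apply: (@eq_integrable _ _ _ _ _ measurableT
        (fun x => (1 - p)%:E * (EFin \o G false) x)%E) => //; exact: integrableZl.
  rewrite /ebit RintegralD//.
  - by rewrite !RintegralZl// eT eN.
  - by apply: (@eq_integrable _ _ _ _ _ measurableT
        (fun x => p%:E * (EFin \o G true) x)%E) => //; exact: integrableZl.
  - by apply: (@eq_integrable _ _ _ _ _ measurableT
        (fun x => (1 - p)%:E * (EFin \o G false) x)%E) => //; exact: integrableZl.
suff H m zs ws : mu.-integrable setT
    (EFin \o (fun x => bit_phase1 m zs ws (fun o => F o x))) /\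
  \int[mu]_x bit_phase1 m zs ws (fun o => F o x) =
  bit_phase1 m zs ws (fun o => \int[mu]_x F o x).
  exact: H.
elim: m zs ws => [|m IH] zs ws /=.
  elim: (n2 - n1)%N ws => [|k IH] ws //=.
  by apply: ebitP => w; exact: IH.
by apply: (ebitP) => z; apply: (ebitP) => w; exact: IH.
Qed.

Hypothesis pX_causal : causal_fun pX.
Hypothesis pY_causal : causal_fun pY.

Definition bit_diff i zs ws : R := (nth false zs i)%:R - (nth false ws i)%:R.

(* Exponent of the exponential supermartingale attached to predictable weights
   [c]; [8 * c ^ 2] dominates the log-Laplace transform of one centred step. *)
Definition exp_proc (c : nat -> zst -> wst -> R) (k : nat) zs ws : R :=
  \sum_(i < k) (c i zs ws * (bit_diff i zs ws - (pX i zs ws - pY i zs ws))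
                - 8 * c i zs ws ^+ 2).

Lemma exp_proc_causal c k zs zs' ws ws' : causal_fun c ->
  (forall j, (j < k)%N -> nth false zs j = nth false zs' j) ->
  (forall j, (j < k)%N -> nth false ws j = nth false ws' j) ->
  exp_proc c k zs ws = exp_proc c k zs' ws'.
Proof.
move=> cc Hz Hw; apply: eq_bigr => i _.
have Hzi j : (j < i)%N -> nth false zs j = nth false zs' j.
  by move=> ji; apply: Hz; exact: ltn_trans ji (ltn_ord i).
have Hwi j : (j < i)%N -> nth false ws j = nth false ws' j.
  by move=> ji; apply: Hw; exact: ltn_trans ji (ltn_ord i).
rewrite /bit_diff (Hz i)// (Hw i)// (cc _ _ _ _ _ Hzi Hwi).
by rewrite (pX_causal Hzi Hwi) (pY_causal Hzi Hwi).
Qed.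

(** Backward induction on the number of remaining steps. As [pX] and [pY] may differ, the same bound
    serves the null and, with the drift subtracted, the alternative. *)
Theorem exp_supermartingale c : (n1 <= n2)%N -> causal_fun c ->
  bit_expect (fun o => expR (exp_proc c n1 o.1 o.2)) <= 1.
Proof.
move=> n12 cc.
suff H m zs ws : (m <= n1)%N ->
    bit_phase1 m zs ws (fun o => expR (exp_proc c n1 o.1 o.2))
      <= expR (exp_proc c (n1 - m) zs ws).
  by apply: le_trans (H _ _ _ (leqnn _)) _; rewrite subnn /exp_proc big_ord0 expR0.
elim: m zs ws => [|m IH] zs ws mn1 /=.
  rewrite subn0.
  suff H k ws' : (k <= n2 - n1)%N ->
      bit_phase2 k zs ws' (fun o => expR (exp_proc c n1 o.1 o.2))
        <= expR (exp_proc c n1 zs ws') by exact: H.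
  elim: k ws' => [|k IH] {}ws kn //=.
  (* The process stops at [n1]: a later [W] does not change it, so averaging over that bit is
     free. *)
  rewrite -[leRHS](ebit_cst (pY (n2 - k.+1)%N zs ws)).
  apply: le_ebit => // w; apply: le_trans (IH _ (ltnW kn)) _.
  rewrite le_eqVlt; apply/orP; left; apply/eqP; congr expR.
  apply: exp_proc_causal => // j jn1; rewrite nth_upd; last first.
    by rewrite ltn_subrL (leq_trans _ (leq_trans kn (leq_subr _ _))).
  case: eqP => // je; move: jn1; rewrite je ltnNge => /negP[].
  by rewrite leq_subRL ?(leq_trans kn) ?leq_subr// addnC -leq_subRL.
set k := (n1 - m.+1)%N.
have kn1 : (k < n1)%N by rewrite ltn_subrL (leq_trans _ mn1).
have kn2 : (k < n2)%N by exact: leq_trans kn1 n12.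
have ek : (n1 - m)%N = k.+1 by rewrite /k subnSK.
pose S := exp_proc c k zs ws.
have step z w : exp_proc c (n1 - m) (upd zs k z) (upd ws k w) =
    S - 8 * c k zs ws ^+ 2 +
    c k zs ws * (z%:R - w%:R - (pX k zs ws - pY k zs ws)).
  have Hz j : (j < k)%N -> nth false (upd zs k z) j = nth false zs j.
    by move=> jk; rewrite nth_upd// ltn_eqF.
  have Hw j : (j < k)%N -> nth false (upd ws k w) j = nth false ws j.
    by move=> jk; rewrite nth_upd// ltn_eqF.
  rewrite ek /exp_proc big_ord_recr/= -/(exp_proc c k _ _).
  rewrite (exp_proc_causal cc Hz Hw) -/S (cc _ _ _ _ _ Hz Hw).
  rewrite (pX_causal Hz Hw) (pY_causal Hz Hw) /bit_diff !nth_upd// eqxx.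
  ring.
apply: (@le_trans _ _ (ebit (pX k zs ws) (fun z => ebit (pY k zs ws) (fun w =>
    expR (S - 8 * c k zs ws ^+ 2) *
    expR (c k zs ws * (z%:R - w%:R - (pX k zs ws - pY k zs ws))))))).
  apply: le_ebit => // z; apply: le_ebit => // w.
  by rewrite -expRD -step; apply: IH; exact: ltnW.
(* The factor known before the step leaves both averages, and its [- 8 c ^ 2] cancels the bound of
   [ebit_mgf]. *)
under eq_ebit do rewrite ebitZ.
rewrite ebitZ -[leRHS](@mulfVK _ (expR (8 * c k zs ws ^+ 2))) ?gt_eqF ?expR_gt0//.
rewrite -expRN -expRD -/S; apply: ler_wpM2l; first exact: expR_ge0.
exact: ebit_mgf.
Qed.

End bit_process.

(** * Randomized response and the law of the released bits *)

Lemma bernoulli_prob_EFin {R : realType} (p : R) (A : set bool) : 0 <= p <= 1 ->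
  bernoulli_prob p A = (p * (true \in A)%:R + (1 - p) * (false \in A)%:R)%:E.
Proof. by move=> p01; rewrite bernoulli_probE// !diracE. Qed.

Section randomized_response.
Context {R : realType} {d n1 n2 : nat}.
Local Notation zst := (n1.-tuple bool).
Local Notation wst := (n2.-tuple bool).
Local Notation mu := (cube_prob (R := R) d).
Variable eps : R.
Hypothesis eps01 : 0 < eps <= 1.

Definition rr_prob (v : R) : R := (1 + eps / 4 * v) / 2.

Lemma rr_prob01 v : -1 <= v <= 1 -> 0 <= rr_prob v <= 1.
Proof.
by rewrite /rr_prob; move: eps01 => /andP[? ?] /andP[? ?]; apply/andP; split; nra.
Qed.

Variable u : nat -> d.-tuple R -> zst -> wst -> R.
Hypothesis u1 : forall i x zs ws, -1 <= u i x zs ws <= 1.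
Hypothesis um : forall i, measurable_fun setT
  (fun p : d.-tuple R * (zst * wst) => u i p.1 p.2.1 p.2.2).

Definition rr_channel : channels R d n1 n2 bool := fun i x zs ws =>
  [the probability _ _ of bernoulli_prob (rr_prob (u i x zs ws))].

Lemma measurable_rr_prob : measurable_fun setT rr_prob.
Proof.
by rewrite /rr_prob; apply: measurable_funM => //; apply: measurable_funD => //.
Qed.

Lemma rr_channel_measurable : channels_measurable rr_channel.
Proof.
move=> i A mA; apply: (measurableT_comp (measurable_bernoulli_prob2 mA)).
exact: (measurableT_comp measurable_rr_prob (um i)).
Qed.

(* (1 + eps/4) / (1 - eps/4) <= 1 + eps <= e^eps for eps <= 1. *)
Lemma rr_channel_ldp : channels_ldp eps rr_channel.
Proof.
move=> i x x' zs ws A _ _ _; rewrite /rr_channel /=.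
have := rr_prob01 (u1 i x zs ws); have := rr_prob01 (u1 i x' zs ws).
have := u1 i x zs ws; have := u1 i x' zs ws; rewrite /rr_prob.
set v' := u i x' zs ws; set v := u i x zs ws => hv' hv p' p.
have := expR_ge1Dx eps; set E := expR eps => hE.
rewrite !bernoulli_prob_EFin// -EFinM lee_fin.
move: eps01 hv hv' => /andP[e0 e1] /andP[v1 v2] /andP[v1' v2'].
have E0 : 1 + eps <= E by [].
have key (s s' : R) : -1 <= s <= 1 -> -1 <= s' <= 1 ->
    (1 + eps / 4 * s) / 2 <= E * ((1 + eps / 4 * s') / 2).
  move=> /andP[s1 s2] /andP[t1 t2].
  apply: (@le_trans _ _ ((1 + eps) * ((1 + eps / 4 * s') / 2))); last first.
    by apply: ler_wpM2r => //; nra.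
  nra.
rewrite mulrDr; apply: lerD.
  by rewrite (mulrA E) ler_wpM2r//; apply: key; apply/andP.
rewrite (mulrA E) ler_wpM2r//.
have -> : 1 - (1 + eps / 4 * v) / 2 = (1 + eps / 4 * - v) / 2 by field.
have -> : 1 - (1 + eps / 4 * v') / 2 = (1 + eps / 4 * - v') / 2 by field.
by apply: key; apply/andP; split; lra.
Qed.

Lemma rr_channel_causal : (forall x, causal_fun (fun i => u i x)) ->
  causal rr_channel.
Proof.
move=> uc i x zs zs' ws ws' A Hz Hw; rewrite /rr_channel /=.
rewrite (uc x i zs zs' ws ws')// => k ki.
  have [kn|kn] := ltnP k n1; last by rewrite !nth_default ?size_tuple.
  by have := Hz (Ordinal kn) ki; rewrite !(tnth_nth false).
have [kn|kn] := ltnP k n2; last by rewrite !nth_default ?size_tuple.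
by have := Hw (Ordinal kn) ki; rewrite !(tnth_nth false).
Qed.

Lemma rr_channel_non_interactive :
  (forall i x zs zs' ws ws', u i x zs ws = u i x zs' ws') ->
  non_interactive rr_channel.
Proof.
by move=> uc i x zs zs' ws ws' A; rewrite /rr_channel /= (uc i x zs zs' ws ws').
Qed.

(** [rr_prob] is affine, so averaging the success probability over the datum amounts to averaging
    [u]. *)
Definition rr_mean (f : d.-tuple R -> R) i zs ws : R :=
  rr_prob (\int[mu]_x (f x * u i x zs ws)).

Lemma rr_mean_causal f : (forall x, causal_fun (fun i => u i x)) ->
  causal_fun (rr_mean f).
Proof.
move=> uc i zs zs' ws ws' Hz Hw; rewrite /rr_mean; congr rr_prob.
by apply: eq_Rintegral => x _; rewrite (uc x i zs zs' ws ws').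
Qed.

Section density.
Variable f : d.-tuple R -> R.
Hypothesis f0 : forall x, 0 <= f x.
Hypothesis df : is_density f.

Lemma density_integrable : mu.-integrable setT (EFin \o f).
Proof.
apply/integrableP; split; first by apply/measurable_EFinP; case: df.
have [mf [_ f1]] := df.
have -> : (\int[mu]_x `|(EFin \o f) x| = int_cube (fun x => (f x)%:E))%E.
  rewrite int_cubeE; [|exact/measurable_EFinP|by move=> x; rewrite lee_fin].
  by apply: eq_integral => x _ /=; rewrite ger0_norm.
by rewrite f1 ltry.
Qed.

Lemma density_Rintegral : \int[mu]_x f x = 1.
Proof.
have [mf [_ f1]] := df.
rewrite /Rintegral -(int_cubeE (f := EFin \o f)) ?f1//.
exact/measurable_EFinP.
Qed.

Lemma integrable_density_mul (g : d.-tuple R -> R) (M : R) :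
  measurable_fun setT g -> (forall x, `|g x| <= M) ->
  mu.-integrable setT (EFin \o (fun x => f x * g x)).
Proof.
move=> mg gM; apply: (@le_integrable _ _ _ mu _ measurableT _ (fun x => (M * f x)%:E)).
- by apply/measurable_EFinP; apply: measurable_funM => //; case: df.
- move=> x _ /=; rewrite lee_fin normrM mulrC (ger0_norm (f0 x)) normrM (ger0_norm (f0 x)).
  by rewrite ler_wpM2r// (le_trans (gM x)) ?ler_norm.
- apply: (@eq_integrable _ _ _ _ _ measurableT (fun x => M%:E * (EFin \o f) x)%E).
    by move=> x _; rewrite /= EFinM.
  by apply: integrableZl => //; exact: density_integrable.
Qed.

Lemma um_x i zs ws : measurable_fun setT (fun x => u i x zs ws).
Proof.
exact: (measurableT_comp (um i) (measurable_pair2 (zs, ws))).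
Qed.

Lemma u_norm i x zs ws : `|u i x zs ws| <= 1.
Proof. by rewrite ler_norml. Qed.

Lemma rr_mean01 i zs ws : 0 <= rr_mean f i zs ws <= 1.
Proof.
apply: rr_prob01; rewrite -ler_norml.
have iu := integrable_density_mul (um_x i zs ws) (fun x => u_norm i x zs ws).
apply: (le_trans (le_normr_Rintegral measurableT iu)).
rewrite -density_Rintegral; apply: le_Rintegral => //.
- by apply: (@eq_integrable _ _ _ _ _ measurableT _ _ _ (integrable_norm iu)).
- exact: density_integrable.
- by move=> x _; rewrite normrM (ger0_norm (f0 x)) ler_piMr// u_norm.
Qed.

Lemma int_cube_rr i zs ws (A B : R) : 0 <= A -> 0 <= B ->
  int_cube (fun x => (f x * ebit (rr_prob (u i x zs ws)) (fun b => if b then A else B))%:E)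
  = (ebit (rr_mean f i zs ws) (fun b => if b then A else B))%:E.
Proof.
move=> A0 B0; have [mf _] := df.
have iu := integrable_density_mul (um_x i zs ws) (fun x => u_norm i x zs ws).
have i1 : mu.-integrable setT (EFin \o (fun x => (A + B) / 2 * f x)).
  apply: (@eq_integrable _ _ _ _ _ measurableT (fun x => ((A + B) / 2)%:E * (EFin \o f) x)%E).
    by move=> x _; rewrite /= -EFinM.
  by apply: integrableZl => //; exact: density_integrable.
have i2 : mu.-integrable setT
    (EFin \o (fun x => eps / 8 * (A - B) * (f x * u i x zs ws))).
  apply: (@eq_integrable _ _ _ _ _ measurableT
    (fun x => (eps / 8 * (A - B))%:E * (EFin \o (fun x => f x * u i x zs ws)%R) x)%E).
    by move=> x _; rewrite /= -EFinM.
  exact: integrableZl.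
have e x : f x * ebit (rr_prob (u i x zs ws)) (fun b => if b then A else B) =
    (A + B) / 2 * f x + eps / 8 * (A - B) * (f x * u i x zs ws).
  by rewrite /ebit /rr_prob; field.
rewrite int_cubeE; last 2 first.
- apply/measurable_EFinP; under eq_fun do rewrite e.
  by apply: measurable_funD; apply: measurable_funM => //; apply: measurable_funM => //; exact: um_x.
- move=> x; rewrite lee_fin mulr_ge0//.
  have /andP[p0 p1] := rr_prob01 (u1 i x zs ws).
  by rewrite /ebit addr_ge0// mulr_ge0// subr_ge0.
have -> : (\int[mu]_x (f x * ebit (rr_prob (u i x zs ws))
    (fun b => if b then A else B))%:E)%E =
    (\int[mu]_x (EFin \o (fun x => ((A + B) / 2 * f x +
        eps / 8 * (A - B) * (f x * u i x zs ws))%R)) x)%E.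
  by apply: eq_integral => x _; rewrite e.
have i12 := integrableD measurableT i1 i2.
rewrite -[LHS]fineK; last exact: (integrable_fin_num measurableT i12).
congr EFin; rewrite -[LHS]/(\int[mu]_x ((A + B) / 2 * f x +
        eps / 8 * (A - B) * (f x * u i x zs ws))).
rewrite RintegralD// !RintegralZl//; last exact: density_integrable.
by rewrite density_Rintegral /rr_mean /ebit /rr_prob; field.
Qed.

End density.
End randomized_response.

Section law_of_releases.
Context {R : realType} {d n1 n2 : nat}.
Local Notation zst := (n1.-tuple bool).
Local Notation wst := (n2.-tuple bool).
Local Notation mu := (cube_prob (R := R) d).
Variable eps : R.
Hypothesis eps01 : 0 < eps <= 1.
Variable u : nat -> d.-tuple R -> zst -> wst -> R.
Hypothesis u1 : forall i x zs ws, -1 <= u i x zs ws <= 1.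
Hypothesis um : forall i, measurable_fun setT
  (fun p : d.-tuple R * (zst * wst) => u i p.1 p.2.1 p.2.2).
Variables fX fY : d.-tuple R -> R.
Hypotheses (fX0 : forall x, 0 <= fX x) (dX : is_density fX).
Hypotheses (fY0 : forall x, 0 <= fY x) (dY : is_density fY).
Local Notation Q := (rr_channel eps u).
Local Notation pX := (rr_mean eps u fX).
Local Notation pY := (rr_mean eps u fY).

Lemma integral_rr_channel i x zs ws (G : bool -> R) : (forall b, 0 <= G b) ->
  (\int[Q i x zs ws]_z (G z)%:E)%E = (ebit (rr_prob eps (u i x zs ws)) G)%:E.
Proof.
move=> G0; rewrite /rr_channel integral_bernoulli_prob//.
exact: rr_prob01.
Qed.

Lemma ebit_ge0 (p : R) (G : bool -> R) : 0 <= p <= 1 -> (forall b, 0 <= G b) ->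
  0 <= ebit p G.
Proof. by move=> /andP[p0 p1] G0; rewrite /ebit addr_ge0// mulr_ge0// subr_ge0. Qed.

Lemma int_cube_rr_fun (f : d.-tuple R -> R) i zs ws (G : bool -> R) :
  (forall x, 0 <= f x) -> is_density f -> (forall b, 0 <= G b) ->
  int_cube (fun x => (f x * ebit (rr_prob eps (u i x zs ws)) G)%:E)
  = (ebit (rr_mean eps u f i zs ws) G)%:E.
Proof.
move=> f0 df G0.
have -> : G = (fun b => if b then G true else G false) by apply/funext; case.
exact: int_cube_rr.
Qed.

Lemma bit_phase2_ge0 m zs ws g : (forall o, 0 <= g o) ->
  0 <= bit_phase2 pY m zs ws g.
Proof.
move=> g0; elim: m ws => [|m IH] ws //=.
by apply: ebit_ge0 => //; exact: rr_mean01.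
Qed.

Lemma bit_phase1_ge0 m zs ws g : (forall o, 0 <= g o) ->
  0 <= bit_phase1 pX pY m zs ws g.
Proof.
move=> g0; elim: m zs ws => [|m IH] zs ws /=; first exact: bit_phase2_ge0.
apply: ebit_ge0 => [|z]; first exact: rr_mean01.
by apply: ebit_ge0 => //; exact: rr_mean01.
Qed.

Lemma expect_out_rr (g : zst * wst -> R) : (forall o, 0 <= g o) ->
  expect_out Q Q fX fY (EFin \o g) = (bit_expect pX pY g)%:E.
Proof.
move=> g0.
have H2 m zs ws : phase2 Q fY (EFin \o g) m zs ws = (bit_phase2 pY m zs ws g)%:E.
  elim: m ws => [|m IH] ws //=.
  rewrite -int_cube_rr_fun//; last by move=> w; exact: bit_phase2_ge0.
  congr int_cube; apply/funext => y; rewrite EFinM; congr (_ * _)%E.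
  rewrite -integral_rr_channel//; last by move=> w; exact: bit_phase2_ge0.
  by apply: eq_integral => w _; exact: IH.
rewrite /expect_out /bit_expect.
suff H1 m zs ws : phase1 Q Q fX fY (EFin \o g) m zs ws =
    (bit_phase1 pX pY m zs ws g)%:E by exact: H1.
elim: m zs ws => [|m IH] zs ws /=; first exact: H2.
set i := (n1 - m.+1)%N.
pose G z w := bit_phase1 pX pY m (upd zs i z) (upd ws i w) g.
have G0 z w : 0 <= G z w by exact: bit_phase1_ge0.
have EG0 p z : 0 <= p <= 1 -> 0 <= ebit p (G z) by move=> p01; exact: ebit_ge0.
rewrite -/(G _ _).
rewrite -(@int_cube_rr_fun fX)//; last first.
  by move=> z; apply: EG0; exact: rr_mean01.
congr int_cube; apply/funext => x; rewrite EFinM; congr (_ * _)%E.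
(* [phase1] integrates over [y] before it draws [z], while the bit averages are nested as [z], then
   [w]. They are swapped to turn the [w] average into an integral over [y], then swapped back. *)
have -> : ebit (rr_prob eps (u i x zs ws)) (fun z => ebit (pY i zs ws) (G z)) =
    ebit (pY i zs ws) (fun w => ebit (rr_prob eps (u i x zs ws)) (G ^~ w)).
  by rewrite /ebit; ring.
rewrite -(@int_cube_rr_fun fY)//; last first.
  by move=> w; apply: ebit_ge0 => //; exact: rr_prob01.
congr int_cube; apply/funext => y; rewrite EFinM; congr (_ * _)%E.
have -> : ebit (rr_prob eps (u i y zs ws)) (fun w => ebit (rr_prob eps (u i x zs ws)) (G ^~ w)) =
    ebit (rr_prob eps (u i x zs ws)) (fun z => ebit (rr_prob eps (u i y zs ws)) (G z)).
  by rewrite /ebit; ring.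
rewrite -integral_rr_channel//; last by move=> z; apply: EG0; exact: rr_prob01.
apply: eq_integral => z _.
rewrite -integral_rr_channel//.
by apply: eq_integral => w _; exact: IH.
Qed.

End law_of_releases.

(** There are finitely many tuples, and each singleton is a finite intersection of coordinate
    cylinders. *)
Lemma measurable_tuple_bool n (A : set (n.-tuple bool)) : measurable A.
Proof.
have -> : A = \bigcup_(t in A) \bigcap_(i in [set: 'I_n])
    ((fun s : n.-tuple bool => tnth s i) @^-1` [set tnth t i]).
  apply/seteqP; split=> [t At|s [t At ts]]; first by exists t.
  suff -> : s = t by [].
  by apply: eq_from_tnth => i; exact: ts.
apply: fin_bigcup_measurable; first exact: finite_finset.
move=> t _; apply: fin_bigcap_measurable; first exact: finite_finset.
by move=> i _; rewrite -[X in measurable X]setTI; exact: measurable_tnth.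
Qed.

Lemma measurable_bool_outcomes n1 n2 (A : set (n1.-tuple bool * n2.-tuple bool)) :
  measurable A.
Proof.
have -> : A = \bigcup_(o in A) ([set o.1] `*` [set o.2]).
  apply/seteqP; split=> [p Ap|[s1 s2] [[t1 t2] At [/= -> ->]]]//.
  by exists p.
apply: fin_bigcup_measurable; first exact: finite_finset.
by move=> o _; apply: measurableX; exact: measurable_tuple_bool.
Qed.

(** * Fourier analysis on the cube *)

Section bounded_measurable.
Context {d : measure_display} {T : measurableType d} {R : realType}.

Definition bounded_mfun (f : T -> R) : Prop :=
  measurable_fun setT f /\ exists M, forall x, `|f x| <= M.

Lemma bounded_mfun_cst (a : R) : bounded_mfun (fun=> a).
Proof. by split; [exact: measurable_cst|exists `|a|]. Qed.

Lemma bounded_mfunD f g : bounded_mfun f -> bounded_mfun g ->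
  bounded_mfun (fun x => f x + g x).
Proof.
move=> [mf [M fM]] [mg [K gK]]; split; first exact: measurable_funD.
by exists (M + K) => x; rewrite (le_trans (ler_normD _ _))// lerD.
Qed.

Lemma bounded_mfunM f g : bounded_mfun f -> bounded_mfun g ->
  bounded_mfun (fun x => f x * g x).
Proof.
move=> [mf [M fM]] [mg [K gK]]; split; first exact: measurable_funM.
by exists (M * K) => x; rewrite normrM ler_pM.
Qed.

Lemma bounded_mfunZ a f : bounded_mfun f -> bounded_mfun (fun x => a * f x).
Proof. exact/bounded_mfunM/bounded_mfun_cst. Qed.

Lemma bounded_mfun_sum (I : Type) (r : seq I) (P : pred I) (f : I -> T -> R) :
  (forall i, bounded_mfun (f i)) -> bounded_mfun (fun x => \sum_(i <- r | P i) f i x).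
Proof.
move=> bf; elim: r => [|i r IH].
  by under eq_fun do rewrite big_nil; exact: bounded_mfun_cst.
under eq_fun do rewrite big_cons.
by case: (P i) => //; exact: bounded_mfunD.
Qed.

Lemma bounded_mfun_prod (I : Type) (r : seq I) (f : I -> T -> R) :
  (forall i, bounded_mfun (f i)) -> bounded_mfun (fun x => \prod_(i <- r) f i x).
Proof.
move=> bf; elim: r => [|i r IH].
  by under eq_fun do rewrite big_nil; exact: bounded_mfun_cst.
by under eq_fun do rewrite big_cons; exact: bounded_mfunM.
Qed.

Lemma bounded_mfun_integrable (mu : {finite_measure set T -> \bar R}) f :
  bounded_mfun f -> mu.-integrable setT (EFin \o f).
Proof.
move=> [mf [M fM]].
apply: (@le_integrable _ _ _ mu _ measurableT _ (EFin \o cst M)) => //.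
- exact/measurable_EFinP.
- by move=> x _ /=; rewrite lee_fin (le_trans (fM x)) ?ler_norm.
- exact: finite_measure_integrable_cst.
Qed.

End bounded_measurable.

Lemma bounded_mfun_comp d d' (T : measurableType d) (T' : measurableType d')
    (R : realType) (f : T -> R) (g : T' -> T) :
  bounded_mfun f -> measurable_fun setT g -> bounded_mfun (f \o g).
Proof.
by move=> [mf [M fM]] mg; split; [exact: measurableT_comp|exists M => x /=].
Qed.

Lemma Rintegral_prob_cst d (T : measurableType d) (R : realType)
  (P : probability T R) (a : R) : \int[P]_x a = a.
Proof.
rewrite /Rintegral integral_cst//=; set z := P _.
by have -> : z = 1%E by [exact: probability_setT]; rewrite mule1.
Qed.

Section trig_orthonormal.
Context {R : realType}.
Local Notation U := (unif01 (R := R)).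

Lemma int_unif01_bounded (f : R -> R) : measurable_fun setT f ->
  \int[U]_x f x = fine (\int[@lebesgue_measure R]_(x in `[0%R, 1%R]) (f x)%:E)%E.
Proof.
move=> mf; congr fine; rewrite integralE [in RHS]integralE.
have mE : measurable_fun setT (EFin \o f) by exact/measurable_EFinP.
by congr (_ - _)%E; apply: int_unif01 => //;
  [exact: measurable_funepos|exact: measurable_funeneg].
Qed.

Lemma Rintegral_unif01_FTC (f F : R -> R) :
  continuous f -> (forall x : R, is_derive x (1 : R) F (f x)) ->
  \int[U]_x f x = F 1 - F 0.
Proof.
move=> cf dF; rewrite int_unif01_bounded; last exact: continuous_measurable_fun.
rewrite (@continuous_FTC2 _ f F)//.
- by apply: continuous_subspaceT => x; exact: cf.
- have dFx x : derivable F x 1 by case: (dF x).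
  have cF x : {for x, continuous F}.
    exact/differentiable_continuous/derivable1_diffP.
  by split=> [x _||]; [exact: dFx|apply: cvg_at_right_filter; exact: cF|apply: cvg_at_left_filter; exact: cF].
- by move=> x _; rewrite derive1E; case: (dF x).
Qed.

Lemma is_derive_scale (w x : R) : is_derive x (1 : R) (fun y : R => w * y) w.
Proof.
have := @is_deriveZ _ _ _ id w x 1 1 (is_derive_id _ _).
by rewrite -[X in is_derive _ _ _ X -> _]/(w * 1) mulr1.
Qed.

Lemma continuous_scale (w : R) : continuous (fun y : R => w * y).
Proof. by move=> x; apply: cvgM; [exact: cvg_cst|exact: cvg_id]. Qed.

Lemma int_cos_scale (w : R) : w != 0 -> sin w = 0 ->
  \int[U]_x cos (w * x) = 0.
Proof.
move=> w0 sw.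
have dF (x : R) : is_derive x (1 : R) (fun x => w^-1 * sin (w * x)) (cos (w * x)).
  have := is_derive1_comp (is_derive_sin (w * x)) (is_derive_scale w x).
  move=> /(@is_deriveZ _ _ _ _ w^-1).
  by rewrite -[X in is_derive _ _ _ X -> _]/(w^-1 * (cos (w * x) * w)) mulrCA mulVf// mulr1.
rewrite (Rintegral_unif01_FTC _ dF).
  by rewrite mulr1 sw !mulr0 sin0 !mulr0 subrr.
by move=> x; apply: continuous_comp; [exact: continuous_scale|exact: continuous_cos].
Qed.

Lemma int_sin_scale (w : R) : w != 0 -> cos w = 1 ->
  \int[U]_x sin (w * x) = 0.
Proof.
move=> w0 sw.
have dF (x : R) : is_derive x (1 : R) (fun x => - w^-1 * cos (w * x)) (sin (w * x)).
  have := is_derive1_comp (is_derive_cos (w * x)) (is_derive_scale w x).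
  move=> /(@is_deriveZ _ _ _ _ (- w^-1)).
  rewrite -[X in is_derive _ _ _ X -> _]/(- w^-1 * (- sin (w * x) * w)).
  by rewrite !mulNr mulrN opprK mulrCA mulVf// mulr1.
rewrite (Rintegral_unif01_FTC _ dF).
  by rewrite mulr1 sw mulr0 cos0 subrr.
by move=> x; apply: continuous_comp; [exact: continuous_scale|exact: continuous_sin].
Qed.

(** [uphalf] gives the sine [2 j - 1] and the cosine [2 j] their common frequency [2 pi j]. *)
Definition freq (k : nat) : R := 2 * pi * (uphalf k)%:R.

Lemma freqE k : freq k = (uphalf k)%:R * (pi *+ 2).
Proof. by rewrite /freq mulrC (mulr_natl pi). Qed.

Lemma sin_freq k : sin (freq k) = 0.
Proof. by rewrite freqE mulr_natl -[_ *+ _]add0r periodicn ?sin0//; exact: sinD2pi. Qed.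

Lemma cos_freq k : cos (freq k) = 1.
Proof. by rewrite freqE mulr_natl -[_ *+ _]add0r periodicn ?cos0//; exact: cosD2pi. Qed.

Lemma eq_freq j k : (freq j == freq k) = (uphalf j == uphalf k).
Proof.
rewrite !freqE -subr_eq0 -mulrBl mulf_eq0 subr_eq0 eqr_nat orbC.
by rewrite mulrn_eq0/= gt_eqF ?pi_gt0.
Qed.

Lemma int_cosB j k : \int[U]_x cos ((freq j - freq k) * x) =
  (uphalf j == uphalf k)%:R.
Proof.
case: eqVneq => [e|ne].
  rewrite /freq e subrr; under eq_Rintegral do rewrite mul0r cos0.
  by rewrite Rintegral_prob_cst.
by rewrite int_cos_scale// ?subr_eq0 ?eq_freq// sinB !sin_freq mul0r mulr0 subrr.
Qed.

Lemma int_cosD j k : \int[U]_x cos ((freq j + freq k) * x) =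
  ((uphalf j == 0%N) && (uphalf k == 0%N))%:R.
Proof.
have e : (freq j + freq k == 0) = (uphalf j == 0%N) && (uphalf k == 0%N).
  rewrite !freqE -mulrDl mulf_eq0 -natrD pnatr_eq0 addn_eq0 orbC.
  by rewrite mulrn_eq0/= gt_eqF ?pi_gt0.
rewrite -e; case: eqVneq => [->|ne].
  under eq_Rintegral do rewrite mul0r cos0.
  by rewrite Rintegral_prob_cst.
by rewrite int_cos_scale// sinD !sin_freq mul0r mulr0 addr0.
Qed.

Lemma int_sinD j k : \int[U]_x sin ((freq j + freq k) * x) = 0.
Proof.
case: (eqVneq (freq j + freq k) 0) => [->|ne].
  under eq_Rintegral do rewrite mul0r sin0.
  by rewrite Rintegral_prob_cst.
by rewrite int_sin_scale// cosD !sin_freq !cos_freq mulr1 mulr0 subr0.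
Qed.

Lemma int_sinB j k : \int[U]_x sin ((freq j - freq k) * x) = 0.
Proof.
case: (eqVneq (freq j) (freq k)) => [->|ne].
  under eq_Rintegral do rewrite subrr mul0r sin0.
  by rewrite Rintegral_prob_cst.
by rewrite int_sin_scale// ?subr_eq0// cosB !sin_freq !cos_freq mulr1 mulr0 addr0.
Qed.

Lemma trig1E k (x : R) : trig1 k x = if k == 0%N then 1 else
  Num.sqrt 2 * (if odd k then sin (freq k * x) else cos (freq k * x)).
Proof.
rewrite /trig1 /freq; case: ifP => // k0; case: ifP => // ok.
by rewrite uphalf_half ok.
Qed.

Lemma continuous_trig1 k : continuous (trig1 k : R -> R).
Proof.
rewrite (_ : trig1 k = (fun y => if k == 0%N then 1 else
    Num.sqrt 2 * (if odd k then sin (freq k * y) else cos (freq k * y)))); last first.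
  by apply/funext => y; exact: trig1E.
move=> x; case: (k == 0%N); first exact: cvg_cst.
by case: (odd k); apply: cvgM; try exact: cvg_cst;
  apply: continuous_comp; try exact: continuous_scale;
  [exact: continuous_sin|exact: continuous_cos].
Qed.

Lemma trig1_le k (x : R) : `|trig1 k x| <= Num.sqrt 2.
Proof.
have s1 : 1 <= Num.sqrt (2 : R) by rewrite -[leLHS]sqrtr1 ler_wsqrtr// ler1n.
rewrite trig1E; case: ifP => _; first by rewrite normr1.
rewrite normrM (ger0_norm (sqrtr_ge0 _)) ler_piMr// ?sqrtr_ge0//.
by case: ifP => _; rewrite ler_norml ?sin_geN1 ?sin_le1 ?cos_geN1 ?cos_le1.
Qed.

Lemma bounded_trig1 k : bounded_mfun (trig1 k : R -> R).
Proof.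
split; first by apply: continuous_measurable_fun; exact: continuous_trig1.
by exists (Num.sqrt 2); exact: trig1_le.
Qed.

Lemma bounded_sin_scale (w : R) : bounded_mfun (fun x : R => sin (w * x)).
Proof.
split; last by exists 1 => x; rewrite ler_norml sin_geN1 sin_le1.
apply: continuous_measurable_fun => x.
by apply: continuous_comp; [exact: continuous_scale|exact: continuous_sin].
Qed.

Lemma bounded_cos_scale (w : R) : bounded_mfun (fun x : R => cos (w * x)).
Proof.
split; last by exists 1 => x; rewrite ler_norml cos_geN1 cos_le1.
apply: continuous_measurable_fun => x.
by apply: continuous_comp; [exact: continuous_scale|exact: continuous_cos].
Qed.

Lemma Rintegral_lincomb d (T : measurableType d)
    (P : {finite_measure set T -> \bar R}) (a b : R) (f g : T -> R) :
  bounded_mfun f -> bounded_mfun g ->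
  \int[P]_x (a * f x + b * g x) = a * \int[P]_x f x + b * \int[P]_x g x.
Proof.
move=> bf bg; rewrite RintegralD//; try exact/bounded_mfun_integrable/bounded_mfunZ.
by rewrite !RintegralZl//; exact: bounded_mfun_integrable.
Qed.

(** Product-to-sum formulas in the four parity cases; a sine or cosine integrates to 0 over full
    periods unless it is a cosine of frequency 0. *)
Lemma trig1_orthonormal j k : \int[U]_x (trig1 j x * trig1 k x) = (j == k)%:R.
Proof.
(* The constant is treated as a cosine of frequency 0, with amplitude 1 in place of [sqrt 2]. *)
pose amp (i : nat) : R := if i == 0%N then 1 else Num.sqrt 2.
have tE i x : trig1 i x = amp i * (if odd i then sin (freq i * x) else cos (freq i * x)).
  rewrite trig1E /amp; case: eqP => // ->.
  by rewrite /freq/= mulr0 mul0r cos0 mulr1.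
have uE i : odd i = odd i && (uphalf i != 0%N) by case: i => [|[|i]]; rewrite ?andbT.
have ijE : (j == k) = (odd j == odd k) && (uphalf j == uphalf k).
  apply/eqP/andP => [->|[/eqP o /eqP u]]; first by rewrite !eqxx.
  have hE i : i = ((uphalf i).*2 - odd i)%N.
    by rewrite -{1}(odd_double_half i) uphalf_half; case: (odd i) => /=; lia.
  by rewrite (hE j) (hE k) o u.
have a2 i : i != 0%N -> amp i * amp i = 2.
  by rewrite /amp => /negbTE->; rewrite -expr2 sqr_sqrtr.
under eq_Rintegral do rewrite !tE.
rewrite ijE.
have nz i : odd i -> i != 0%N by case: i.
case oj : (odd j); case ok : (odd k) => /=.
- under eq_Rintegral => x _.
    rewrite (_ : _ * _ = amp j * amp k / 2 * cos ((freq j - freq k) * x) +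
      - (amp j * amp k / 2) * cos ((freq j + freq k) * x)); last first.
      by rewrite mulrBl mulrDl cosB cosD; field.
    over.
  rewrite Rintegral_lincomb; try exact: bounded_cos_scale.
  rewrite int_cosB int_cosD.
  have /negbTE-> : uphalf j != 0%N by move: (uE j); rewrite oj /= => <-.
  rewrite mulr0 addr0; case: eqP => [e|_]; last by rewrite mulr0.
  have <- : j = k by apply/eqP; rewrite ijE oj ok e !eqxx.
  by rewrite a2 ?nz// mulr1 divff.
- under eq_Rintegral => x _.
    rewrite (_ : _ * _ = amp j * amp k / 2 * sin ((freq j - freq k) * x) +
      (amp j * amp k / 2) * sin ((freq j + freq k) * x)); last first.
      by rewrite mulrBl mulrDl sinB sinD; field.
    over.
  rewrite Rintegral_lincomb; try exact: bounded_sin_scale.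
  by rewrite int_sinB int_sinD !mulr0 addr0.
- under eq_Rintegral => x _.
    rewrite (_ : _ * _ = - (amp j * amp k / 2) * sin ((freq j - freq k) * x) +
      (amp j * amp k / 2) * sin ((freq j + freq k) * x)); last first.
      by rewrite mulrBl mulrDl sinB sinD; field.
    over.
  rewrite Rintegral_lincomb; try exact: bounded_sin_scale.
  by rewrite int_sinB int_sinD !mulr0 addr0.
- under eq_Rintegral => x _.
    rewrite (_ : _ * _ = amp j * amp k / 2 * cos ((freq j - freq k) * x) +
      (amp j * amp k / 2) * cos ((freq j + freq k) * x)); last first.
      by rewrite mulrBl mulrDl cosB cosD; field.
    over.
  rewrite Rintegral_lincomb; try exact: bounded_cos_scale.
  rewrite int_cosB int_cosD; case: eqP => [e|ne]; last first.
    rewrite mulr0 add0r; case: eqP => [uj0|_]; last by rewrite mulr0.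
    by case: eqP => [uk0|_]; [case: ne; rewrite uj0 uk0|rewrite mulr0].
  have <- : j = k by apply/eqP; rewrite ijE oj ok e !eqxx.
  have [j0|j0] := eqVneq j 0%N.
    by rewrite j0/= /amp/= !mulr1 mul1r; field.
  rewrite a2// andbb mulr1 divff// mul1r.
  have /negbTE-> : uphalf j != 0%N by case: j j0 {oj e ijE nz} => [|[|?]].
  by rewrite addr0.
Qed.

End trig_orthonormal.

Section trig_tensor.
Context {R : realType}.
Local Notation mu := (cube_prob (R := R)).

Lemma Rintegral_cube_probS k (F : k.+1.-tuple R -> R) : bounded_mfun F ->
  \int[mu k.+1]_t F t = \int[unif01 (R := R)]_x \int[mu k]_t F (cons_pair (x, t)).
Proof.
move=> bF; have [mF _] := bF.
have bFc := bounded_mfun_comp bF (@measurable_cons_pair R k).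
have iFc : (unif01 (R := R) \x mu k)%E.-integrable setT (EFin \o (F \o @cons_pair R k)).
  exact: (bounded_mfun_integrable [the probability _ _ of (unif01 (R := R) \x mu k)%E] bFc).
rewrite /Rintegral /= integral_distribution//; last exact/measurable_EFinP.
rewrite -integral12_prod_meas1//; congr fine; apply: eq_integral => x _.
rewrite /fubini_F fineK//.
have bx := bounded_mfun_comp bFc (measurable_pair1 x).
exact: (integrable_fin_num measurableT (bounded_mfun_integrable (mu k) bx)).
Qed.

Lemma bounded_trig d (l : d.-tuple nat) : bounded_mfun (trig l : d.-tuple R -> R).
Proof.
apply: bounded_mfun_prod => j.
exact: (bounded_mfun_comp (bounded_trig1 _) (measurable_tnth j)).
Qed.

Lemma trig_le d (l : d.-tuple nat) (x : d.-tuple R) : `|trig l x| <= Num.sqrt 2 ^+ d.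
Proof.
rewrite /trig normr_prod.
apply: (@le_trans _ _ (\prod_(j < d) Num.sqrt (2 : R))).
  by apply: ler_prod => j _; rewrite normr_ge0 trig1_le.
by rewrite prodr_const card_ord.
Qed.

Lemma trig_cons k (l : k.+1.-tuple nat) (p : R * k.-tuple R) :
  trig l (cons_pair p) = trig1 (thead l) p.1 * trig [tuple of behead l] p.2.
Proof.
rewrite /trig big_ord_recl; congr (_ * _); apply: eq_bigr => i _.
by rewrite [in LHS](tuple_eta l) !tnthS.
Qed.

Lemma trig_orthonormal d (l m : d.-tuple nat) :
  \int[mu d]_x (trig l x * trig m x) = (l == m)%:R.
Proof.
elim: d l m => [|k IH] l m.
  rewrite (tuple0 l) (tuple0 m) eqxx -[RHS](Rintegral_prob_cst (mu 0) 1).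
  by apply: eq_Rintegral => x _; rewrite /trig !big_ord0 mulr1.
rewrite Rintegral_cube_probS; last by apply: bounded_mfunM; exact: bounded_trig.
under eq_Rintegral => x _.
  under eq_Rintegral => t _.
    rewrite !trig_cons/= mulrACA.
    over.
  rewrite RintegralZl//; last first.
    by apply: bounded_mfun_integrable; apply: bounded_mfunM; exact: bounded_trig.
  rewrite IH.
  over.
rewrite RintegralZr//; last first.
  by apply: bounded_mfun_integrable; apply: bounded_mfunM; exact: bounded_trig1.
rewrite trig1_orthonormal -natrM mulnb; congr (nat_of_bool _)%:R.
apply/andP/eqP => [[/eqP h /eqP t]|->]; last by rewrite !eqxx.
rewrite [LHS]tuple_eta [RHS]tuple_eta; apply/val_inj => /=; rewrite h.
by congr (_ :: _); exact: (congr1 val t).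
Qed.

End trig_tensor.

Lemma Rintegral_sum_bounded d (T : measurableType d) (R : realType)
    (P : {finite_measure set T -> \bar R}) (I : Type) (r : seq I) (p : pred I)
    (f : I -> T -> R) : (forall i, bounded_mfun (f i)) ->
  \int[P]_x (\sum_(i <- r | p i) f i x) = \sum_(i <- r | p i) \int[P]_x f i x.
Proof.
move=> bf; elim: r => [|i r IH].
  under eq_Rintegral do rewrite big_nil.
  by rewrite big_nil Rintegral_cst// mul0r.
under eq_Rintegral do rewrite big_cons.
rewrite big_cons; case: (p i) => //.
rewrite RintegralD// ?IH//; apply: bounded_mfun_integrable => //.
exact: bounded_mfun_sum.
Qed.

Lemma Rintegral_sum_integrable d (T : measurableType d) (R : realType)
    (P : probability T R) (M : nat) (f : nat -> T -> R) :
  (forall i, P.-integrable setT (EFin \o f i)) ->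
  \int[P]_x (\sum_(i < M) f i x) = \sum_(i < M) \int[P]_x f i x.
Proof.
move=> fi; suff [] : P.-integrable setT (EFin \o (fun x => \sum_(i < M) f i x)) /\
  \int[P]_x (\sum_(i < M) f i x) = \sum_(i < M) \int[P]_x f i x by [].
elim: M => [|M [iM eM]].
  rewrite big_ord0 (_ : (fun x => _) = (fun=> 0)); last first.
    by apply/funext => x; rewrite big_ord0.
  split; first exact/bounded_mfun_integrable/bounded_mfun_cst.
  by rewrite Rintegral_cst// mul0r.
rewrite (_ : (fun x => _) = (fun x => \sum_(i < M) f i x + f M x)); last first.
  by apply/funext => x; rewrite big_ord_recr.
split; first by apply: eq_integrable (integrableD measurableT iM (fi M)).
by rewrite RintegralD// eM [RHS]big_ord_recr.
Qed.

Lemma lt_tnth_ord_idx d N (l : d.-tuple 'I_N) j : (tnth (ord_idx l) j < N)%N.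
Proof. by rewrite tnth_map. Qed.

Lemma ord_idx_inj d N : injective (@ord_idx d N).
Proof.
move=> l m e; apply: eq_from_tnth => j; apply: val_inj.
by have := congr1 (fun t => tnth t j) e; rewrite !tnth_map.
Qed.

Lemma ord_idx_onto d N (l : d.-tuple nat) : (forall j, tnth l j < N)%N ->
  exists m : d.-tuple 'I_N, ord_idx m = l.
Proof.
move=> lN; exists [tuple Ordinal (lN j) | j < d].
by apply: eq_from_tnth => j; rewrite tnth_map tnth_mktuple.
Qed.

(** * Square-integrable functions and limits of trigonometric sums *)

Section square_integrable.
Context {d : measure_display} {T : measurableType d} {R : realType}.
Variable P : probability T R.

Definition sq_integrable (f : T -> R) : Prop :=
  measurable_fun setT f /\ P.-integrable setT (EFin \o (fun x => f x ^+ 2)).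

Lemma le_integrableR (f g : T -> R) : measurable_fun setT f ->
  (forall x, `|f x| <= g x) -> P.-integrable setT (EFin \o g) ->
  P.-integrable setT (EFin \o f).
Proof.
move=> mf fg ig; apply: (le_integrable measurableT) ig.
- exact/measurable_EFinP.
- by move=> x _ /=; rewrite lee_fin (le_trans (fg x)) ?ler_norm.
Qed.

Lemma integrableDR (f g : T -> R) : P.-integrable setT (EFin \o f) ->
  P.-integrable setT (EFin \o g) -> P.-integrable setT (EFin \o (fun x => f x + g x)).
Proof. by move=> fi gi; apply: eq_integrable (integrableD measurableT fi gi). Qed.

Lemma integrableZR (a : R) (f : T -> R) : P.-integrable setT (EFin \o f) ->
  P.-integrable setT (EFin \o (fun x => a * f x)).
Proof.
move=> fi; apply: eq_integrable (integrableZl measurableT a fi) => //.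
Qed.

Lemma sq_integrable_bounded f : bounded_mfun f -> sq_integrable f.
Proof.
move=> bf; split; first by case: bf.
by apply: bounded_mfun_integrable; apply: bounded_mfunM.
Qed.

Lemma sq_integrableD f g : sq_integrable f -> sq_integrable g ->
  sq_integrable (fun x => f x + g x).
Proof.
move=> [mf fi] [mg gi]; split; first exact: measurable_funD.
apply: (le_integrableR (g := fun x => 2 * (f x ^+ 2) + 2 * (g x ^+ 2))).
- by apply: measurable_funX; exact: measurable_funD.
- move=> x; rewrite ger0_norm ?sqr_ge0//; have := sqr_ge0 (f x - g x); nra.
- by apply: integrableDR; apply: integrableZR.
Qed.

Lemma sq_integrableM f g : sq_integrable f -> sq_integrable g ->
  P.-integrable setT (EFin \o (fun x => f x * g x)).
Proof.
move=> [mf fi] [mg gi].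
apply: (le_integrableR (g := fun x => f x ^+ 2 + g x ^+ 2)).
- exact: measurable_funM.
- move=> x; rewrite ler_norml; have := sqr_ge0 (f x - g x).
  by have := sqr_ge0 (f x + g x); move=> ? ?; apply/andP; split; nra.
- exact: integrableDR.
Qed.

Lemma sq_integrable_integrable f : sq_integrable f -> P.-integrable setT (EFin \o f).
Proof.
move=> sf; have b1 := sq_integrable_bounded (bounded_mfun_cst (1 : R)).
by apply: eq_integrable (sq_integrableM sf b1) => // x _ /=; rewrite mulr1.
Qed.

Lemma le_RintegralR (f g : T -> R) : P.-integrable setT (EFin \o f) ->
  P.-integrable setT (EFin \o g) -> (forall x, f x <= g x) ->
  \int[P]_x f x <= \int[P]_x g x.
Proof. by move=> fi gi fg; apply: le_Rintegral. Qed.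

(** Cauchy-Schwarz as a weighted arithmetic-geometric mean inequality: the free parameter [t]
    replaces square roots and avoids dividing by a norm that may vanish. *)
Lemma Rintegral_mul_le f g t : 0 < t -> sq_integrable f -> sq_integrable g ->
  `|\int[P]_x (f x * g x)| <=
    (t^-1 * \int[P]_x (f x ^+ 2) + t * \int[P]_x (g x ^+ 2)) / 2.
Proof.
move=> t0 sf sg; have ifg := sq_integrableM sf sg.
apply: (le_trans (le_normr_Rintegral measurableT ifg)).
have [[mf fi] [mg gi]] := (sf, sg).
have i1 := integrableZR (t^-1 / 2) fi; have i2 := integrableZR (t / 2) gi.
apply: (@le_trans _ _ (\int[P]_x (t^-1 / 2 * f x ^+ 2 + t / 2 * g x ^+ 2))).
  apply: le_RintegralR; [|exact: integrableDR|].
    by apply: eq_integrable (integrable_norm ifg).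
  move=> x; rewrite normrM -!(real_normK (num_real (f x))) -!(real_normK (num_real (g x))).
  set a := `|f x|; set b := `|g x|.
  have := sqr_ge0 (a - t * b); have ti : 0 < t^-1 by rewrite invr_gt0.
  have tt : t^-1 * t = 1 by rewrite mulVf// gt_eqF.
  move=> h; have : 0 <= t^-1 * (a - t * b) ^+ 2 by rewrite mulr_ge0// ltW.
  have -> : t^-1 * (a - t * b) ^+ 2 = t^-1 * a ^+ 2 - 2 * (t^-1 * t) * (a * b) + (t^-1 * t) * t * b ^+ 2 by ring.
  rewrite tt; lra.
rewrite RintegralD// !RintegralZl//; lra.
Qed.

End square_integrable.

Section trig_approximation.
Context {R : realType} {d : nat}.
Local Notation mu := (cube_prob (R := R) d).

Definition trig_sum (delta : d.-tuple nat -> R) (N : nat) (x : d.-tuple R) : R :=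
  \sum_(l : d.-tuple 'I_N.+1) delta (ord_idx l) * trig (ord_idx l) x.

Lemma bounded_trig_sum delta N : bounded_mfun (trig_sum delta N).
Proof. by apply: bounded_mfun_sum => l; apply: bounded_mfunZ; exact: bounded_trig. Qed.

Lemma trig_sum_coef delta N (m : d.-tuple 'I_N.+1) :
  \int[mu]_x (trig_sum delta N x * trig (ord_idx m) x) = delta (ord_idx m).
Proof.
under eq_Rintegral do rewrite /trig_sum mulr_suml.
rewrite Rintegral_sum_bounded; last first.
  move=> l; apply: bounded_mfunM; last exact: bounded_trig.
  by apply: bounded_mfunZ; exact: bounded_trig.
under eq_bigr => l _.
  under eq_Rintegral do rewrite -mulrA.
  rewrite RintegralZl//; last first.
    by apply: bounded_mfun_integrable; apply: bounded_mfunM; exact: bounded_trig.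
  rewrite trig_orthonormal (inj_eq (@ord_idx_inj _ _)).
  over.
rewrite (bigD1 m)//= eqxx mulr1 big1 ?addr0// => l /negbTE->.
by rewrite mulr0.
Qed.

Lemma trig_sum_norm delta N :
  \int[mu]_x (trig_sum delta N x ^+ 2) = \sum_(l : d.-tuple 'I_N.+1) delta (ord_idx l) ^+ 2.
Proof.
transitivity (\int[mu]_x \sum_(l : d.-tuple 'I_N.+1)
    delta (ord_idx l) * (trig_sum delta N x * trig (ord_idx l) x)).
  apply: eq_Rintegral => x _; rewrite expr2 {2}/trig_sum mulr_sumr.
  by apply: eq_bigr => l _; ring.
have bl l : bounded_mfun (fun x => trig_sum delta N x * trig l x).
  by apply: bounded_mfunM; [exact: bounded_trig_sum|exact: bounded_trig].
rewrite Rintegral_sum_bounded => [|l]; last exact: bounded_mfunZ.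
apply: eq_bigr => l _; rewrite RintegralZl//; last exact: bounded_mfun_integrable.
by rewrite trig_sum_coef expr2.
Qed.

Section limit.
Variables (h : d.-tuple R -> R) (delta : d.-tuple nat -> R).
Hypothesis mh : measurable_fun setT h.
Hypothesis h_lim : forall eta : R, 0 < eta -> exists N0, forall N, (N0 <= N)%N ->
  (\int[mu]_x ((h x - trig_sum delta N x) ^+ 2)%:E <= eta%:E)%E.

Let mhN N : measurable_fun setT (fun x => h x - trig_sum delta N x).
Proof. by apply: measurable_funB => //; case: (bounded_trig_sum delta N). Qed.

Lemma trig_rest_sq_integrable N : (\int[mu]_x ((h x - trig_sum delta N x) ^+ 2)%:E < +oo)%E ->
  sq_integrable mu (fun x => h x - trig_sum delta N x).
Proof.
move=> lty; split=> //; apply/integrableP; split.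
  by apply/measurable_EFinP; exact: measurable_funX.
apply: le_lt_trans lty; rewrite le_eqVlt; apply/orP; left; apply/eqP.
by apply: eq_integral => x _ /=; rewrite ger0_norm ?sqr_ge0.
Qed.

Lemma trig_lim_rest (eta : R) : 0 < eta -> exists N0, forall N, (N0 <= N)%N ->
  sq_integrable mu (fun x => h x - trig_sum delta N x) /\
  \int[mu]_x ((h x - trig_sum delta N x) ^+ 2) <= eta.
Proof.
move=> eta0; have [N0 hN] := h_lim eta0; exists N0 => N /hN le.
have sq := trig_rest_sq_integrable (le_lt_trans le (ltry _)).
split=> //; rewrite -lee_fin; apply: le_trans le.
by rewrite /Rintegral fineK// (integrable_fin_num measurableT)//; case: sq.
Qed.

Lemma trig_lim_sq_integrable : sq_integrable mu h.
Proof.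
have [N0 hN] := trig_lim_rest ltr01; have [sq _] := hN N0 (leqnn _).
have st := sq_integrable_bounded mu (bounded_trig_sum delta N0).
have := sq_integrableD sq st; congr sq_integrable.
by apply/funext => x; rewrite subrK.
Qed.

(** A partial sum has the exact coefficient once it contains [l]; a rest of squared norm at most
    [t ^ 2] then contributes an error of at most [t]. *)
Lemma trig_lim_coef l : \int[mu]_x (h x * trig l x) = delta l.
Proof.
have sh := trig_lim_sq_integrable.
have st := sq_integrable_bounded mu (bounded_trig l).
apply/eqP; rewrite -subr_eq0 -normr_le0; apply/ler_addgt0Pr => t t0; rewrite add0r.
have [N0 hN] := trig_lim_rest (exprn_gt0 2 t0).
(* The sum of the entries of [l] bounds each of them, so [l] is among the frequencies up to [N]. *)
pose N := maxn N0 (\sum_(j < d) tnth l j).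
have [sq leN] := hN N (leq_maxl _ _).
have [m em] : exists m : d.-tuple 'I_N.+1, ord_idx m = l.
  apply: ord_idx_onto => j; rewrite ltnS /N leq_max; apply/orP; right.
  by rewrite (bigD1 j)//= leq_addr.
have sN := sq_integrable_bounded mu (bounded_trig_sum delta N).
rewrite -{2}em -(trig_sum_coef delta) em -RintegralB//; try exact: sq_integrableM.
under eq_Rintegral do rewrite -mulrBl.
apply: (le_trans (Rintegral_mul_le t0 sq st)).
rewrite [X in t * X](_ : _ = 1); last first.
  under eq_Rintegral do rewrite expr2.
  by rewrite trig_orthonormal eqxx.
have := ler_wpM2l (ltW (_ : 0 < t^-1)) leN; rewrite invr_gt0 => /(_ t0).
rewrite expr2 mulrA mulVf ?gt_eqF// mul1r; lra.
Qed.

(** The upper half of Parseval's identity, from [h ^ 2 <= (1 + 1/t) (h - S) ^ 2 + (1 + t) S ^ 2]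
    with [S] a partial sum. *)
Lemma trig_lim_norm (B : R) :
  (forall N, \sum_(l : d.-tuple 'I_N.+1) delta (ord_idx l) ^+ 2 <= B) ->
  \int[mu]_x (h x ^+ 2) <= B.
Proof.
move=> hB; have B0 : 0 <= B by apply: le_trans (hB 0%N); apply: sumr_ge0 => l _; exact: sqr_ge0.
apply/ler_addgt0Pr => e e0.
(* A rest of at most [t ^ 2] contributes [t ^ 2 + t]; added to [(1 + t) B] this stays below
   [B + t (B + 2)] when [t <= 1]. *)
pose t : R := Num.min 1 (e / (B + 2)).
have t0 : 0 < t by rewrite lt_min ltr01 divr_gt0// ltr_wpDl.
have t1 : t <= 1 by rewrite ge_min lexx.
have te : t * (B + 2) <= e by rewrite -ler_pdivlMr ?ltr_wpDl// ge_min lexx orbT.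
have [N0 hN] := trig_lim_rest (exprn_gt0 2 t0).
have [sq leN] := hN N0 (leqnn _).
have sN := sq_integrable_bounded mu (bounded_trig_sum delta N0).
have [[_ i1] [_ i2]] := (sq, sN).
apply: (@le_trans _ _ (\int[mu]_x ((1 + t^-1) * (h x - trig_sum delta N0 x) ^+ 2 +
   (1 + t) * trig_sum delta N0 x ^+ 2))).
  apply: le_RintegralR.
  - by case: trig_lim_sq_integrable.
  - by apply: integrableDR; apply: integrableZR.
  - move=> x; set a := h x; set b := trig_sum _ _ _.
    have ti : t^-1 * t = 1 by rewrite mulVf// gt_eqF.
    have : 0 <= t^-1 * ((a - b) - t * b) ^+ 2 by rewrite mulr_ge0 ?sqr_ge0// invr_ge0 ltW.
    have -> : t^-1 * ((a - b) - t * b) ^+ 2 = t^-1 * (a - b) ^+ 2 -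
      2 * (t^-1 * t) * ((a - b) * b) + (t^-1 * t) * t * b ^+ 2 by ring.
    by rewrite ti; nra.
rewrite RintegralD//; try exact: integrableZR.
rewrite !RintegralZl// trig_sum_norm.
have h1 := hB N0; set S := \sum_l _ in h1 *; set Q := \int[mu]_x _ in leN *.
have ti : t^-1 * t = 1 by rewrite mulVf// gt_eqF.
have ti0 : 0 < t^-1 by rewrite invr_gt0.
have : (1 + t^-1) * Q <= (1 + t^-1) * t ^+ 2 by rewrite ler_wpM2l// ltW// ltr_wpDl.
have -> : (1 + t^-1) * t ^+ 2 = t ^+ 2 + (t^-1 * t) * t by ring.
rewrite ti mul1r => hQ.
have : (1 + t) * S <= (1 + t) * B by rewrite ler_wpM2l// ltW// ltr_wpDl.
nra.
Qed.

End limit.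
End trig_approximation.

(** * Fourier energy and the Sobolev tail *)

Definition energy {R : realType} d (delta : d.-tuple nat -> R) (K : nat) : R :=
  \sum_(l : d.-tuple 'I_K) delta (ord_idx l) ^+ 2.

Lemma tuple_sum_split (R : realType) d K K' (F : d.-tuple nat -> R) : (K <= K')%N ->
  \sum_(l : d.-tuple 'I_K') F (ord_idx l) = \sum_(l : d.-tuple 'I_K) F (ord_idx l) +
  \sum_(l : d.-tuple 'I_K' | ~~ [forall j, (tnth (ord_idx l) j < K)%N]) F (ord_idx l).
Proof.
move=> KK'; rewrite (bigID (fun l : d.-tuple 'I_K' => [forall j, (tnth (ord_idx l) j < K)%N]))/=.
congr (_ + _); pose w (m : d.-tuple 'I_K) := map_tuple (widen_ord KK') m.
have wE m : ord_idx (w m) = ord_idx m.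
  by apply: eq_from_tnth => j; rewrite !tnth_map.
have wI : injective w.
  by move=> m m' /(congr1 (@ord_idx _ _)); rewrite !wE; exact: ord_idx_inj.
transitivity (\sum_(l in (w @: predT)%SET) F (ord_idx l)).
  apply: eq_bigl => l; apply/forallP/imsetP => [lK|[m _ ->] j].
    have [m em] := ord_idx_onto lK; exists m => //.
    by apply: (@ord_idx_inj _ _); rewrite wE.
  by rewrite wE lt_tnth_ord_idx.
rewrite big_imset/=; last by move=> ? ? _ _; exact: wI.
by apply: eq_bigr => m _; rewrite wE.
Qed.

Lemma le_energy (R : realType) d (delta : d.-tuple nat -> R) K K' : (K <= K')%N ->
  energy delta K <= energy delta K'.
Proof.
move=> KK'; rewrite /energy (tuple_sum_split (fun l => delta l ^+ 2) KK') lerDl.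
by apply: sumr_ge0 => l _; exact: sqr_ge0.
Qed.

Lemma energy_ge0 (R : realType) d (delta : d.-tuple nat -> R) K : 0 <= energy delta K.
Proof. by apply: sumr_ge0 => l _; exact: sqr_ge0. Qed.

Lemma le_idx_norm (R : realType) d (l : d.-tuple nat) j : (tnth l j)%:R <= idx_norm R l.
Proof.
rewrite /idx_norm -[leLHS]ger0_norm// -sqrtr_sqr; apply: ler_wsqrtr.
by rewrite (bigD1 j)//= lerDl; apply: sumr_ge0 => i _; exact: sqr_ge0.
Qed.

Lemma near_le_of_cvg0 (R : realType) (a : nat -> \bar R) : (a @ \oo --> 0%E)%classic ->
  forall eta : R, 0 < eta -> exists N0, forall N, (N0 <= N)%N -> (a N <= eta%:E)%E.
Proof.
move=> ca eta eta0.
have [N0 _ hN] : \forall N \near \oo, (a N < eta%:E)%E.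
  exact: (ca _ (@nbhs_open_ereal_lt _ 0 (fun=> eta) eta0)).
by exists N0 => N /hN /ltW.
Qed.

Section sobolev_difference.
Context {R : realType} {d : nat}.
Local Notation mu := (cube_prob (R := R) d).
Variables (s r : R) (f g : d.-tuple R -> R).
Hypothesis s0 : 0 < s.
Hypotheses (mf : measurable_fun setT f) (mg : measurable_fun setT g).
Hypotheses (Sf : sobolev_S s r f) (Sg : sobolev_S s r g).

Lemma measurable_trig_partial theta N :
  measurable_fun setT (trig_partial theta N : d.-tuple R -> R).
Proof.
suff [] : bounded_mfun (trig_partial theta N : d.-tuple R -> R) by [].
apply: bounded_mfunD; first exact: bounded_mfun_cst.
by apply: bounded_mfun_sum => l; apply: bounded_mfunZ; exact: bounded_trig.
Qed.

(** The constant terms 1 cancel, so the difference has no zero frequency, and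
    [(a - b) ^ 2 <= 2 a ^ 2 + 2 b ^ 2] turns the two radii into [4 r ^ 2]. *)
Lemma sobolev_difference_coef : exists delta : d.-tuple nat -> R,
  [/\ forall l, ~~ nonzero_idx l -> delta l = 0,
      forall N, \sum_(l : d.-tuple 'I_N.+1)
        idx_norm R (ord_idx l) `^ (2 * s) * delta (ord_idx l) ^+ 2 <= 4 * r ^+ 2 &
      forall eta : R, 0 < eta -> exists N0, forall N, (N0 <= N)%N ->
        (\int[mu]_x (((f x - g x) - trig_sum delta N x) ^+ 2)%:E <= eta%:E)%E].
Proof.
have [[tf [bf cf]] [tg [bg cg]]] := (Sf, Sg).
pose delta l := if nonzero_idx l then tf l - tg l else 0.
have d0 l : ~~ nonzero_idx l -> delta l = 0 by rewrite /delta => /negbTE->.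
exists delta; split=> // [N|eta eta0].
  rewrite (bigID (fun l : d.-tuple 'I_N.+1 => nonzero_idx (ord_idx l)))/= addrC big1 ?add0r; last first.
    by move=> l /d0 ->; rewrite expr0n/= mulr0.
  apply: (@le_trans _ _ (\sum_(l : d.-tuple 'I_N.+1 | nonzero_idx (ord_idx l))
      (2 * (idx_norm R (ord_idx l) `^ (2 * s) * tf (ord_idx l) ^+ 2) +
       2 * (idx_norm R (ord_idx l) `^ (2 * s) * tg (ord_idx l) ^+ 2)))).
    apply: ler_sum => l nl; rewrite /delta nl.
    have p0 := powR_ge0 (idx_norm R (ord_idx l)) (2 * s).
    have := mulr_ge0 p0 (sqr_ge0 (tf (ord_idx l) + tg (ord_idx l))).
    lra.
  rewrite big_split/= -!mulr_sumr; have := bf N; have := bg N; lra.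
have e4 : 0 < eta / 4 by rewrite divr_gt0.
have [N1 h1] := near_le_of_cvg0 cf e4; have [N2 h2] := near_le_of_cvg0 cg e4.
exists (maxn N1 N2) => N; rewrite geq_max => /andP[/h1 {}h1 /h2 {}h2].
have mF : measurable_fun setT (fun x => (f x - trig_partial tf N x) ^+ 2).
  by apply: measurable_funX; apply: measurable_funB => //; exact: measurable_trig_partial.
have mG : measurable_fun setT (fun x => (g x - trig_partial tg N x) ^+ 2).
  by apply: measurable_funX; apply: measurable_funB => //; exact: measurable_trig_partial.
rewrite int_cubeE in h1; [|exact/measurable_EFinP|by move=> x; rewrite lee_fin sqr_ge0].
rewrite int_cubeE in h2; [|exact/measurable_EFinP|by move=> x; rewrite lee_fin sqr_ge0].
apply: (@le_trans _ _ (\int[mu]_x (2%:E * ((f x - trig_partial tf N x) ^+ 2)%:E +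
   2%:E * ((g x - trig_partial tg N x) ^+ 2)%:E))%E).
  apply: ge0_le_integral => //.
  - by move=> x _; rewrite lee_fin sqr_ge0.
  - apply/measurable_EFinP; apply: measurable_funX; apply: measurable_funB.
      exact: measurable_funB.
    by case: (bounded_trig_sum delta N).
  - by apply/measurable_EFinP; apply: measurable_funD; apply: measurable_funM.
  - move=> x _; rewrite -!EFinM -EFinD lee_fin.
    have -> : trig_sum delta N x = trig_partial tf N x - trig_partial tg N x.
      rewrite /trig_sum (bigID (fun l : d.-tuple 'I_N.+1 => nonzero_idx (ord_idx l)))/=.
      rewrite addrC big1 ?add0r; last by move=> l /d0 ->; rewrite mul0r.
      rewrite /trig_partial opprD addrACA subrr add0r -sumrB.
      by apply: eq_bigr => l nl; rewrite /delta nl mulrBl.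
    set a := f x; set b := g x; set p := trig_partial _ _ _; set q := trig_partial _ _ _.
    have := sqr_ge0 ((a - p) + (b - q)); lra.
rewrite ge0_integralD//; last 4 first.
- by move=> x _; rewrite -EFinM lee_fin mulr_ge0// sqr_ge0.
- by apply/measurable_EFinP; apply: measurable_funM.
- by move=> x _; rewrite -EFinM lee_fin mulr_ge0// sqr_ge0.
- by apply/measurable_EFinP; apply: measurable_funM.
rewrite !ge0_integralZl//; try by [move=> x _; rewrite lee_fin sqr_ge0|exact/measurable_EFinP].
apply: (@le_trans _ _ (2%:E * (eta / 4)%:E + 2%:E * (eta / 4)%:E)%E).
  by apply: leeD; apply: lee_wpmul2l; rewrite ?lee_fin.
by rewrite -!EFinM -EFinD lee_fin; lra.
Qed.

Definition coef_diff (l : d.-tuple nat) : R := \int[mu]_x ((f x - g x) * trig l x).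

(** A nonzero index has norm at least 1, so the weighted bound also bounds the plain energy. An
    index outside the box of side [K] has an entry, hence a Euclidean norm, of at least [K], which
    yields the bias [K ^ (- 2 s)]. *)
Theorem sobolev_difference : [/\ sq_integrable mu (fun x => f x - g x),
   \int[mu]_x ((f x - g x) ^+ 2) <= 4 * r ^+ 2,
   forall K, energy coef_diff K <= 4 * r ^+ 2 &
   forall K, (0 < K)%N -> \int[mu]_x ((f x - g x) ^+ 2) <=
     energy coef_diff K + 4 * r ^+ 2 * K%:R `^ (- (2 * s))].
Proof.
have [delta [d0 bd lim]] := sobolev_difference_coef.
have mh : measurable_fun setT (fun x => f x - g x) by exact: measurable_funB.
have eD : coef_diff = delta by apply/funext => l; exact: (trig_lim_coef mh lim).
have p1 (l : d.-tuple nat) : nonzero_idx l -> 1 <= idx_norm R l `^ (2 * s).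
  move=> /existsP[j lj]; rewrite -[leLHS](_ : 1 `^ (2 * s) = 1); last by rewrite powR1.
   apply: ge0_ler_powR.
  - by rewrite mulr_ge0// ltW.
  - by rewrite nnegrE.
  - by rewrite nnegrE sqrtr_ge0.
  - by apply: le_trans (le_idx_norm R l j); rewrite ler1n lt0n.
have E1 K : energy delta K <= 4 * r ^+ 2.
  apply: le_trans (le_energy delta (leqnSn K)) _; apply: le_trans (bd K).
  apply: ler_sum => l _; have [nl|/d0 ->] := boolP (nonzero_idx (ord_idx l)).
    by rewrite ler_peMl ?sqr_ge0// p1.
  by rewrite expr0n mulr0.
split=> //.
- exact: trig_lim_sq_integrable mh lim.
- by apply: (trig_lim_norm mh lim) => N; exact: E1.
- by move=> K; rewrite eD.
- move=> K K0; apply: (trig_lim_norm mh lim) => N; rewrite eD.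
  have b0 : 0 <= 4 * r ^+ 2 * K%:R `^ (- (2 * s)).
    by rewrite mulr_ge0 ?powR_ge0// mulr_ge0// sqr_ge0.
  have [le|/ltnW le] := leqP K N.+1; last first.
    by apply: le_trans (le_energy delta le) _; rewrite lerDl.
  rewrite (tuple_sum_split (fun l => delta l ^+ 2) le) lerD2l.
  have Kp : 0 < K%:R `^ (2 * s) :> R by apply: powR_gt0; rewrite ltr0n.
  rewrite powRN ler_pdivlMr//; apply: le_trans (bd N).
  rewrite mulr_suml [leRHS](bigID (fun l : d.-tuple 'I_N.+1 => [forall j, (tnth (ord_idx l) j < K)%N]))/=.
  rewrite -[leLHS]add0r; apply: lerD.
    by apply: sumr_ge0 => l _; rewrite mulr_ge0 ?powR_ge0 ?sqr_ge0.
  apply: ler_sum => l; rewrite negb_forall => /existsP[j]; rewrite -leqNgt => Kj.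
  rewrite mulrC ler_wpM2r ?sqr_ge0//; apply: ge0_ler_powR.
  - by rewrite mulr_ge0// ltW.
  - by rewrite nnegrE.
  - by rewrite nnegrE sqrtr_ge0.
  - by apply: le_trans (le_idx_norm R _ j); rewrite ler_nat.
Qed.

End sobolev_difference.

(** * Comparison of the Lp and L2 distances *)

Lemma expR_convex_le {R : realType} (t z : R) : 0 <= t <= 1 ->
  expR (t * z) <= 1 - t + t * expR z.
Proof.
move=> /andP[t0 t1]; set w := expR (t * z).
have w0 : 0 < w by exact: expR_gt0.
have h1 : w * (1 - t * z) <= 1.
  have e : w * expR (- (t * z)) = 1 by rewrite -expRD subrr expR0.
  rewrite -[leRHS]e.
  by rewrite (ler_wpM2l (ltW w0))// expR_ge1Dx.
have h2 : w * (1 + (1 - t) * z) <= expR z.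
  rewrite [leRHS](_ : _ = w * expR ((1 - t) * z)).
    by rewrite (ler_wpM2l (ltW w0))// expR_ge1Dx.
  by rewrite /w -expRD; congr expR; ring.
(* The two tangent bounds at [t z] are combined with weights [1 - t] and [t], for which their linear
   terms cancel. *)
have := ler_wpM2l t0 h2; have := ler_wpM2l (_ : 0 <= 1 - t) h1.
rewrite subr_ge0 => /(_ t1); nra.
Qed.

(* Convexity of [q |-> a ^ q] between [q = 0] and [q = 2]. *)
Lemma powR_le_sq {R : realType} (p a : R) : 1 <= p <= 2 -> 0 <= a ->
  a `^ p <= 1 - p / 2 + p / 2 * a ^+ 2.
Proof.
move=> /andP[p1 p2]; rewrite le_eqVlt => /predU1P[<-|a0].
  by rewrite powR0 ?gt_eqF ?(lt_le_trans _ p1)// expr0n/=; lra.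
have {2}-> : a = expR (ln a) by rewrite lnK.
rewrite -expRM_natl /powR gt_eqF//.
have -> : p * ln a = p / 2 * (2 * ln a) by field.
by apply: expR_convex_le; lra.
Qed.

Lemma powR_norm_le_sq {R : realType} (p rho a : R) : 1 <= p <= 2 -> 0 < rho ->
  `|a| `^ p <= rho `^ p * (1 - p / 2) + rho `^ p * (p / 2) * rho ^- 2 * a ^+ 2.
Proof.
move=> p12 rho0; have a0 : 0 <= `|a| / rho by rewrite divr_ge0// ltW.
have := ler_wpM2r (powR_ge0 rho p) (powR_le_sq p12 a0).
rewrite -powRM//; last exact: ltW.
rewrite divfK ?gt_eqF// expr_div_n real_normK ?num_real// => h.
apply: (le_trans h); rewrite le_eqVlt; apply/orP; left; apply/eqP.
rewrite mulrDl [X in X + _]mulrC; congr (_ + _).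
by rewrite [LHS]mulrC [X in p / 2 * X]mulrC !mulrA.
Qed.

(** Jensen's inequality in pointwise form: the majorant of [powR_norm_le_sq] is affine in [h ^ 2]
    and equals [rho ^ p] at [|h| = rho]. *)
Lemma Rintegral_powR_lt {R : realType} dT (T : measurableType dT)
    (P : probability T R) (h : T -> R) (p rho : R) :
  sq_integrable P h -> 1 <= p <= 2 -> 0 < rho ->
  \int[P]_x (h x ^+ 2) < rho ^+ 2 ->
  P.-integrable setT (EFin \o (fun x => `|h x| `^ p)) /\
  \int[P]_x (`|h x| `^ p) < rho `^ p.
Proof.
move=> [mh ih] p12 rho0 lt.
pose F x := rho `^ p * (1 - p / 2) + rho `^ p * (p / 2) * rho ^- 2 * h x ^+ 2.
have rp : 0 < rho `^ p by exact: powR_gt0.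
have iF : P.-integrable setT (EFin \o F).
  apply: integrableDR; last exact: integrableZR.
  by apply: bounded_mfun_integrable; exact: bounded_mfun_cst.
have ip : P.-integrable setT (EFin \o (fun x => `|h x| `^ p)).
  apply: le_integrableR iF => [|x].
    apply: (measurableT_comp (measurable_powR p)).
    exact: (measurableT_comp (@normr_measurable R setT) mh).
  by rewrite ger0_norm ?powR_ge0// powR_norm_le_sq.
split=> //; apply: (@le_lt_trans _ _ (\int[P]_x F x)).
  by apply: le_RintegralR => // x; exact: powR_norm_le_sq.
rewrite /F RintegralD//; last 2 first.
- by apply: bounded_mfun_integrable; exact: bounded_mfun_cst.
- exact: integrableZR.
rewrite Rintegral_prob_cst RintegralZl//; set I := \int[P]_x _ in lt *.
rewrite -!mulrA -mulrDr gtr_pMr//.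
have : rho ^- 2 * I < 1 by rewrite mulrC ltr_pdivrMr ?exprn_gt0// mul1r.
by move: (rho ^- 2 * I) => y; move/andP: p12 => [p1 p2]; nra.
Qed.

Lemma lp_dist_le_l2 {R : realType} d (p rho : R) (f g : d.-tuple R -> R) :
  sq_integrable (cube_prob d) (fun x => f x - g x) -> 1 <= p <= 2 -> 0 < rho ->
  (rho%:E <= lp_dist p f g)%E ->
  rho ^+ 2 <= \int[cube_prob d]_x ((f x - g x) ^+ 2).
Proof.
move=> sh p12 rho0; apply: contraTT; rewrite -!ltNge => lt.
have [ip JI] := Rintegral_powR_lt sh p12 rho0 lt.
have p0 : 0 < p by move/andP: p12 => [p1 _]; exact: lt_le_trans p1.
rewrite /lp_dist int_cubeE; last 2 first.
- by case/integrableP: ip.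
- by move=> x; rewrite lee_fin powR_ge0.
have -> : (\int[cube_prob d]_x (`|f x - g x| `^ p)%:E)%E =
    (\int[cube_prob d]_x (`|f x - g x| `^ p))%:E.
  by rewrite /Rintegral fineK// (integrable_fin_num measurableT ip).
move: JI; have : 0 <= \int[cube_prob d]_x (`|f x - g x| `^ p).
  by apply: Rintegral_ge0 => x _; exact: powR_ge0.
move: (\int[_]_x (_ `^ _)) => J J0 JI.
have rE : (rho `^ p) `^ p^-1 = rho.
  by rewrite -powRrM mulfV ?gt_eqF// powRr1// ltW.
rewrite poweR_EFin lte_fin -[ltRHS]rE.
by rewrite gt0_ltr_powR ?invr_gt0// nnegrE// powR_ge0.
Qed.

(** * Replacing densities by their positive parts *)

Section positive_part.
Context {R : realType} {d : nat}.
Implicit Types f g : d.-tuple R -> R.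

(* A density in the sense of [is_density] is only nonnegative on the cube. *)
Definition pos_part f : d.-tuple R -> R := fun x => Num.max (f x) 0.

Lemma pos_part_ge0 f x : 0 <= pos_part f x.
Proof. by rewrite /pos_part le_max lexx orbT. Qed.

Lemma pos_part_cube f x : is_density f -> cube x -> pos_part f x = f x.
Proof. by move=> [_ [f0 _]] /f0; rewrite /pos_part => /max_idPl. Qed.

Lemma measurable_pos_part f : measurable_fun setT f -> measurable_fun setT (pos_part f).
Proof. by move=> mf; apply: measurable_maxr. Qed.

Lemma pos_part_density f : is_density f -> is_density (pos_part f).
Proof.
move=> df; have [mf [f0 f1]] := df; split; first exact: measurable_pos_part.
split=> [x _|]; first exact: pos_part_ge0.
by rewrite -f1; apply: eq_int_cube => x cx; rewrite pos_part_cube.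
Qed.

Lemma pos_part_sobolev s r f : sobolev_F s r f -> sobolev_F s r (pos_part f).
Proof.
move=> [[theta [bt ct]] df]; split; last exact: pos_part_density.
exists theta; split=> //; rewrite (_ : (fun N => _) = (fun N : nat =>
   int_cube (fun x => ((f x - trig_partial theta N x) ^+ 2)%:E)))//.
by apply/funext => N; apply: eq_int_cube => x cx; rewrite pos_part_cube.
Qed.

Lemma pos_part_lp_dist p f g : is_density f -> is_density g ->
  lp_dist p (pos_part f) (pos_part g) = lp_dist p f g.
Proof.
move=> df dg; rewrite /lp_dist; congr poweR.
by apply: eq_int_cube => x cx; rewrite !pos_part_cube.
Qed.

Lemma pos_part_expect_out n1 n2 dT (T : measurableType dT)
    (QX QY : channels R d n1 n2 T) f g (G : n1.-tuple T * n2.-tuple T -> \bar R) :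
  is_density f -> is_density g ->
  expect_out QX QY (pos_part f) (pos_part g) G = expect_out QX QY f g G.
Proof.
move=> df dg; rewrite /expect_out.
have H2 m zs ws : phase2 QY (pos_part g) G m zs ws = phase2 QY g G m zs ws.
  elim: m ws => [|m IH] ws; first by [].
  rewrite /=; apply: eq_int_cube => y cy.
  rewrite (pos_part_cube dg cy); apply: (congr1 (fun t => (g y)%:E * t)%E).
  by apply: eq_integral => w _; rewrite IH.
suff H1 m zs ws : phase1 QX QY (pos_part f) (pos_part g) G m zs ws =
  phase1 QX QY f g G m zs ws by exact: H1.
elim: m zs ws => [|m IH] zs ws; first by rewrite /= H2.
rewrite /=; apply: eq_int_cube => x cx.
rewrite (pos_part_cube df cx); apply: (congr1 (fun t => (f x)%:E * t)%E).
apply: eq_int_cube => y cy.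
rewrite (pos_part_cube dg cy); apply: (congr1 (fun t => (g y)%:E * t)%E).
apply: eq_integral => z _.
by apply: eq_integral => w _; rewrite IH.
Qed.

End positive_part.

(** * Tests from exponential supermartingales *)

Section level_tests.
Context {R : realType} {d n1 n2 : nat}.
Local Notation zst := (n1.-tuple bool).
Local Notation wst := (n2.-tuple bool).
Hypothesis n12 : (n1 <= n2)%N.
Variable eps : R.
Hypothesis eps01 : 0 < eps <= 1.
Variable u : nat -> d.-tuple R -> zst -> wst -> R.
Hypothesis u1 : forall i x zs ws, -1 <= u i x zs ws <= 1.
Hypothesis um : forall i, measurable_fun setT
  (fun p : d.-tuple R * (zst * wst) => u i p.1 p.2.1 p.2.2).
Hypothesis uc : forall x, causal_fun (fun i => u i x).
Local Notation Q := (rr_channel eps u).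

Definition level_stat (c : nat -> zst -> wst -> R) (o : zst * wst) : R :=
  \sum_(i < n1) (c i o.1 o.2 * bit_diff i o.1 o.2 - 8 * c i o.1 o.2 ^+ 2).

(** With equal success probabilities the drift cancels, so the observable statistic is itself the
    exponent of the supermartingale. *)
Lemma level_statE (p : nat -> zst -> wst -> R) c o :
  level_stat c o = exp_proc p p c n1 o.1 o.2.
Proof. by apply: eq_bigr => i _; rewrite subrr subr0. Qed.

Variables (V : nat) (alpha : R) (c : nat -> nat -> zst -> wst -> R).
Hypotheses (V0 : (0 < V)%N) (alpha0 : 0 < alpha).
Hypothesis cc : forall nu, causal_fun (c nu).

Definition level_reject : set (zst * wst) :=
  [set o | exists2 nu, (nu < V)%N & ln (V%:R / alpha) <= level_stat (c nu) o].

Lemma prob_reject_level f : is_density f ->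
  (prob_reject Q Q f f level_reject <= alpha%:E)%E.
Proof.
move=> df; rewrite /prob_reject -pos_part_expect_out//.
have dp := pos_part_density df; have p0 := pos_part_ge0 f.
have -> : (fun o => (\1_level_reject o)%:E : \bar R) = EFin \o (fun o => \1_level_reject o : R) by [].
rewrite expect_out_rr//.
rewrite lee_fin; set p := rr_mean _ _ _.
have p01 i zs ws : 0 <= p i zs ws <= 1 by exact: rr_mean01.
have pc : causal_fun p by exact: rr_mean_causal.
have Va : 0 < V%:R / alpha by rewrite divr_gt0// ltr0n.
apply: (@le_trans _ _ (bit_expect p p (fun o =>
    \sum_(nu < V) alpha / V%:R * expR (exp_proc p p (c nu) n1 o.1 o.2)))).
  apply: le_bit_expect => // o; rewrite indicE.
  have [|_] := boolP (o \in level_reject); last first.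
    by apply: sumr_ge0 => nu _; rewrite mulr_ge0 ?expR_ge0// divr_ge0// ltW.
  rewrite inE => -[nu nuV]; rewrite (level_statE p) => le.
  rewrite (bigD1 (Ordinal nuV))//= -[leLHS]addr0; apply: lerD.
    rewrite -ler_pdivrMl; last by rewrite divr_gt0// ltr0n.
    by rewrite invf_div mulr1 -[leLHS]lnK ?posrE// ler_expR.
  by apply: sumr_ge0 => mu _; rewrite mulr_ge0 ?expR_ge0// divr_ge0// ltW.
rewrite bit_expect_sum//.
apply: (@le_trans _ _ (\sum_(nu < V) alpha / V%:R)).
  apply: ler_sum => nu _; rewrite bit_expectZ ler_piMr//.
    by rewrite divr_ge0// ltW.
  exact: exp_supermartingale.
by rewrite sumr_const card_ord -[X in X <= _]mulr_natr divfK// pnatr_eq0 -lt0n.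
Qed.

(** Markov's inequality with a certificate [G]: dominating the acceptance indicator replaces a union
    of bad events by a sum of expectations. *)
Lemma prob_accept_level (fX fY : d.-tuple R -> R) (G : zst * wst -> R) (beta : R) :
  (forall x, 0 <= fX x) -> (forall x, 0 <= fY x) -> is_density fX -> is_density fY ->
  (forall o, 0 <= G o) ->
  (forall o, ~ level_reject o -> 1 <= G o) ->
  bit_expect (rr_mean eps u fX) (rr_mean eps u fY) G <= beta ->
  (prob_accept Q Q fX fY level_reject <= beta%:E)%E.
Proof.
move=> fX0 fY0 dX dY G0 G1 le; rewrite /prob_accept.
have -> : (fun o => (\1_(~` level_reject) o)%:E : \bar R) =
  EFin \o (fun o => \1_(~` level_reject) o : R) by [].
rewrite expect_out_rr// lee_fin; apply: le_trans le.
have p01 f i zs ws : (forall x, 0 <= f x) -> is_density f ->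
  0 <= rr_mean eps u f i zs ws <= 1 by move=> *; exact: rr_mean01.
apply: le_bit_expect => [i zs ws|i zs ws|o]; [exact: p01|exact: p01|].
rewrite indicE; case: (boolP (o \in _)) => // /set_mem; exact: G1.
Qed.

End level_tests.

(** * Allocation of users to blocks and coordinates *)

Section user_allocation.
Context {R : realType}.
Implicit Types (n m q M h i j : nat) (F G : nat -> R).

Lemma sum_block n m h G : (0 < m)%N -> (h.+1 * m <= n)%N ->
  \sum_(i < n | (i %/ m == h)%N) G i = \sum_(t < m) G (h * m + t)%N.
Proof.
move=> m0 hn; rewrite -(big_mkord (fun i => i %/ m == h)%N G).
have e i : (i %/ m == h)%N = (h * m <= i)%N && (i < h.+1 * m)%N.
  by rewrite eqn_leq -ltnS ltn_divLR// leq_divRL// andbC.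
rewrite (eq_bigl _ _ e) (@big_cat_nat _ _ _ (h.+1 * m)%N)//=.
rewrite [X in _ + X]big_nat_cond [X in _ + X]big1 ?addr0; last first.
  by move=> i /andP[/andP[a _] /andP[_ b]]; rewrite ltnNge a in b.
rewrite (@big_cat_nat _ _ _ (h * m)%N)//=; last by rewrite leq_mul2r leqnSn orbT.
rewrite big_nat_cond big1 ?add0r; last first.
  by move=> i /andP[/andP[_ a] /andP[b _]]; rewrite ltnNge b in a.
transitivity (\sum_(h * m <= i < h.+1 * m) G i).
  by rewrite [RHS]big_nat_cond [LHS]big_nat_cond; apply: eq_bigl => i; rewrite andbb andbT.
rewrite -{1}[(h * m)%N]add0n big_addn mulSn addnK big_mkord.
by apply: eq_bigr => t _; rewrite addnC.
Qed.

Lemma sum_const_blocks q M F : (0 < q)%N ->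
  \sum_(t < M * q) F (t %/ q)%N = q%:R * \sum_(j < M) F j.
Proof.
move=> q0; elim: M => [|M IH]; first by rewrite mul0n !big_ord0 mulr0.
rewrite mulSn addnC -(big_mkord xpredT (fun t => F (t %/ q)%N)).
rewrite (@big_cat_nat _ _ _ (M * q)%N)//= ?leq_addr// big_mkord IH.
rewrite big_ord_recr/= mulrDr; congr (_ + _).
rewrite -{1}[(M * q)%N]add0n big_addn addKn big_mkord.
rewrite (eq_bigr (fun=> F M)) => [|t _]; last first.
  by rewrite addnC divnMDl// divn_small ?addn0.
by rewrite sumr_const card_ord mulr_natl.
Qed.

(* User [i] sits in block [i %/ m] and, within it, probes coordinate
   [(i %% m) %/ q]; the leftover users of a block have coordinate [>= M]. *)
Definition probes m q M h i : bool := (i %/ m == h)%N && ((i %% m) %/ q < M)%N.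

Definition coord m q i : nat := ((i %% m) %/ q)%N.

Lemma sum_probes n m q M h F : (0 < q)%N -> (M * q <= m)%N -> (0 < m)%N ->
  (h.+1 * m <= n)%N ->
  \sum_(i < n | probes m q M h i) F (coord m q i) = q%:R * \sum_(j < M) F j.
Proof.
move=> q0 Mq m0 hn; rewrite -sum_const_blocks//.
rewrite big_mkcondr (sum_block (fun i => if ((i %% m) %/ q < M)%N then
  F (coord m q i) else 0))//.
rewrite (big_ord_widen_cond m xpredT (fun t => F (t %/ q)%N) Mq)/=.
rewrite [RHS]big_mkcond/=; apply: eq_bigr => t _.
by rewrite /coord modnMDl modn_small// ltn_divLR.
Qed.

Lemma sum_block_const n m h (a : R) : (0 < m)%N -> (h.+1 * m <= n)%N ->
  \sum_(i < n | (i %/ m == h)%N) a = m%:R * a.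
Proof.
by move=> m0 hn; rewrite (sum_block (fun=> a))// sumr_const card_ord mulr_natl.
Qed.

Lemma sum_coord_split n m q M h (w : nat -> R) (D : nat -> R) :
  \sum_(j < M) w j * (\sum_(i < n | probes m q M h i && (coord m q i == j)) D i) =
  \sum_(i < n | probes m q M h i) w (coord m q i) * D i.
Proof.
under eq_bigr do rewrite mulr_sumr big_mkcondr/=.
rewrite exchange_big/=; apply: eq_bigr => i /andP[_ cM].
rewrite (bigD1 (Ordinal cM))//= eqxx big1 ?addr0// => j ne.
case: eqP => // e; move: ne; rewrite -(inj_eq val_inj)/= -e.
by rewrite eqxx.
Qed.

End user_allocation.

Lemma expR_norm_le {R : realType} (y : R) : expR `|y| <= expR y + expR (- y).
Proof.
have [y0|y0] := ger0P y; first by rewrite lerDl expR_ge0.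
by rewrite lerDr expR_ge0.
Qed.

(** Converts an exponential moment into control of a square at the price [b ^ 2]. Beyond [b], [x / b
    <= 1 + (x - b) / 2 <= expR ((x - b) / 2)] because [b >= 2]. *)
Lemma sq_le_expR {R : realType} (b x : R) : 2 <= b -> 0 <= x ->
  x ^+ 2 <= b ^+ 2 + b ^+ 2 * expR (x - b).
Proof.
move=> b2 x0; have [xb|bx] := leP x b.
  have : x ^+ 2 <= b ^+ 2 by nra.
  have : 0 <= b ^+ 2 * expR (x - b) by rewrite mulr_ge0 ?sqr_ge0 ?expR_ge0.
  lra.
have e : expR (x - b) = expR ((x - b) / 2) ^+ 2.
  by rewrite expr2 -expRD; congr expR; field.
have := expR_ge1Dx ((x - b) / 2); rewrite e; set y := expR _ => h.
have xy : x <= b * y.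
  by have := ler_wpM2l (_ : 0 <= b) h; rewrite (le_trans _ b2)// => /(_ isT); nra.
have : x ^+ 2 <= (b * y) ^+ 2 by nra.
rewrite exprMn; have := sqr_ge0 b; lra.
Qed.

(** Deterministic core of the non-interactive power, with mean signal [P = lam q^2 kappa^2 En]. The
    scale [lam = 1 / (64 q w b)] makes the quadratic noise cost [2 * 32 / 64^2 = 1 / 64], and
    [lam q <= 1 / 512] makes the remaining loss [40 lam q P] smaller than [P / 8]. *)
Lemma quad_power_arith {R : realType} (X1 X2 L lam q kappa En DX A2 S2 M w b T : R) :
  X1 < L -> X2 < L ->
  X2 = - (lam * q * kappa * DX) - 8 * q * ((lam * q * kappa) ^+ 2 * En) ->
  A2 <= 2 * (q * kappa) ^+ 2 * En + 2 * S2 -> S2 <= 2 * q * M * b ^+ 2 ->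
  0 <= En -> 0 < lam -> 1 <= q -> w ^+ 2 = M -> 1 <= w -> 8 <= b ->
  lam * q * w * b * 64 = 1 ->
  T <= 7 / 8 * (lam * q ^+ 2 * kappa ^+ 2 * En) - 2 * L - 1 / 64 ->
  T <= - X1 + lam * q * kappa * (q * kappa * En + DX) - 16 * lam ^+ 2 * q * A2.
Proof.
move=> x1 x2 X2E a2 s2 En0 lp q1 wM w1 b8 lq hT.
pose t := lam * q; pose P := lam * q ^+ 2 * kappa ^+ 2 * En.
have l0 := ltW lp; have q0 : 0 <= q by lra.
have t0 : 0 <= t by rewrite mulr_ge0.
have wb8 : 8 <= w * b by nra.
have twb : t * (w * b) = 1 / 64 by rewrite /t; lra.
have t512 : t <= 1 / 512 by nra.
have P0 : 0 <= P.
  by rewrite /P mulr_ge0// mulr_ge0 ?sqr_ge0// mulr_ge0// sqr_ge0.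
have c0 : 0 <= 16 * lam ^+ 2 * q.
  by rewrite mulr_ge0// mulr_ge0// sqr_ge0.
have h1 := ler_wpM2l c0 a2; have h2 := ler_wpM2l c0 s2.
have e1 : 16 * lam ^+ 2 * q * (2 * (q * kappa) ^+ 2 * En) = 32 * (t * P).
  by rewrite /t /P; ring.
have e2 : 16 * lam ^+ 2 * q * (2 * q * M * b ^+ 2) = 32 * (t * (w * b)) ^+ 2.
  by rewrite /t -wM; ring.
have e3 : 8 * q * ((lam * q * kappa) ^+ 2 * En) = 8 * (t * P) by rewrite /t /P; ring.
have e4 : lam * q * kappa * (q * kappa * En + DX) = P + lam * q * kappa * DX.
  by rewrite /P; ring.
have tP : t * P <= 1 / 512 * P by rewrite ler_wpM2r.
rewrite twb in e2; rewrite e4; rewrite e3 in X2E; rewrite -/P in hT.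
rewrite mulrDr e1 (mulrCA _ 2 S2) in h1; rewrite e2 in h2.
lra.
Qed.

Lemma eq_le {R : realType} (x y : R) : x = y -> x <= y.
Proof. by move=> ->. Qed.

(** * Power of the quadratic statistic at one level *)

Section coordinate_sums.
Context {R : realType} {n1 n2 : nat}.
Local Notation zst := (n1.-tuple bool).
Local Notation wst := (n2.-tuple bool).
Variables (m q M : nat).

Definition coord_sum (h j : nat) (zs : zst) (ws : wst) : R :=
  \sum_(i < n1 | probes m q M h i && (coord m q i == j)) bit_diff i zs ws.

Lemma coord_sum_causal h j (zs zs' : zst) (ws ws' : wst) k : (h.+1 * m <= k)%N -> (0 < m)%N ->
  (forall i, (i < k)%N -> nth false zs i = nth false zs' i) ->
  (forall i, (i < k)%N -> nth false ws i = nth false ws' i) ->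
  coord_sum h j zs ws = coord_sum h j zs' ws'.
Proof.
move=> hk m0 Hz Hw; apply: eq_bigr => i /andP[/andP[/eqP ih _] _].
have ik : (i < k)%N by apply: leq_trans hk; rewrite -ltn_divLR// ih.
by rewrite /bit_diff Hz// Hw.
Qed.

Definition quad_weight (lam : R) h (i : nat) zs ws : R :=
  if probes m q M h.+1 i then lam * coord_sum h (coord m q i) zs ws else 0.

Lemma quad_weight_causal lam h : causal_fun (quad_weight lam h).
Proof.
move=> i zs zs' ws ws' Hz Hw; rewrite /quad_weight; case: ifP => // /andP[/eqP ih _].
have m0 : (0 < m)%N by case: (posnP m) ih => // ->; rewrite divn0.
by congr (_ * _); apply: coord_sum_causal Hz Hw => //; rewrite -ih leq_trunc_div.
Qed.

Variables pX pY : nat -> zst -> wst -> R.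
Hypothesis pX01 : forall i zs ws, 0 <= pX i zs ws <= 1.
Hypothesis pY01 : forall i zs ws, 0 <= pY i zs ws <= 1.
Hypothesis pXc : causal_fun pX.
Hypothesis pYc : causal_fun pY.
Hypothesis n12 : (n1 <= n2)%N.
Hypotheses (m0 : (0 < m)%N) (q0 : (0 < q)%N) (Mqm : (M * q <= m)%N).
Variables (h : nat) (kappa : R) (Delta : nat -> R).
Hypothesis hn : (h.+2 * m <= n1)%N.
Hypothesis muA : forall i zs ws, probes m q M h i ->
  pX i zs ws - pY i zs ws = kappa * Delta (coord m q i).

Let hn' : (h.+1 * m <= n1)%N.
Proof. by apply: leq_trans hn; rewrite leq_mul2r leqnSn orbT. Qed.

Definition coord_noise j (o : zst * wst) : R :=
  coord_sum h j o.1 o.2 - q%:R * kappa * Delta j.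

(** The supermartingale with deterministic weights on block [h], shared by the [q] users of a
    coordinate: every linear form of the coordinate noises is sub-Gaussian. *)
Lemma linear_mgf (w : nat -> R) :
  bit_expect pX pY (fun o => expR (\sum_(j < M) w j * coord_noise j o -
    8 * q%:R * \sum_(j < M) w j ^+ 2)) <= 1.
Proof.
pose c (i : nat) (zs : zst) (ws : wst) : R := if probes m q M h i then w (coord m q i) else 0.
apply: le_trans (exp_supermartingale pX01 pY01 pXc pYc (c := c) n12 _); last by [].
apply: le_bit_expect => // o; rewrite ler_expR le_eqVlt; apply/orP; left; apply/eqP.
have -> : exp_proc pX pY c n1 o.1 o.2 = \sum_(i < n1 | probes m q M h i)
   (w (coord m q i) * bit_diff i o.1 o.2 - (kappa * (w (coord m q i) * Delta (coord m q i))
      + 8 * w (coord m q i) ^+ 2)).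
  rewrite /exp_proc [RHS]big_mkcond/=; apply: eq_bigr => i _; rewrite /c.
  case: ifP => [pi|_]; last by rewrite mul0r expr0n/= mulr0 subr0.
  by rewrite muA//; ring.
rewrite sumrB big_split/= -!mulr_sumr.
rewrite (sum_probes (fun j => w j * Delta j) q0 Mqm m0 hn').
rewrite (sum_probes (fun j => w j ^+ 2) q0 Mqm m0 hn').
rewrite -(@sum_coord_split _ n1 m q M h w (fun i => bit_diff i o.1 o.2)).
under [X in X - _ = _]eq_bigr do rewrite /coord_noise mulrBr.
rewrite sumrB [X in _ - X - _](_ : _ = kappa * (q%:R * \sum_(j < M) w j * Delta j)).
  ring.
by rewrite !mulr_sumr; apply: eq_bigr => j _; ring.
Qed.

Lemma single_coord_mgf (b : R) j : (j < M)%N ->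
  bit_expect pX pY (fun o => expR (b * coord_noise j o)) <= expR (8 * q%:R * b ^+ 2).
Proof.
move=> jM; pose w i : R := if i == j then b else 0; have := linear_mgf w.
have e1 (F : nat -> R) : \sum_(i < M) w i * F i = b * F j.
  rewrite (bigD1 (Ordinal jM))//= /w eqxx big1 ?addr0// => i ne.
  by case: eqP => [e|_]; [move: ne; rewrite -(inj_eq val_inj)/= e eqxx|rewrite mul0r].
have e2 : \sum_(i < M) w i ^+ 2 = b ^+ 2.
  under eq_bigr do rewrite expr2.
  by rewrite (e1 w) /w eqxx expr2.
under [fun o => _]eq_fun => o.
  rewrite (e1 (fun i => coord_noise i o)) e2 expRD expRN mulrC.
  over.
by rewrite bit_expectZ ler_pdivrMl ?expR_gt0// mulr1.
Qed.

Hypothesis muB : forall i zs ws, probes m q M h.+1 i ->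
  pX i zs ws - pY i zs ws = kappa * Delta (coord m q i).

Let En : R := \sum_(j < M) Delta j ^+ 2.

(** The sign of [lam] is flipped because power needs a lower bound on the statistic while Markov
    bounds an exponent from above. The compensator is then paid twice, in the statistic and in the
    process, hence 16. *)
Lemma quad_level_stat lam (o : zst * wst) :
  level_stat (quad_weight lam h) o =
  - exp_proc pX pY (quad_weight (- lam) h) n1 o.1 o.2 +
  lam * q%:R * kappa * \sum_(j < M) Delta j * coord_sum h j o.1 o.2 -
  16 * lam ^+ 2 * q%:R * \sum_(j < M) coord_sum h j o.1 o.2 ^+ 2.
Proof.
pose a j := coord_sum h j o.1 o.2.
have -> : exp_proc pX pY (quad_weight (- lam) h) n1 o.1 o.2 =
   \sum_(i < n1 | probes m q M h.+1 i) (- lam * (a (coord m q i) * bit_diff i o.1 o.2)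
     + lam * kappa * (Delta (coord m q i) * a (coord m q i))
     - 8 * lam ^+ 2 * a (coord m q i) ^+ 2).
  rewrite /exp_proc [RHS]big_mkcond/=; apply: eq_bigr => i _; rewrite /quad_weight.
  case: ifP => [pi|_]; last by rewrite mul0r expr0n/= mulr0 subr0.
  by rewrite muB// /a; ring.
have -> : level_stat (quad_weight lam h) o =
   \sum_(i < n1 | probes m q M h.+1 i) (lam * (a (coord m q i) * bit_diff i o.1 o.2)
     - 8 * lam ^+ 2 * a (coord m q i) ^+ 2).
  rewrite /level_stat [RHS]big_mkcond/=; apply: eq_bigr => i _; rewrite /quad_weight.
  case: ifP => [pi|_]; last by rewrite mul0r expr0n/= mulr0 subr0.
  by rewrite /a; ring.
rewrite !sumrB big_split/= -!mulr_sumr.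
rewrite (sum_probes (fun j => Delta j * a j) q0 Mqm m0 hn).
rewrite (sum_probes (fun j => a j ^+ 2) q0 Mqm m0 hn).
rewrite /a; move: (\sum_(i < n1 | _) _) => X; ring.
Qed.

(** The three parts of [G] control the fluctuation of the second block ([X1]), the cross term of
    signal and first-block noise ([X2]) and the sizes of the coordinate noises ([Y]). *)
Lemma quad_level_power (beta T : R) : 0 < beta < 1 -> (0 < M)%N ->
  let b := 8 + ln (6 / beta) in
  let lam := (64 * q%:R * Num.sqrt M%:R * b)^-1 in
  T <= 7 / 8 * (lam * q%:R ^+ 2 * kappa ^+ 2 * En) - 2 * ln (3 / beta) - 1 / 64 ->
  exists G : zst * wst -> R, [/\ forall o, 0 <= G o,
    bit_expect pX pY G <= beta &
    forall o, level_stat (quad_weight lam h) o < T -> 1 <= G o].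
Proof.
move=> /andP[b0 b1] M0 b lam hT.
have L6 : 0 <= ln (6 / beta) by rewrite ln_ge0// ler_pdivlMr// mul1r; lra.
have b8 : 8 <= b by rewrite /b; lra.
have bp : 0 < b by lra.
have qp : 0 < q%:R :> R by rewrite ltr0n.
have q1 : 1 <= q%:R :> R by rewrite ler1n.
have Mp : 0 < M%:R :> R by rewrite ltr0n.
have w1 : 1 <= Num.sqrt (M%:R : R) by rewrite -[leLHS]sqrtr1 ler_wsqrtr// ler1n.
have wM : Num.sqrt (M%:R : R) ^+ 2 = M%:R by rewrite sqr_sqrtr// ltW.
have sq2 : Num.sqrt (q%:R : R) ^+ 2 = q%:R by rewrite sqr_sqrtr// ltW.
have sqp : 0 < Num.sqrt (q%:R : R) by rewrite sqrtr_gt0.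
set w := Num.sqrt M%:R in lam hT w1 wM *; set sq := Num.sqrt q%:R in sq2 sqp *.
have wp : 0 < w by lra.
have b3 : 0 < 3 / beta by rewrite divr_gt0.
pose X1 o := exp_proc pX pY (quad_weight (- lam) h) n1 o.1 o.2.
(* The slope of the cross term in [quad_level_stat], negated so that an upper bound on [X2] bounds
   that term from below. *)
pose v j := - (lam * q%:R * kappa * Delta j).
pose X2 o := \sum_(j < M) v j * coord_noise j o - 8 * q%:R * \sum_(j < M) v j ^+ 2.
(* Slope [1 / sqrt q] is the inverse noise scale of a coordinate: each exponential has mean at most
   [expR 8]. *)
pose Y o := \sum_(j < M) (expR (sq^-1 * coord_noise j o) + expR (- sq^-1 * coord_noise j o)).
exists (fun o => beta / 3 * expR (X1 o) + beta / 3 * expR (X2 o) +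
  beta / (6 * M%:R * expR 8) * Y o).
have Y0 o : 0 <= Y o by apply: sumr_ge0 => j _; rewrite addr_ge0 ?expR_ge0.
have cY : 0 < 6 * M%:R * expR (8 : R) by rewrite !mulr_gt0 ?expR_gt0.
split; [move=> o| |move=> o].
- by rewrite !addr_ge0// mulr_ge0 ?expR_ge0// divr_ge0// ltW.
- rewrite !bit_expectD !bit_expectZ.
  have h1 : bit_expect pX pY (fun o => expR (X1 o)) <= 1.
    by apply: exp_supermartingale => //; exact: quad_weight_causal.
  have h2 : bit_expect pX pY (fun o => expR (X2 o)) <= 1 by exact: linear_mgf.
  have h3 : bit_expect pX pY Y <= 2 * M%:R * expR 8.
    rewrite /Y bit_expect_sum; apply: (@le_trans _ _ (\sum_(j < M) (expR 8 + expR 8))).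
      apply: ler_sum => j _; rewrite bit_expectD; apply: lerD.
        apply: le_trans (single_coord_mgf _ (ltn_ord j)) _.
        by rewrite ler_expR exprVn sq2 mulfK// gt_eqF.
      apply: le_trans (single_coord_mgf _ (ltn_ord j)) _.
      by rewrite ler_expR sqrrN exprVn sq2 mulfK// gt_eqF.
    by rewrite sumr_const card_ord -[leLHS]mulr_natr; apply: eq_le; ring.
  have hb : 0 < beta / 3 by rewrite divr_gt0.
  have hb' : 0 < beta / (6 * M%:R * expR 8) by rewrite divr_gt0.
  have e3 : beta / (6 * M%:R * expR 8) * (2 * M%:R * expR 8) = beta / 3.
    by field; rewrite !gt_eqF// expR_gt0.
  have := ler_wpM2l (ltW hb) h1; have := ler_wpM2l (ltW hb) h2.
  have := ler_wpM2l (ltW hb') h3; rewrite e3 !mulr1; lra.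
apply: contraTT; rewrite -ltNge -leNgt => lt.
have hX (X : R) : beta / 3 * expR X < 1 -> X < ln (3 / beta).
  rewrite -ltr_pdivlMl ?divr_gt0// mulr1 invf_div => hx.
  by rewrite -ltr_expR lnK.
have p1 : 0 < beta / 3 * expR (X1 o) by rewrite mulr_gt0 ?expR_gt0// divr_gt0.
have p2 : 0 < beta / 3 * expR (X2 o) by rewrite mulr_gt0 ?expR_gt0// divr_gt0.
have p3 : 0 <= beta / (6 * M%:R * expR 8) * Y o by rewrite mulr_ge0// divr_ge0// ltW.
have x1 : X1 o < ln (3 / beta) by apply: hX; lra.
have x2 : X2 o < ln (3 / beta) by apply: hX; lra.
(* [b] is defined so that [expR b = 6 expR 8 / beta], the level at which the third part of [G]
   reaches 1 after division by [M]. *)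
have x3 : Y o <= M%:R * expR b.
  have : beta / (6 * M%:R * expR 8) * Y o <= 1 by lra.
  rewrite -ler_pdivlMl; last by rewrite divr_gt0.
  rewrite mulr1 invf_div => le; apply: le_trans le _; apply: eq_le.
  rewrite /b (expRD _ (ln _)) lnK ?posrE ?divr_gt0//; ring.
pose xi j := coord_noise j o.
have xi2 : \sum_(j < M) xi j ^+ 2 <= 2 * q%:R * M%:R * b ^+ 2.
  apply: (@le_trans _ _ (\sum_(j < M) q%:R * (b ^+ 2 + b ^+ 2 * expR (- b) *
      (expR (sq^-1 * xi j) + expR (- sq^-1 * xi j))))).
    apply: ler_sum => j _; set y := sq^-1 * xi j; rewrite mulNr -/y.
    have -> : xi j ^+ 2 = q%:R * `|y| ^+ 2.
      by rewrite real_normK ?num_real// /y exprMn exprVn sq2 mulrA divff ?gt_eqF// mul1r.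
    rewrite ler_pM2l//; apply: le_trans (@sq_le_expR _ b _ _ (normr_ge0 y)) _; first lra.
    rewrite lerD2l -mulrA ler_wpM2l ?sqr_ge0// expRD mulrC ler_wpM2l ?expR_ge0//.
    exact: expR_norm_le.
  rewrite -mulr_sumr big_split/= sumr_const card_ord -mulr_sumr -/(Y o).
  have e : b ^+ 2 * expR (- b) * (M%:R * expR b) = M%:R * b ^+ 2.
    by rewrite expRN; field; rewrite gt_eqF ?expR_gt0.
  have := ler_wpM2l (_ : 0 <= b ^+ 2 * expR (- b)) x3.
  rewrite mulr_ge0 ?sqr_ge0 ?expR_ge0// => /(_ isT); rewrite e -[b ^+ 2 *+ M]mulr_natr => le.
  have := ler_wpM2l (ltW qp) le; nra.
have En0 : 0 <= En by apply: sumr_ge0 => j _; exact: sqr_ge0.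
have a2 : \sum_(j < M) coord_sum h j o.1 o.2 ^+ 2 <=
    2 * (q%:R * kappa) ^+ 2 * En + 2 * \sum_(j < M) xi j ^+ 2.
  rewrite /En !mulr_sumr -big_split/=; apply: ler_sum => j _.
  rewrite /xi /coord_noise; set a := coord_sum _ _ _ _; set e := _ * kappa.
  have := sqr_ge0 (a - 2 * (e * Delta j)); nra.
have aD : \sum_(j < M) Delta j * coord_sum h j o.1 o.2 =
    q%:R * kappa * En + \sum_(j < M) Delta j * xi j.
  rewrite /En mulr_sumr -big_split/=; apply: eq_bigr => j _.
  by rewrite /xi /coord_noise; ring.
have X2E : X2 o = - (lam * q%:R * kappa * \sum_(j < M) Delta j * xi j) -
   8 * q%:R * ((lam * q%:R * kappa) ^+ 2 * En).
  have -> : lam * q%:R * kappa * (\sum_(j < M) Delta j * xi j) =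
      - \sum_(j < M) v j * coord_noise j o.
    by rewrite mulr_sumr -sumrN; apply: eq_bigr => j _; rewrite /v /xi; ring.
  have -> : (lam * q%:R * kappa) ^+ 2 * En = \sum_(j < M) v j ^+ 2.
    by rewrite /En mulr_sumr; apply: eq_bigr => j _; rewrite /v; ring.
  by rewrite opprK.
rewrite quad_level_stat -/(X1 o) aD.
set A2 := \sum_(j < M) coord_sum _ _ _ _ ^+ 2 in a2 *.
set DX := \sum_(j < M) Delta j * xi j in aD X2E *.
set S2 := \sum_(j < M) xi j ^+ 2 in xi2 a2 *.
have lp : 0 < lam by rewrite invr_gt0 !mulr_gt0.
have lq : lam * q%:R * w * b * 64 = 1 by rewrite /lam; field; rewrite !gt_eqF.
exact: (quad_power_arith x1 x2 X2E a2 xi2 En0 lp q1 wM w1 b8 lq hT).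
Qed.

End coordinate_sums.

(** * Power of the clipped score at one level *)

Definition clip1 {R : realType} (v : R) : R := Num.max (-1) (Num.min 1 v).

Lemma clip1_itv {R : realType} (v : R) : -1 <= clip1 v <= 1.
Proof.
by rewrite /clip1 le_max lexx/= ge_max ge_min lexx/= andbT; lra.
Qed.

(** Clipping acts only when [|v + x| > tau]. As [v] accounts for at most [tau / 2], the overshoot is
    at most [|x| - tau / 2], which [a <= expR (theta a) / theta] charges to the exponential moment
    of the noise [x]. *)
Lemma clip1_defect {R : realType} (tau theta v x : R) : 0 < tau -> 0 < theta ->
  `|v| <= tau / 2 ->
  `|(v + x) - tau * clip1 (tau^-1 * (v + x))| <=
    theta^-1 * expR (- (theta * tau / 2)) * (expR (theta * x) + expR (- theta * x)).
Proof.
move=> t0 th0 vt; set y := v + x.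
have ti : 0 < tau^-1 by rewrite invr_gt0.
have tt : tau * tau^-1 = 1 by rewrite divff// gt_eqF.
have E0 : 0 <= theta^-1 * expR (- (theta * tau / 2)) * (expR (theta * x) + expR (- theta * x)).
  by rewrite mulr_ge0 ?addr_ge0 ?expR_ge0// mulr_ge0 ?expR_ge0// invr_ge0 ltW.
have [yt|ty] := leP `|y| tau.
  suff -> : tau * clip1 (tau^-1 * y) = y by rewrite subrr normr0.
  have : -1 <= tau^-1 * y <= 1.
    by rewrite -ler_norml normrM gtr0_norm// ler_pdivrMl// mulr1.
  move=> /andP[h1 h2]; rewrite /clip1 (min_idPr _)// (max_idPr _)//.
  by rewrite mulrA tt mul1r.
have yx : `|y| - tau <= `|x| - tau / 2.
  have := ler_normD v x; rewrite -/y; lra.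
have defect : `|y - tau * clip1 (tau^-1 * y)| <= `|y| - tau.
  have [y0|y0] := ger0P y.
    rewrite ger0_norm// in ty.
    have h1 : 1 <= tau^-1 * y by rewrite ler_pdivlMl// mulr1 ltW.
    have -> : clip1 (tau^-1 * y) = 1.
      by rewrite /clip1 (min_idPl h1); apply/max_idPr; lra.
    by rewrite mulr1 ger0_norm// subr_ge0 ltW.
  rewrite ltr0_norm// in ty.
  have h1 : tau^-1 * y <= -1 by rewrite ler_pdivrMl// mulrN1; lra.
  have h2 : tau^-1 * y <= 1 by lra.
  have -> : clip1 (tau^-1 * y) = -1 by rewrite /clip1 (min_idPr h2) (max_idPl h1).
  rewrite mulrN1 opprK ler0_norm; last lra.
  lra.
apply: (le_trans defect); apply: (le_trans yx).
apply: (@le_trans _ _ (theta^-1 * expR (theta * (`|x| - tau / 2)))).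
  rewrite ler_pdivlMl//.
  by have := expR_ge1Dx (theta * (`|x| - tau / 2)); lra.
rewrite -mulrA ler_pM2l ?invr_gt0//.
have -> : theta * (`|x| - tau / 2) = - (theta * tau / 2) + `|theta * x|.
  by rewrite normrM (gtr0_norm th0); ring.
rewrite expRD ler_pM2l ?expR_gt0// mulNr; exact: expR_norm_le.
Qed.

(** With [A = q kappa En], the cross noise takes at most [A / 4] of the signal and clipping at most
    [A / 8], so [tau J >= A / 2]. The slope [kappa / 64] makes the compensator of [X2] equal to that
    slope times [A / 8]. *)
Lemma interactive_power_arith {R : realType}
    (X1 X2 L S J D Cf tau k q kappa En Th : R) :
  X1 < L -> X2 < L ->
  X2 = - (kappa / 64 * D) - 8 * q * ((kappa / 64) ^+ 2 * En) ->
  q * kappa * En + D - Cf <= tau * J -> Cf <= q * kappa * En / 8 ->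
  X1 = - S + k * J - 16 ->
  64 * L / kappa <= q * kappa * En / 8 ->
  Th + L + 16 <= k * (q * kappa * En) / (2 * tau) ->
  0 < kappa -> 0 <= En -> 0 <= q -> 0 < tau -> 0 <= k -> Th <= S.
Proof.
move=> x1 x2 X2E sig CF X1E c2 c1 kp En0 q0 t0 k0.
set A := q * kappa * En in c1 c2 sig CF.
have A0 : 0 <= A by apply: mulr_ge0 => //; apply: mulr_ge0 => //; exact: ltW.
have etap : 0 < kappa / 64 by rewrite divr_gt0.
have D1 : - (A / 4) <= D.
  have e : kappa / 64 * (A / 8) = 8 * q * ((kappa / 64) ^+ 2 * En) by rewrite /A; field.
  have eL : kappa / 64 * (64 * L / kappa) = L by field; rewrite gt_eqF.
  have := ler_wpM2l (ltW etap) c2; rewrite eL => hL.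
  rewrite -(ler_pM2l etap) mulrN.
  have : kappa / 64 * (A / 4) = kappa / 64 * (A / 8) + kappa / 64 * (A / 8) by field.
  lra.
have J1 : A / 2 <= tau * J by lra.
have J2 : A / (2 * tau) <= J.
  rewrite ler_pdivrMr ?mulr_gt0//; have : J * (2 * tau) = 2 * (tau * J) by ring.
  lra.
have := ler_wpM2l k0 J2; rewrite mulrA; lra.
Qed.

Section interactive_power.
Context {R : realType} {n1 n2 : nat}.
Local Notation zst := (n1.-tuple bool).
Local Notation wst := (n2.-tuple bool).
Variables (m q M : nat).

Definition block_weight (lam : R) h (i : nat) (zs : zst) (ws : wst) : R :=
  if (i %/ m == h)%N then lam else 0.

Variables pX pY : nat -> zst -> wst -> R.
Hypothesis pX01 : forall i zs ws, 0 <= pX i zs ws <= 1.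
Hypothesis pY01 : forall i zs ws, 0 <= pY i zs ws <= 1.
Hypothesis pXc : causal_fun pX.
Hypothesis pYc : causal_fun pY.
Hypothesis n12 : (n1 <= n2)%N.
Hypotheses (m0 : (0 < m)%N) (q0 : (0 < q)%N) (Mqm : (M * q <= m)%N).
Variables (h : nat) (kappa : R) (Delta : nat -> R).
Hypothesis hn : (h.+2 * m <= n1)%N.
Hypothesis kp : 0 < kappa.
Hypothesis muA : forall i zs ws, probes m q M h i ->
  pX i zs ws - pY i zs ws = kappa * Delta (coord m q i).
Variables (dT : measure_display) (T : measurableType dT) (P : probability T R).
Variables (g : T -> R) (phi : nat -> T -> R) (s tau e8 : R).
Hypothesis sg : sq_integrable P g.
Hypothesis bphi : forall j, bounded_mfun (phi j).
Hypothesis phis : forall j x, `|phi j x| <= s.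
Hypothesis gphi : forall j, (j < M)%N -> \int[P]_x (g x * phi j x) = Delta j.
Hypothesis g1 : \int[P]_x `|g x| <= 2.

(** An unnormalised function estimate: it is [q kappa] times the partial Fourier sum with
    coefficients [Delta], plus noise. *)
Definition score (zs : zst) (ws : wst) (x : T) : R :=
  \sum_(j < M) coord_sum m q M h j zs ws * phi j x.

Hypothesis muB : forall i zs ws, (i %/ m == h.+1)%N ->
  pX i zs ws - pY i zs ws = e8 * \int[P]_x (g x * clip1 (tau^-1 * score zs ws x)).

Let En : R := \sum_(j < M) Delta j ^+ 2.
Local Notation noise := (coord_noise m q M h kappa Delta).

Let noise_fun (o : zst * wst) (x : T) : R := \sum_(j < M) noise j o * phi j x.

Let cosh_noise theta (o : zst * wst) (x : T) : R :=
  expR (theta * noise_fun o x) + expR (- theta * noise_fun o x).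

Lemma bounded_noise_fun o : bounded_mfun (noise_fun o).
Proof. by apply: bounded_mfun_sum => j; apply: bounded_mfunZ. Qed.

Lemma bounded_expR (f : T -> R) : bounded_mfun f -> bounded_mfun (fun x => expR (f x)).
Proof.
move=> [mf [K fK]]; split; first exact: measurableT_comp.
exists (expR K) => x; rewrite ger0_norm ?expR_ge0// ler_expR.
by rewrite (le_trans (ler_norm _)).
Qed.

Lemma bounded_cosh_noise theta o : bounded_mfun (cosh_noise theta o).
Proof.
by apply: bounded_mfunD; apply: bounded_expR; apply: bounded_mfunZ; exact: bounded_noise_fun.
Qed.

Lemma sq_integrable_norm : sq_integrable P (fun x => `|g x|).
Proof.
have [mg ig] := sg; split; first exact: (measurableT_comp (@normr_measurable R setT) mg).
by apply: eq_integrable ig => // x _ /=; rewrite real_normK ?num_real.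
Qed.

(** For fixed [x] the noise is a linear form in the coordinate noises, so [linear_mgf] applies
    pointwise. Averaging against [|g|], of mass at most 2, takes the place of a bound uniform in
    [x]. *)
Lemma cosh_noise_mgf theta : 8 * q%:R * theta ^+ 2 * s ^+ 2 * M%:R <= 1 ->
  bit_expect pX pY (fun o => \int[P]_x (`|g x| * cosh_noise theta o x)) <= 4 * expR 1.
Proof.
move=> th; have ng := sq_integrable_norm.
have iF o : P.-integrable setT (EFin \o (fun x => `|g x| * cosh_noise theta o x)).
  by apply: sq_integrableM => //; apply: sq_integrable_bounded; exact: bounded_cosh_noise.
have [iE <-] := Rintegral_bit_expect pX pY iF.
have mgf (t : R) x : t ^+ 2 = theta ^+ 2 ->
    bit_expect pX pY (fun o => expR (t * noise_fun o x)) <= expR 1.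
  move=> tth; have := linear_mgf pX01 pY01 pXc pYc n12 m0 q0 Mqm hn muA (fun j => t * phi j x).
  have eS o : \sum_(j < M) t * phi j x * noise j o = t * noise_fun o x.
    by rewrite /noise_fun mulr_sumr; apply: eq_bigr => j _; rewrite mulrAC mulrA.
  rewrite (_ : (fun o => _) = (fun o => expR (- (8 * q%:R * \sum_(j < M) (t * phi j x) ^+ 2)) *
     expR (t * noise_fun o x))); last first.
    by apply/funext => o; rewrite -expRD addrC -eS.
  rewrite bit_expectZ expRN ler_pdivrMl ?expR_gt0// mulr1 => le; apply: (le_trans le).
  rewrite ler_expR; apply: le_trans th.
  have -> : 8 * q%:R * theta ^+ 2 * s ^+ 2 * M%:R = 8 * q%:R * (theta ^+ 2 * s ^+ 2 * M%:R) by ring.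
  rewrite ler_wpM2l//.
  apply: (@le_trans _ _ (\sum_(j < M) theta ^+ 2 * s ^+ 2)).
    apply: ler_sum => j _; rewrite exprMn tth ler_wpM2l ?sqr_ge0//.
    by rewrite -real_normK ?num_real// lerXn2r ?nnegrE// (le_trans _ (phis j x)).
  by rewrite sumr_const card_ord mulr_natr.
have EF x : bit_expect pX pY (fun o => `|g x| * cosh_noise theta o x) <= `|g x| * (2 * expR 1).
  rewrite bit_expectZ ler_wpM2l// bit_expectD.
  by have := mgf theta x erefl; have := mgf (- theta) x (sqrrN _); lra.
have i2 : P.-integrable setT (EFin \o (fun x => (2 * expR 1) * `|g x|)).
  by apply: integrableZR; exact: sq_integrable_integrable.
apply: (@le_trans _ _ (\int[P]_x ((2 * expR 1) * `|g x|))).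
  by apply: le_RintegralR => // x; rewrite [leRHS]mulrC.
rewrite RintegralZl//; last exact: sq_integrable_integrable.
rewrite (_ : 4 * expR 1 = 2 * expR 1 * 2); last by ring.
by rewrite ler_wpM2l// mulr_ge0// expR_ge0.
Qed.

Lemma drift_bound x : 0 < s -> 0 < tau -> (0 < M)%N ->
  4 * q%:R ^+ 2 * kappa ^+ 2 * s ^+ 2 * M%:R * En <= tau ^+ 2 ->
  `|q%:R * kappa * \sum_(j < M) Delta j * phi j x| <= tau / 2.
Proof.
move=> s0 t0 M0 htau.
have qp : 0 < q%:R :> R by rewrite ltr0n.
have Mp : 0 < M%:R :> R by rewrite ltr0n.
(* Weight of the termwise mean inequality replacing Cauchy-Schwarz; it makes the first of the two
   averaged terms exactly [tau / 2]. *)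
pose t := tau / (2 * q%:R * kappa * s * M%:R).
have tp : 0 < t by rewrite divr_gt0// !mulr_gt0.
have cp : 0 < q%:R * kappa by rewrite mulr_gt0.
rewrite normrM gtr0_norm//.
have le : `|\sum_(j < M) Delta j * phi j x| <= s * (M%:R * t + t^-1 * En) / 2.
  apply: (le_trans (ler_norm_sum _ _ _)).
  rewrite (_ : s * (M%:R * t + t^-1 * En) / 2 = \sum_(j < M) s * (t + t^-1 * Delta j ^+ 2) / 2); last first.
    rewrite -mulr_suml -mulr_sumr big_split/= sumr_const card_ord.
    by rewrite -mulr_sumr mulr_natl.
  apply: ler_sum => j _; rewrite normrM.
  have tt : t^-1 * t = 1 by rewrite mulVf// gt_eqF.
  have : `|Delta j| <= (t + t^-1 * Delta j ^+ 2) / 2.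
    rewrite -[Delta j ^+ 2]real_normK ?num_real//; set a := `|Delta j|.
    have : 0 <= t^-1 * (a - t) ^+ 2 by rewrite mulr_ge0 ?sqr_ge0// invr_ge0 ltW.
    have -> : t^-1 * (a - t) ^+ 2 = t^-1 * a ^+ 2 - 2 * (t^-1 * t) * a + (t^-1 * t) * t by ring.
    by rewrite tt; lra.
  have := phis j x; have := normr_ge0 (phi j x); have := normr_ge0 (Delta j).
  move=> h1 h2 h3 h4; apply: (@le_trans _ _ (`|Delta j| * s)).
    by rewrite ler_wpM2l.
  by rewrite mulrC -mulrA ler_wpM2l// ltW.
apply: (le_trans (ler_wpM2l (ltW cp) le)).
have e1 : q%:R * kappa * (s * (M%:R * t)) = tau / 2.
  by rewrite /t; field; rewrite !gt_eqF.
have e2 : q%:R * kappa * (s * (t^-1 * En)) = (4 * q%:R ^+ 2 * kappa ^+ 2 * s ^+ 2 * M%:R * En) / (2 * tau).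
  by rewrite /t; field; rewrite !gt_eqF.
have : q%:R * kappa * (s * (t^-1 * En)) <= tau / 2.
  rewrite e2 ler_pdivrMr ?mulr_gt0// (_ : tau / 2 * (2 * tau) = tau ^+ 2)//; by field.
have -> : q%:R * kappa * (s * (M%:R * t + t^-1 * En) / 2) =
  (q%:R * kappa * (s * (M%:R * t)) + q%:R * kappa * (s * (t^-1 * En))) / 2 by field; rewrite gt_eqF.
by rewrite e1; lra.
Qed.

(** Integrating the unclipped score against [g] returns the sum on the left; the clipping loss is
    bounded pointwise by [clip1_defect], whose drift condition is [drift_bound]. *)
Lemma signal_bound theta o : 0 < s -> 0 < tau -> 0 < theta -> (0 < M)%N ->
  4 * q%:R ^+ 2 * kappa ^+ 2 * s ^+ 2 * M%:R * En <= tau ^+ 2 ->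
  \sum_(j < M) Delta j * coord_sum m q M h j o.1 o.2 -
    theta^-1 * expR (- (theta * tau / 2)) * (\int[P]_x (`|g x| * cosh_noise theta o x)) <=
  tau * \int[P]_x (g x * clip1 (tau^-1 * score o.1 o.2 x)).
Proof.
move=> s0 t0 th0 M0 htau.
set C := theta^-1 * expR _.
have bscore : bounded_mfun (score o.1 o.2).
  by apply: bounded_mfun_sum => j; exact: bounded_mfunZ.
have bclip : bounded_mfun (fun x => clip1 (tau^-1 * score o.1 o.2 x)).
  split.
    apply: measurable_maxr => //; apply: measurable_minr => //.
    by case: (bounded_mfunZ tau^-1 bscore).
  by exists 1 => x; rewrite ler_norml clip1_itv.
have ig f : bounded_mfun f -> P.-integrable setT (EFin \o (fun x => g x * f x)).
  by move=> bf; apply: sq_integrableM => //; exact: sq_integrable_bounded.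
have icn : P.-integrable setT (EFin \o (fun x => `|g x| * cosh_noise theta o x)).
  apply: sq_integrableM; first exact: sq_integrable_norm.
  by apply: sq_integrable_bounded; exact: bounded_cosh_noise.
have -> : \sum_(j < M) Delta j * coord_sum m q M h j o.1 o.2 =
    \int[P]_x (g x * score o.1 o.2 x).
  under eq_Rintegral => x _.
    rewrite /score mulr_sumr; under eq_bigr do rewrite mulrCA.
    over.
  rewrite (@Rintegral_sum_integrable _ _ _ P M
      (fun j x => coord_sum m q M h j o.1 o.2 * (g x * phi j x))) => [|j]; last first.
    by apply: integrableZR; exact: ig.
  by apply: eq_bigr => j _; rewrite RintegralZl ?gphi 1?mulrC//; exact: ig.
rewrite -!RintegralZl//; try exact: ig.
rewrite -RintegralB//; try exact: integrableZR; try exact: ig.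
apply: le_RintegralR.
- apply: eq_integrable (integrableDR (ig _ bscore) (integrableZR (- C) icn)) => // x _.
  by rewrite /= mulNr.
- by apply: integrableZR; exact: ig.
move=> x.
pose v := q%:R * kappa * \sum_(j < M) Delta j * phi j x.
have sE : score o.1 o.2 x = v + noise_fun o x.
  rewrite /score /v /noise_fun mulr_sumr -big_split/=; apply: eq_bigr => j _.
  by rewrite /coord_noise; ring.
have vt : `|v| <= tau / 2 by exact: drift_bound.
have := clip1_defect (noise_fun o x) t0 th0 vt; rewrite -sE -/C -/(cosh_noise theta o x).
move=> df; have := ler_wpM2l (normr_ge0 (g x)) df; rewrite -normrM mulrBr.
move=> /(le_trans (ler_norm _)); rewrite (mulrCA `|g x|) (mulrCA (g x)); lra.
Qed.

Let block_exp_proc lam o : exp_proc pX pY (block_weight (- lam) h.+1) n1 o.1 o.2 =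
  - level_stat (block_weight lam h.+1) o
  + lam * m%:R * (e8 * \int[P]_x (g x * clip1 (tau^-1 * score o.1 o.2 x)))
  - 16 * lam ^+ 2 * m%:R.
Proof.
set I := \int[P]_x _.
pose B : R := \sum_(i < n1 | (i %/ m == h.+1)%N) bit_diff i o.1 o.2.
have -> : level_stat (block_weight lam h.+1) o = lam * B - 8 * lam ^+ 2 * m%:R.
  rewrite [8 * lam ^+ 2 * m%:R]mulrC -(sum_block_const (h := h.+1) (n := n1))// /B mulr_sumr -sumrB.
  rewrite /level_stat [RHS]big_mkcond/=; apply: eq_bigr => i _; rewrite /block_weight.
  by case: ifP => _ //; rewrite mul0r expr0n/= mulr0 subr0.
have -> : exp_proc pX pY (block_weight (- lam) h.+1) n1 o.1 o.2 =
    - lam * B + m%:R * (lam * (e8 * I) - 8 * lam ^+ 2).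
  rewrite -(sum_block_const (h := h.+1) (n := n1))// /B mulr_sumr -big_split/=.
  rewrite /exp_proc [RHS]big_mkcond/=; apply: eq_bigr => i _; rewrite /block_weight.
  case: ifP => [ib|_]; last by rewrite mul0r expr0n/= mulr0 subr0.
  by rewrite muB// -/I sqrrN; ring.
ring.
Qed.

(** The parts of [G] control the score block, the cross noise and the clipping bias [F], whose mean
    of at most [4 e] explains the normaliser [12 e]. Weight [1 / sqrt m] turns the doubled
    compensator [16 lam^2 m] into the constant 16. *)
Lemma interactive_level_power (beta theta Th : R) :
  0 < beta < 1 -> (0 < M)%N -> 0 < s -> 0 < tau -> 0 < theta -> 0 < e8 ->
  8 * q%:R * theta ^+ 2 * s ^+ 2 * M%:R <= 1 ->
  4 * q%:R ^+ 2 * kappa ^+ 2 * s ^+ 2 * M%:R * En <= tau ^+ 2 ->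
  theta^-1 * expR (- (theta * tau / 2)) * (12 * expR 1 / beta) <= q%:R * kappa * En / 8 ->
  64 * ln (3 / beta) / kappa <= q%:R * kappa * En / 8 ->
  Th + ln (3 / beta) + 16 <= Num.sqrt m%:R * e8 * (q%:R * kappa * En) / (2 * tau) ->
  exists G : zst * wst -> R, [/\ forall o, 0 <= G o,
    bit_expect pX pY G <= beta &
    forall o, level_stat (block_weight (Num.sqrt m%:R)^-1 h.+1) o < Th -> 1 <= G o].
Proof.
move=> /andP[b0 b1] M0 s0 t0 th0 e80 hth htau c0 c2 c1.
have qp : 0 < q%:R :> R by rewrite ltr0n.
have mp : 0 < m%:R :> R by rewrite ltr0n.
set sm := Num.sqrt m%:R in c1 *.
have smp : 0 < sm by rewrite sqrtr_gt0.
have sm2 : sm ^+ 2 = m%:R by rewrite sqr_sqrtr// ltW.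
pose lam := sm^-1.
pose eta := kappa / 64.
have etap : 0 < eta by rewrite divr_gt0.
pose v j := - (eta * Delta j).
pose X1 o := exp_proc pX pY (block_weight (- lam) h.+1) n1 o.1 o.2.
pose X2 (o : zst * wst) : R := \sum_(j < M) v j * noise j o - 8 * q%:R * \sum_(j < M) v j ^+ 2.
pose F (o : zst * wst) : R := \int[P]_x (`|g x| * cosh_noise theta o x).
have F0 o : 0 <= F o.
  by apply: Rintegral_ge0 => x _; rewrite mulr_ge0// addr_ge0 ?expR_ge0.
have e1p : 0 < expR (1 : R) by exact: expR_gt0.
exists (fun o => beta / 3 * expR (X1 o) + beta / 3 * expR (X2 o) +
  beta / (12 * expR 1) * F o).
have cF : 0 < 12 * expR (1 : R) by rewrite mulr_gt0.
have hb : 0 < beta / 3 by rewrite divr_gt0.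
have hb' : 0 < beta / (12 * expR 1) by rewrite divr_gt0.
split; [move=> o| |move=> o].
- by rewrite !addr_ge0// mulr_ge0 ?expR_ge0// ltW.
- rewrite !bit_expectD !bit_expectZ.
  have h1 : bit_expect pX pY (fun o => expR (X1 o)) <= 1.
    apply: exp_supermartingale => // i zs zs' ws ws' _ _; by [].
  have h2 : bit_expect pX pY (fun o => expR (X2 o)) <= 1 by exact: linear_mgf.
  have h3 : bit_expect pX pY F <= 4 * expR 1 by exact: cosh_noise_mgf.
  have e3 : beta / (12 * expR 1) * (4 * expR 1) = beta / 3.
    by field; rewrite gt_eqF.
  have := ler_wpM2l (ltW hb) h1; have := ler_wpM2l (ltW hb) h2.
  have := ler_wpM2l (ltW hb') h3; rewrite e3 !mulr1; lra.
apply: contraTT; rewrite -ltNge -leNgt => lt.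
have hX (X : R) : beta / 3 * expR X < 1 -> X < ln (3 / beta).
  rewrite -ltr_pdivlMl ?divr_gt0// mulr1 invf_div => hx.
  by rewrite -ltr_expR lnK// posrE divr_gt0.
have p1 : 0 < beta / 3 * expR (X1 o) by rewrite mulr_gt0 ?expR_gt0.
have p2 : 0 < beta / 3 * expR (X2 o) by rewrite mulr_gt0 ?expR_gt0.
have p3 : 0 <= beta / (12 * expR 1) * F o by rewrite mulr_ge0// ltW.
have x1 : X1 o < ln (3 / beta) by apply: hX; lra.
have x2 : X2 o < ln (3 / beta) by apply: hX; lra.
have x3 : F o <= 12 * expR 1 / beta.
  have : beta / (12 * expR 1) * F o <= 1 by lra.
  by rewrite -ler_pdivlMl// mulr1 invf_div.
have sig := signal_bound o s0 t0 th0 M0 htau.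
rewrite -/(F o) in sig.
set C := theta^-1 * expR _ in sig c0.
have C0 : 0 <= C by rewrite mulr_ge0 ?expR_ge0// invr_ge0 ltW.
have CF := le_trans (ler_wpM2l C0 x3) c0.
have aD : \sum_(j < M) Delta j * coord_sum m q M h j o.1 o.2 =
    q%:R * kappa * En + \sum_(j < M) Delta j * noise j o.
  rewrite /En mulr_sumr -big_split/=; apply: eq_bigr => j _.
  by rewrite /coord_noise; ring.
have X2E : X2 o = - (eta * \sum_(j < M) Delta j * noise j o) - 8 * q%:R * (eta ^+ 2 * En).
  rewrite /X2.
  have -> : eta * (\sum_(j < M) Delta j * noise j o) = - \sum_(j < M) v j * noise j o.
    by rewrite mulr_sumr -sumrN; apply: eq_bigr => j _; rewrite /v; ring.
  have -> : eta ^+ 2 * En = \sum_(j < M) v j ^+ 2.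
    by rewrite /En mulr_sumr; apply: eq_bigr => j _; rewrite /v; ring.
  by rewrite opprK.
have X1E := block_exp_proc lam o; rewrite -/(X1 o) in X1E.
rewrite aD in sig.
have X1E' : X1 o = - level_stat (block_weight lam h.+1) o + (sm * e8) *
    \int[P]_x (g x * clip1 (tau^-1 * score o.1 o.2 x)) - 16.
  have lm : lam * m%:R = sm by rewrite /lam -sm2 expr2 mulrA mulVf ?gt_eqF// mul1r.
  have l2 : lam ^+ 2 * m%:R = 1 by rewrite /lam exprVn sm2 mulVf// gt_eqF.
  by rewrite X1E -(mulrA 16) l2 lm mulr1 (mulrA sm).
have En0 : 0 <= En by apply: sumr_ge0 => j _; exact: sqr_ge0.
exact: (interactive_power_arith x1 x2 X2E sig CF X1E' c2 c1 kp En0 (ltW qp) t0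
  (mulr_ge0 (ltW smp) (ltW e80))).
Qed.

End interactive_power.

(** * Choice of the resolution *)

Lemma ln2_ge_half {R : realType} : 1 / 2 <= ln (2 : R).
Proof.
rewrite -[leLHS]expRK ler_ln ?posrE ?expR_gt0//.
by apply: (le_trans (expR_le_quad _)); lra.
Qed.

Lemma ln_pow2_ge {R : realType} (k : nat) (x : R) : (2 ^ k)%:R <= x -> k%:R / 2 <= ln x.
Proof.
move=> kx; apply: (@le_trans _ _ (ln ((2 ^ k)%:R : R))); last first.
  by rewrite ler_ln ?posrE// (lt_le_trans _ kx)// ltr0n expn_gt0.
rewrite natrX lnXn// -[leRHS]mulr_natl ler_wpM2l//.
by have := @ln2_ge_half R; lra.
Qed.

(* The rate is [z ^ p] with [z] the inverse effective sample size; resolution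
   [2 ^ nu] balances the variance [M ^ a * z] against the bias [2 ^ (- 2 s nu)]. *)
Lemma level_choice {R : realType} (a s z : R) (d : nat) :
  1 <= a -> 0 < s -> (0 < d)%N -> 0 < z <= 1 ->
  let p := 2 * s / (4 * s + 2 * a * d%:R) in
  exists nu : nat, [/\ (2 ^ nu)%:R <= z^-1, ((2 ^ nu) ^ d)%:R <= z^-1,
    ((2 ^ nu) ^ d)%:R `^ a * z <= (z `^ p) ^+ 2 &
    (2 ^ nu)%:R `^ (- (2 * s)) <= 2 `^ (2 * s) * (z `^ p) ^+ 2].
Proof.
move=> a1 s0 d0 /andP[z0 z1] p.
have dp : 1 <= d%:R :> R by rewrite ler1n.
pose t := 2 * s + a * d%:R.
have ad1 : 1 <= a * d%:R by rewrite -[leLHS]mulr1 ler_pM.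
have t1 : 1 <= t by rewrite /t; lra.
have tp : 0 < t by lra.
(* [x] is the ideal resolution: since [p = s / t], the squared radius [(z ^ p) ^ 2] is
   [x ^ (- 2 s)], and variance and bias become powers of [x] as well. *)
have [x x1 zx] : exists2 x, 1 <= x & z = x `^ (- t).
  exists (z `^ (- t^-1)); last by rewrite -powRrM mulrNN mulVf ?gt_eqF// powRr1// ltW.
  rewrite powRN invf_ge1 ?powR_gt0//.
  have <- : 1 `^ t^-1 = 1 :> R by rewrite powR1.
  apply: ge0_ler_powR; [by rewrite invr_ge0 ltW|by rewrite nnegrE ltW|by rewrite nnegrE|exact: z1].
have xp : 0 < x by lra.
have xp' := ltW xp.
have pt : t * p = s.
  by rewrite /p /t; field; rewrite gt_eqF// -/t; rewrite /t in tp; lra.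
have zp : (z `^ p) ^+ 2 = x `^ (- (2 * s)).
  by rewrite zx -powRrM mulNr pt expr2 -powRD ?(gt_eqF xp) ?implybT// -mulr2n mulNrn mulr_natl.
have xz e : 0 <= e -> e <= t -> x `^ e <= z^-1.
  move=> e0 et; rewrite zx powRN invrK; exact: ler_powR.
have [n0 nx xn] : [/\ (0 < Num.truncn x)%N, (Num.truncn x)%:R <= x & x < (Num.truncn x).+1%:R].
  have /andP[h1 h2] := truncn_itv (ltW xp); split=> //.
  by rewrite truncn_gt0.
(* Rounding to a power of two loses at most a factor 2 in resolution, which is the [2 ^ (2 s)] in
   the bias. *)
pose nu := trunc_log 2 (Num.truncn x).
have /andP[l1 l2] := trunc_log_bounds (isT : (1 < 2)%N) n0.
have k0 : 0 < (2 ^ nu)%:R :> R by rewrite ltr0n expn_gt0.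
have k0' := ltW k0.
have kx : (2 ^ nu)%:R <= x by apply: le_trans nx; rewrite ler_nat.
have xk : x <= 2 * (2 ^ nu)%:R.
  by apply: (le_trans (ltW xn)); rewrite -natrM -expnS ler_nat.
exists nu; split.
- apply: (le_trans kx); rewrite -[leLHS]powRr1//; exact: xz.
- rewrite natrX; apply: (@le_trans _ _ (x ^+ d)); first by rewrite lerXn2r ?nnegrE.
  rewrite -powR_mulrn//; apply: xz; first lra.
  by rewrite /t; have := mulr_ge0 (_ : 0 <= a - 1) (_ : 0 <= d%:R :> R); nra.
- rewrite zp natrX -powR_mulrn// -powRrM zx.
  apply: (@le_trans _ _ (x `^ (d%:R * a) * x `^ (- t))).
    rewrite ler_wpM2r ?powR_ge0//; apply: ge0_ler_powR => //.
    by rewrite mulrC; lra.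
  rewrite -powRD; last by rewrite (gt_eqF xp) implybT.
  by rewrite /t (_ : d%:R * a - (2 * s + a * d%:R) = - (2 * s))//; ring.
- rewrite zp !powRN ler_pdivlMr ?powR_gt0//.
  rewrite mulrC ler_pdivrMr ?powR_gt0// -powRM//.
  by apply: ge0_ler_powR => //; rewrite ?nnegrE ?mulr_ge0// ltW.
Qed.

(* [2 r] bounds the L2 distance of any two densities of the class, so a radius above it leaves
   nothing to prove; the last term absorbs the bias of [sobolev_difference]. *)
Definition radius_const {R : realType} (s r C : R) : R :=
  1 + 2 * r + C + 4 * r ^+ 2 * 2 `^ (2 * s).

Lemma energy_level {R : realType} (d : nat) (a s r C z p : R) (f g : d.-tuple R -> R) :
  1 <= a -> 0 < s -> 0 < r -> 0 <= C -> 0 < z -> (0 < d)%N -> 1 <= p <= 2 ->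
  sobolev_F s r f -> sobolev_F s r g ->
  ((radius_const s r C * z `^ (2 * s / (4 * s + 2 * a * d%:R)))%:E <= lp_dist p f g)%E ->
  exists nu : nat, [/\ (2 ^ nu)%:R <= z^-1, ((2 ^ nu) ^ d)%:R <= z^-1 &
    C * (((2 ^ nu) ^ d)%:R `^ a * z) <= energy (coef_diff f g) (2 ^ nu)].
Proof.
move=> a1 s0 r0 C0 z0 d0 p12 Ff Fg.
have [Sf [mf _]] := Ff; have [Sg [mg _]] := Fg.
have [sh h4 _ hK] := sobolev_difference s0 mf mg Sf Sg.
set q := _ / _; set c := radius_const _ _ _.
have zq : 0 < z `^ q by exact: powR_gt0.
have tw : 0 <= 4 * r ^+ 2 * 2 `^ (2 * s).
  by apply: mulr_ge0; [apply: mulr_ge0 => //; exact: sqr_ge0|exact: powR_ge0].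
have c1 : c = 1 + 2 * r + C + 4 * r ^+ 2 * 2 `^ (2 * s) by [].
set w := 4 * r ^+ 2 * 2 `^ (2 * s) in tw c1.
have wE : 4 * r ^+ 2 * 2 `^ (2 * s) = w by [].
clearbody c w; have cp : 0 < c by lra.
move=> /(lp_dist_le_l2 sh p12 (mulr_gt0 cp zq)) le.
(* For [z > 1] the radius exceeds [2 r], while the squared L2 distance is at most [4 r ^ 2]. *)
have [z1|z1] := leP z 1; last first.
  exfalso.
  have q0 : 0 <= q by rewrite divr_ge0// ?addr_ge0 ?mulr_ge0//; lra.
  have zq1 : 1 <= z `^ q.
    have <- : 1 `^ q = 1 :> R by rewrite powR1.
    by apply: ge0_ler_powR; rewrite ?nnegrE//; lra.
  have cz : c <= c * z `^ q by rewrite ler_peMr// ltW.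
  have := le_trans le h4; move: (c * z `^ q) cz => v cz; nra.
have zz : 0 < z <= 1 by rewrite z0 z1.
have [nu [n1 n2 n3 n4]] := level_choice a1 s0 d0 zz.
exists nu; split=> //.
have := le_trans le (hK _ (_ : (0 < 2 ^ nu)%N)); rewrite expn_gt0 => /(_ isT).
rewrite -/q in n3 n4; set E := energy _ _ => hE.
have k1 := ler_wpM2l C0 n3.
have r4 : 0 <= 4 * r ^+ 2 by apply: mulr_ge0 => //; exact: sqr_ge0.
have k2 := ler_wpM2l r4 n4.
move: n3 n4 hE k1 k2 => _ _.
move: (_ `^ a * z) ((2 ^ nu)%:R `^ _) => Q1 Q2.
rewrite (mulrA (4 * r ^+ 2)) wE exprMn; set W := (z `^ q) ^+ 2.
have W0 : 0 <= W by exact: sqr_ge0.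
move=> hE k1 k2.
(* As [c >= 1], [c ^ 2 >= c >= C + w]: the share [w] pays for the bias and [C] is left for the
   energy. *)
have cc : (C + w) * W <= c ^+ 2 * W.
  rewrite ler_wpM2r//; apply: (@le_trans _ _ c); first lra.
  by rewrite expr2 ler_peMr ?ltW//; lra.
have := mulrDl C w W; lra.
Qed.

Lemma leq_half_div {R : realFieldType} (x y : nat) : (0 < y)%N -> (y <= x)%N ->
  x%:R <= 2 * y%:R * (x %/ y)%:R :> R.
Proof.
move=> y0 yx; rewrite -!natrM ler_nat.
have h1 := ltn_ceil x y0; have h2 : (0 < x %/ y)%N by rewrite divn_gt0.
nia.
Qed.

(** [alpha + beta <= 1/2] forces [alpha beta <= 1/16], so the sample size condition gives
    [N >= 2 ^ 20] and [ln N >= 20 / 2]. Here [y] is the argument of the logarithm, in the rate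
    lemmas the logarithm itself. The last item is meant for the number [v] of levels and bounds the
    rejection threshold. *)
Lemma ln_budget {R : realType} (alpha beta N : R) (y := ln N / (alpha * beta)) :
  0 < alpha < 1 -> 0 < beta < 1 -> alpha + beta <= 2^-1 ->
  2 ^+ 20 * ln ((alpha * beta)^-1) <= N ->
  [/\ 2 ^+ 20 <= N, 10 <= ln N, 7 / 2 <= ln y,
  ln (6 / beta) <= ln y &
  forall v, 0 < v -> v <= 3 * ln N -> ln (v / alpha) <= 2 * ln y].
Proof.
move=> /andP[a0 a1] /andP[b0 b1] ab hN.
have ab0 : 0 < alpha * beta by rewrite mulr_gt0.
have ab16 : alpha * beta <= 1 / 16.
  by have := sqr_ge0 (alpha - beta); nra.
have abi : 16 <= (alpha * beta)^-1.
  by rewrite -[leLHS]invrK lef_pV2 ?posrE ?invr_gt0//; lra.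
have l2 : 1 <= ln ((alpha * beta)^-1).
  have h : (2 ^ 4)%:R <= (alpha * beta)^-1 by apply: le_trans abi; rewrite ler_nat.
  by have := ln_pow2_ge h; lra.
have N1 : 2 ^+ 20 <= N.
  by apply: le_trans hN; rewrite ler_peMr// exprn_ge0.
have N0 : 0 < N by apply: lt_le_trans N1; rewrite exprn_gt0.
have lN : 10 <= ln N.
  apply: (@le_trans _ _ (ln (2 ^+ 20))); last by rewrite ler_ln ?posrE ?exprn_gt0.
  rewrite lnXn// -[leRHS]mulr_natl.
  by have := @ln2_ge_half R; lra.
have y0 : 0 < y by rewrite divr_gt0//; lra.
have y160 : 160 <= y by rewrite /y ler_pdivlMr//; lra.
have yl : 7 / 2 <= ln y.
  by apply: (@ln_pow2_ge _ 7); apply: le_trans y160; rewrite ler_nat.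
have yb : 6 / beta <= y.
  rewrite /y ler_pdivlMr// mulrA mulrAC divfK ?gt_eqF//.
  nra.
split=> //.
- by rewrite ler_ln// posrE divr_gt0.
move=> v v0 vN; apply: (@le_trans _ _ (ln (y * y))); last first.
  by rewrite lnM ?posrE//; lra.
rewrite ler_ln//; [|by rewrite posrE divr_gt0|by rewrite posrE mulr_gt0].
apply: (@le_trans _ _ (3 * ln N / alpha)); first by rewrite ler_pM2r ?invr_gt0.
apply: (@le_trans _ _ (3 * y)); last by rewrite ler_pM2r//; lra.
rewrite -mulrA ler_pM2l// /y ler_pM2l; last lra.
by rewrite lef_pV2 ?posrE// ler_piMr// ltW.
Qed.

Lemma rr_mean_diff {R : realType} d n1 n2 (eps : R)
    (u : nat -> d.-tuple R -> n1.-tuple bool -> n2.-tuple bool -> R)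
    (u1 : forall i x zs ws, -1 <= u i x zs ws <= 1)
    (um : forall i, measurable_fun setT
      (fun p : d.-tuple R * (n1.-tuple bool * n2.-tuple bool) => u i p.1 p.2.1 p.2.2))
    (f g : d.-tuple R -> R) i zs ws :
  (forall x, 0 <= f x) -> is_density f -> (forall x, 0 <= g x) -> is_density g ->
  rr_mean eps u f i zs ws - rr_mean eps u g i zs ws =
  eps / 8 * \int[cube_prob d]_x ((f x - g x) * u i x zs ws).
Proof.
move=> f0 df g0 dg; rewrite /rr_mean /rr_prob.
have iu h : (forall x, 0 <= h x) -> is_density h ->
    (cube_prob d).-integrable setT (EFin \o (fun x => h x * u i x zs ws)).
  move=> h0 dh; apply: (integrable_density_mul h0 dh (um_x um i zs ws)) => x.
  exact: u_norm u1 _ _ _ _.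
under [in RHS]eq_Rintegral do rewrite mulrBl.
by rewrite RintegralB//; [field|exact: iu|exact: iu].
Qed.

Lemma density_diff_norm1 {R : realType} d (f g : d.-tuple R -> R) :
  (forall x, 0 <= f x) -> is_density f -> (forall x, 0 <= g x) -> is_density g ->
  \int[cube_prob d]_x `|f x - g x| <= 2.
Proof.
move=> f0 df g0 dg.
have fi := density_integrable f0 df; have gi := density_integrable g0 dg.
have [mf _] := df; have [mg _] := dg.
have fgi := integrableDR fi gi.
have -> : 2 = \int[cube_prob d]_x (f x + g x).
  by rewrite RintegralD// !density_Rintegral.
have le x : `|f x - g x| <= f x + g x.
  by rewrite (le_trans (ler_normB _ _))// !ger0_norm.
apply: le_RintegralR => //; apply: (le_integrableR (g := fun x => f x + g x)) => //.
  apply: (measurableT_comp (@normr_measurable R setT)); exact: measurable_funB.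
by move=> x; rewrite normr_id.
Qed.

(** * The two mechanisms *)

Section mechanism.
Context {R : realType} (d n1 V : nat).

(** Each of the [V] levels owns two consecutive blocks, an even and an odd one. *)
Definition bsize : nat := (n1 %/ (2 * V))%N.
Definition ncoord (nu : nat) : nat := ((2 ^ nu) ^ d)%N.
Definition reps (nu : nat) : nat := (bsize %/ ncoord nu)%N.
Definition lev (i : nat) : nat := ((i %/ bsize)./2)%N.

(** The default, the zero index, serves the leftover users of a block, whose coordinate number is
    out of range; [probes] keeps them out of the coordinate sums. *)
Definition probe_idx (nu j : nat) : d.-tuple nat :=
  nth [tuple of nseq d 0%N] [seq ord_idx l | l : d.-tuple 'I_(2 ^ nu)] j.

Lemma sum_probe_idx nu (F : d.-tuple nat -> R) :
  \sum_(l : d.-tuple 'I_(2 ^ nu)) F (ord_idx l) = \sum_(j < ncoord nu) F (probe_idx nu j).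
Proof.
pose r := [seq ord_idx l | l : d.-tuple 'I_(2 ^ nu)].
have <- : \sum_(t <- r) F t = \sum_(l : d.-tuple 'I_(2 ^ nu)) F (ord_idx l).
  by rewrite /r big_map big_enum.
rewrite (big_nth [tuple of nseq d 0%N]) big_mkord.
have -> : size r = ncoord nu by rewrite /r size_map -cardE card_tuple card_ord.
by [].
Qed.

Definition trig_sup : R := Num.sqrt 2 ^+ d.

Lemma trig_sup_sq : trig_sup ^+ 2 = 2 ^+ d.
Proof. by rewrite /trig_sup exprAC sqr_sqrtr. Qed.

Lemma trig_sup_gt0 : 0 < trig_sup.
Proof. by rewrite exprn_gt0// sqrtr_gt0. Qed.

Definition probe (i : nat) (x : d.-tuple R) : R :=
  trig_sup^-1 * trig (probe_idx (lev i) (coord bsize (reps (lev i)) i)) x.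

Lemma probe_itv i x : -1 <= probe i x <= 1.
Proof.
rewrite -ler_norml normrM gtr0_norm ?invr_gt0 ?trig_sup_gt0//.
by rewrite ler_pdivrMl ?trig_sup_gt0// mulr1 trig_le.
Qed.

Lemma measurable_probe i : measurable_fun setT (probe i).
Proof. by have [] := bounded_mfunZ trig_sup^-1 (bounded_trig (R := R) (probe_idx (lev i) (coord bsize (reps (lev i)) i))). Qed.

Lemma block_fits nu : (nu < V)%N -> ((nu.*2).+2 * bsize <= n1)%N.
Proof.
move=> nV; apply: (@leq_trans (2 * V * bsize)).
  by rewrite leq_mul2r -doubleS -mul2n leq_mul2l nV !orbT.
by rewrite mulnC leq_trunc_div.
Qed.

Lemma lev_block i nu (b : bool) : (i %/ bsize = b + nu.*2)%N -> lev i = nu.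
Proof. by rewrite /lev => ->; rewrite half_bit_double. Qed.

Lemma reps_fit nu : (ncoord nu * reps nu <= bsize)%N.
Proof. by rewrite mulnC leq_trunc_div. Qed.

Lemma bsize_gt0 nu : (0 < reps nu)%N -> (0 < bsize)%N.
Proof. by rewrite /reps; case: (posnP bsize) => // ->; rewrite div0n. Qed.

Lemma ncoord_gt0 nu : (0 < ncoord nu)%N.
Proof. by rewrite expn_gt0 expn_gt0. Qed.

End mechanism.

(** [eps / 8] is half the response slope [eps / 4], and [trig_sup] comes from scaling the probe into
    [[-1, 1]]; their quotient is the [kappa] of the power lemmas. *)
Lemma probe_drift {R : realType} (d n1 V : nat) (f g : d.-tuple R -> R) (eps : R) i nu :
  (forall x, 0 <= f x) -> is_density f -> (forall x, 0 <= g x) -> is_density g ->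
  lev n1 V i = nu ->
  eps / 8 * \int[cube_prob d]_x ((f x - g x) * probe n1 V i x) =
  eps / (8 * trig_sup d) *
    coef_diff f g (probe_idx d nu (coord (bsize n1 V) (reps d n1 V nu) i)).
Proof.
move=> f0 df g0 dg il; rewrite /probe il.
under eq_Rintegral do rewrite mulrCA.
rewrite RintegralZl//.
  by rewrite /coef_diff; field; rewrite gt_eqF ?trig_sup_gt0.
have bt : bounded_mfun (trig (probe_idx d nu (coord (bsize n1 V) (reps d n1 V nu) i))
    : d.-tuple R -> R).
  exact: bounded_trig.
have [mt [K tK]] := bt.
apply: eq_integrable (integrableDR (integrable_density_mul f0 df mt tK)
  (integrableZR (-1) (integrable_density_mul g0 dg mt tK))) => // x _.
by rewrite /= mulN1r -mulrBl.
Qed.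

Section noninteractive_test.
Context {R : realType} (d n1 n2 V : nat) (eps alpha beta : R).
Local Notation zst := (n1.-tuple bool).
Local Notation wst := (n2.-tuple bool).
Local Notation m := (bsize n1 V).
Local Notation q := (reps d n1 V).
Local Notation M := (ncoord d).

Definition ni_obs (i : nat) (x : d.-tuple R) (zs : zst) (ws : wst) : R :=
  probe n1 V i x.

Definition ni_scale (nu : nat) : R :=
  (64 * (q nu)%:R * Num.sqrt (M nu)%:R * (8 + ln (6 / beta)))^-1.

Definition ni_weight (nu : nat) : nat -> zst -> wst -> R :=
  quad_weight m (q nu) (M nu) (ni_scale nu) nu.*2.

Lemma ni_obs_itv i x zs ws : -1 <= ni_obs i x zs ws <= 1.
Proof. exact: probe_itv. Qed.

Lemma ni_obs_measurable i : measurable_fun setT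
  (fun p : d.-tuple R * (zst * wst) => ni_obs i p.1 p.2.1 p.2.2).
Proof. exact: (measurableT_comp (measurable_probe n1 V i) measurable_fst). Qed.

Lemma ni_obs_causal x : causal_fun (fun i => ni_obs i x).
Proof. by []. Qed.

Hypothesis eps01 : 0 < eps <= 1.
Hypothesis n12 : (n1 <= n2)%N.
Hypothesis beta01 : 0 < beta < 1.
Variables fX fY : d.-tuple R -> R.
Hypotheses (fX0 : forall x, 0 <= fX x) (dX : is_density fX).
Hypotheses (fY0 : forall x, 0 <= fY x) (dY : is_density fY).
Local Notation kappa := (eps / (8 * trig_sup d)).

Lemma ni_drift nu (b : bool) i zs ws : probes m (q nu) (M nu) (b + nu.*2) i ->
  rr_mean eps ni_obs fX i zs ws - rr_mean eps ni_obs fY i zs ws =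
  kappa * coef_diff fX fY (probe_idx d nu (coord m (q nu) i)).
Proof.
move=> /andP[/eqP /lev_block il _].
by rewrite (rr_mean_diff _ ni_obs_itv ni_obs_measurable)// (probe_drift eps _ _ _ _ il).
Qed.

Lemma noninteractive_power nu : (nu < V)%N -> (0 < q nu)%N ->
  ln (V%:R / alpha) <= 7 / 8 * (ni_scale nu * (q nu)%:R ^+ 2 * kappa ^+ 2 *
    energy (coef_diff fX fY) (2 ^ nu)) - 2 * ln (3 / beta) - 1 / 64 ->
  (prob_accept (rr_channel eps ni_obs) (rr_channel eps ni_obs) fX fY
     (level_reject V alpha ni_weight) <= beta%:E)%E.
Proof.
move=> nV q0 hT; have m0 := bsize_gt0 q0.
have pXc := rr_mean_causal eps fX ni_obs_causal.
have pYc := rr_mean_causal eps fY ni_obs_causal.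
have pX01 i zs ws : 0 <= rr_mean eps ni_obs fX i zs ws <= 1.
  exact: (rr_mean01 eps01 ni_obs_itv ni_obs_measurable fX0 dX).
have pY01 i zs ws : 0 <= rr_mean eps ni_obs fY i zs ws <= 1.
  exact: (rr_mean01 eps01 ni_obs_itv ni_obs_measurable fY0 dY).
rewrite /energy (sum_probe_idx nu (fun l => coef_diff fX fY l ^+ 2)) in hT.
have muA i zs ws : probes m (q nu) (M nu) nu.*2 i ->
    rr_mean eps ni_obs fX i zs ws - rr_mean eps ni_obs fY i zs ws =
    kappa * coef_diff fX fY (probe_idx d nu (coord m (q nu) i)) := @ni_drift nu false i zs ws.
have muB i zs ws : probes m (q nu) (M nu) nu.*2.+1 i ->
    rr_mean eps ni_obs fX i zs ws - rr_mean eps ni_obs fY i zs ws =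
    kappa * coef_diff fX fY (probe_idx d nu (coord m (q nu) i)) := @ni_drift nu true i zs ws.
have [G [G0 Gb G1]] := quad_level_power (Delta := fun j => coef_diff fX fY (probe_idx d nu j))
  pX01 pY01 pXc pYc n12 m0 q0 (reps_fit d n1 V nu) (block_fits n1 nV) muA muB beta01
  (ncoord_gt0 d nu) hT.
apply: (prob_accept_level eps01 ni_obs_itv ni_obs_measurable fX0 fY0 dX dY G0 _ Gb).
move=> o nrej; apply: G1; rewrite ltNge; apply/negP => le.
by apply: nrej; exists nu.
Qed.

End noninteractive_test.

Section interactive_test.
Context {R : realType} (d n1 n2 V : nat) (eps alpha beta : R) (tau : nat -> R).
Local Notation zst := (n1.-tuple bool).
Local Notation wst := (n2.-tuple bool).
Local Notation m := (bsize n1 V).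
Local Notation q := (reps d n1 V).
Local Notation M := (ncoord d).

Definition si_score (nu : nat) (zs : zst) (ws : wst) (x : d.-tuple R) : R :=
  score m (q nu) (M nu) nu.*2 (fun j => trig (probe_idx d nu j)) zs ws x.

(* Even blocks probe the Fourier coefficients of their level; the next odd block
   releases the clipped empirical estimate of [fX - fY] at its own datum. *)
Definition si_obs (i : nat) (x : d.-tuple R) (zs : zst) (ws : wst) : R :=
  if odd (i %/ m) then
    clip1 ((tau (lev n1 V i))^-1 * si_score (lev n1 V i) zs ws x)
  else probe n1 V i x.

Definition si_weight (nu : nat) : nat -> zst -> wst -> R :=
  block_weight m (Num.sqrt m%:R)^-1 nu.*2.+1.

Lemma si_obs_itv i x zs ws : -1 <= si_obs i x zs ws <= 1.
Proof. by rewrite /si_obs; case: ifP => _; [exact: clip1_itv|exact: probe_itv]. Qed.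

Lemma si_obs_measurable i : measurable_fun setT
  (fun p : d.-tuple R * (zst * wst) => si_obs i p.1 p.2.1 p.2.2).
Proof.
rewrite /si_obs; case: (odd _); last first.
  exact: (measurableT_comp (measurable_probe n1 V i) measurable_fst).
apply: measurable_maxr => //; apply: measurable_minr => //.
apply: measurable_funM => //; apply: measurable_sum => j.
apply: measurable_funM.
  have mc : measurable_fun setT (fun o : zst * wst =>
      coord_sum m (q (lev n1 V i)) (M (lev n1 V i)) (lev n1 V i).*2 j o.1 o.2 : R).
    by move=> _ B _; rewrite setTI; exact: measurable_bool_outcomes.
  exact: (measurableT_comp mc measurable_snd).
have [mt _] := bounded_trig (R := R) (probe_idx d (lev n1 V i) j).
exact: (measurableT_comp mt measurable_fst).
Qed.

Lemma si_obs_causal x : causal_fun (fun i => si_obs i x).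
Proof.
move=> i zs zs' ws ws' Hz Hw; rewrite /si_obs; case: ifP => // oi.
have m0 : (0 < m)%N by case: (posnP m) oi => // ->; rewrite divn0.
congr (clip1 (_ * _)); apply: eq_bigr => j _; congr (_ * _).
apply: (coord_sum_causal _ _ _ _ m0 Hz Hw).
(* A user of block [2 nu + 1] comes after all of block [2 nu], so the coordinate sums in the score
   are already known. *)
by rewrite -leq_divRL// /lev -[leqRHS]odd_double_half oi.
Qed.

Hypothesis eps01 : 0 < eps <= 1.
Hypothesis n12 : (n1 <= n2)%N.
Hypothesis beta01 : 0 < beta < 1.
Variables fX fY : d.-tuple R -> R.
Hypotheses (fX0 : forall x, 0 <= fX x) (dX : is_density fX).
Hypotheses (fY0 : forall x, 0 <= fY x) (dY : is_density fY).
Local Notation kappa := (eps / (8 * trig_sup d)).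

Lemma si_drift_probe nu i zs ws : probes m (q nu) (M nu) nu.*2 i ->
  rr_mean eps si_obs fX i zs ws - rr_mean eps si_obs fY i zs ws =
  kappa * coef_diff fX fY (probe_idx d nu (coord m (q nu) i)).
Proof.
move=> /andP[/eqP ib _]; have il := @lev_block n1 V i nu false ib.
rewrite (rr_mean_diff _ si_obs_itv si_obs_measurable)// -(probe_drift eps _ _ _ _ il)//.
by rewrite /si_obs ib odd_double.
Qed.

Lemma si_drift_score nu i zs ws : (i %/ m == nu.*2.+1)%N ->
  rr_mean eps si_obs fX i zs ws - rr_mean eps si_obs fY i zs ws =
  eps / 8 * \int[cube_prob d]_x
    ((fX x - fY x) * clip1 ((tau nu)^-1 * si_score nu zs ws x)).
Proof.
move=> /eqP ib; have il := @lev_block n1 V i nu true ib.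
rewrite (rr_mean_diff _ si_obs_itv si_obs_measurable)//.
by rewrite /si_obs ib /= odd_double il.
Qed.

Lemma interactive_power nu theta (E := energy (coef_diff fX fY) (2 ^ nu)) :
  (nu < V)%N -> (0 < q nu)%N ->
  sq_integrable (cube_prob d) (fun x => fX x - fY x) ->
  0 < tau nu -> 0 < theta ->
  8 * (q nu)%:R * theta ^+ 2 * trig_sup d ^+ 2 * (M nu)%:R <= 1 ->
  4 * (q nu)%:R ^+ 2 * kappa ^+ 2 * trig_sup d ^+ 2 * (M nu)%:R * E <= tau nu ^+ 2 ->
  theta^-1 * expR (- (theta * tau nu / 2)) * (12 * expR 1 / beta) <= (q nu)%:R * kappa * E / 8 ->
  64 * ln (3 / beta) / kappa <= (q nu)%:R * kappa * E / 8 ->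
  ln (V%:R / alpha) + ln (3 / beta) + 16 <=
    Num.sqrt m%:R * (eps / 8) * ((q nu)%:R * kappa * E) / (2 * tau nu) ->
  (prob_accept (rr_channel eps si_obs) (rr_channel eps si_obs) fX fY
     (level_reject V alpha si_weight) <= beta%:E)%E.
Proof.
move=> nV q0 sq tau0 th0 c1 c2 c3 c4 c5; have m0 := bsize_gt0 q0.
have pXc := rr_mean_causal eps fX si_obs_causal.
have pYc := rr_mean_causal eps fY si_obs_causal.
have pX01 i zs ws : 0 <= rr_mean eps si_obs fX i zs ws <= 1.
  exact: (rr_mean01 eps01 si_obs_itv si_obs_measurable fX0 dX).
have pY01 i zs ws : 0 <= rr_mean eps si_obs fY i zs ws <= 1.
  exact: (rr_mean01 eps01 si_obs_itv si_obs_measurable fY0 dY).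
have EE := sum_probe_idx nu (fun l => coef_diff fX fY l ^+ 2).
rewrite /E /energy EE in c2 c3 c4 c5.
have /andP[e0 _] := eps01.
have kp : 0 < kappa by rewrite divr_gt0// mulr_gt0// trig_sup_gt0.
have [G [G0 Gb G1]] := interactive_level_power
  (Delta := fun j => coef_diff fX fY (probe_idx d nu j)) (e8 := eps / 8) (tau := tau nu)
  (phi := fun j => trig (probe_idx d nu j))
  pX01 pY01 pXc pYc n12 m0 q0 (reps_fit d n1 V nu) (block_fits n1 nV) kp
  (@si_drift_probe nu) sq (fun j => bounded_trig (probe_idx d nu j))
  (fun j => trig_le (probe_idx d nu j)) (fun j _ => erefl)
  (density_diff_norm1 fX0 dX fY0 dY) (@si_drift_score nu) beta01
  (ncoord_gt0 d nu) (trig_sup_gt0 d) tau0 th0 (divr_gt0 e0 (ltr0n R 8)) c1 c2 c3 c4 c5.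
apply: (prob_accept_level eps01 si_obs_itv si_obs_measurable fX0 fY0 dX dY G0 _ Gb).
move=> o nrej; apply: G1; rewrite ltNge; apply/negP => le.
by apply: nrej; exists nu.
Qed.

End interactive_test.

(** * Calibration of the constants *)

(** The drift formulas are proved for functions nonnegative everywhere. Distances, Sobolev balls and
    laws only see the cube, so positive parts can be substituted. *)
Lemma accept_reduction {R : realType} (d n1 n2 : nat) dT (T : measurableType dT)
    (s r p rho beta : R) (QX QY : channels R d n1 n2 T) Phi :
  0 < p -> 0 < rho ->
  ((0 < d)%N -> forall fX fY : d.-tuple R -> R,
     (forall x, 0 <= fX x) -> (forall x, 0 <= fY x) ->
     sobolev_F s r fX -> sobolev_F s r fY -> (rho%:E <= lp_dist p fX fY)%E ->
     (prob_accept QX QY fX fY Phi <= beta%:E)%E) ->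
  forall fX fY : d.-tuple R -> R, sobolev_F s r fX -> sobolev_F s r fY ->
    (rho%:E <= lp_dist p fX fY)%E -> (prob_accept QX QY fX fY Phi <= beta%:E)%E.
Proof.
move=> p0 rho0 pow fX fY FX FY le.
have [_ dX] := FX; have [_ dY] := FY.
have [d0|d0] := posnP d; last first.
  rewrite /prob_accept -pos_part_expect_out//; apply: pow => //.
  - exact: pos_part_ge0.
  - exact: pos_part_ge0.
  - exact: pos_part_sobolev.
  - exact: pos_part_sobolev.
  - by rewrite pos_part_lp_dist.
(* In dimension 0 every density equals 1, so [lp_dist] vanishes. *)
exfalso; move: QX QY fX fY FX FY dX dY le {Phi pow}; rewrite d0 => _ _ fX fY _ _.
move=> [_ [_ /= [eX]]] [_ [_ /= [eY]]].
rewrite /lp_dist /= eX eY subrr normr0 powR0 ?gt_eqF// powR0 ?gt_eqF ?invr_gt0//.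
by rewrite lee_fin leNgt rho0.
Qed.

(** As [ln 2 >= 1 / 2], [2 ln N] bounds the binary logarithm of [N], so every level with
    [2 ^ nu <= N] is tested, whatever the smoothness. *)
Definition levels {R : realType} (N : R) : nat := (Num.truncn (2 * ln N)).+1.

Lemma levels_le {R : realType} (N : R) : 1 <= ln N -> (levels N)%:R <= 3 * ln N.
Proof.
move=> l1; rewrite /levels -natr1.
have h : (Num.truncn (2 * ln N))%:R <= 2 * ln N by rewrite truncn_le; lra.
lra.
Qed.

Lemma lt_levels {R : realType} (N : R) nu : (2 ^ nu)%:R <= N -> (nu < levels N)%N.
Proof.
move=> /ln_pow2_ge h; rewrite /levels ltnS.
by rewrite -[leqLHS](@natrK R) le_truncn//; lra.
Qed.

(** Each of the two floor divisions loses at most a factor 2; with two blocks per level this makes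
    8. *)
Lemma reps_lower (d n1 V nu : nat) : (0 < V)%N -> (4 * V * ncoord d nu <= n1)%N ->
  (n1 <= 8 * V * ncoord d nu * reps d n1 V nu)%N.
Proof.
move=> V0 hM; rewrite /reps /bsize; have := ncoord_gt0 d nu.
move: (ncoord d nu) hM => M hM M0.
have V2 : (0 < 2 * V)%N by rewrite muln_gt0.
have h1 : (n1 <= 2 * (2 * V) * (n1 %/ (2 * V)))%N.
  rewrite -(ler_nat rat) !natrM -!natrM natrM natrM; apply: leq_half_div => //.
  by nia.
have h2 : (n1 %/ (2 * V) <= 2 * M * (n1 %/ (2 * V) %/ M))%N.
  rewrite -(ler_nat rat) natrM natrM; apply: leq_half_div => //.
  by nia.
nia.
Qed.

(** 24 is the 8 of [reps_lower] times the 3 of [levels_le]. With [Q = q eps^2] the factor [M] of the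
    energy cancels; [w] is [sqrt M] in the non-interactive test and 1 in the interactive one. *)
Lemma signal_of_energy {R : realType} (c D M w l y N Q E : R) :
  0 < w -> 0 < N -> 0 <= c -> 0 <= D -> N <= 24 * l * M * Q -> 0 < Q ->
  24 * c * D * (M * w * (l * y ^+ 2 / N)) <= E -> c * D * w * y ^+ 2 <= Q * E.
Proof.
move=> w0 N0 c0 D0 hN Q0 hE.
apply: le_trans (ler_wpM2l (ltW Q0) hE).
have -> : Q * (24 * c * D * (M * w * (l * y ^+ 2 / N))) =
    c * D * w * y ^+ 2 * (24 * l * M * Q / N) by field; rewrite gt_eqF.
have cD : 0 <= c * D * w * y ^+ 2.
  by apply: mulr_ge0; [rewrite !mulr_ge0// ltW|exact: sqr_ge0].
by rewrite ler_peMr// ler_pdivlMr// mul1r.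
Qed.

Lemma noninteractive_threshold {R : realType} (c t e q w y Lb L3 Th E : R) :
  64 * 64 * 20 <= c ->
  0 < t -> 0 < q -> 0 < w -> 7 / 2 <= y -> 0 <= Lb <= y -> L3 <= y -> Th <= 2 * y ->
  c * t ^+ 2 * w * y ^+ 2 <= q * e ^+ 2 * E ->
  Th <= 7 / 8 * ((64 * q * w * (8 + Lb))^-1 * q ^+ 2 * (e / (8 * t)) ^+ 2 * E) -
    2 * L3 - 1 / 64.
Proof.
move=> hc t0 q0 w0 y7 /andP[b0 by_] L3y Thy hE.
have b8 : 0 < 8 + Lb by lra.
have -> : (64 * q * w * (8 + Lb))^-1 * q ^+ 2 * (e / (8 * t)) ^+ 2 * E =
    q * e ^+ 2 * E / (64 * 64 * t ^+ 2 * w * (8 + Lb)) by field; rewrite !gt_eqF.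
(* The threshold and both losses amount to [4 y + 1 / 64], less than 7/8 of [5 y]. The bound on [c]
   is then [64 * 64 * 5 * 4]: 64 from the scale, [8 ^ 2] from [kappa], and 4 from
   [8 + Lb <= 4 y]. *)
suff h : 5 * y <= q * e ^+ 2 * E / (64 * 64 * t ^+ 2 * w * (8 + Lb)) by lra.
have D0 : 0 < 64 * 64 * t ^+ 2 * w * (8 + Lb).
  by rewrite !mulr_gt0// exprn_gt0.
rewrite ler_pdivlMr//; apply: le_trans hE.
have -> : 5 * y * (64 * 64 * t ^+ 2 * w * (8 + Lb)) =
  t ^+ 2 * w * (64 * 64 * 5 * (y * (8 + Lb))) by ring.
have -> : c * t ^+ 2 * w * y ^+ 2 = t ^+ 2 * w * (c * y ^+ 2) by ring.
have tw : 0 <= t ^+ 2 * w by apply: mulr_ge0; [exact: sqr_ge0|exact: ltW].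
apply: ler_wpM2l => //.
have h1 : y * (8 + Lb) <= 4 * y ^+ 2 by nra.
have := ler_wpM2r (sqr_ge0 y) hc; move: h1 (sqr_ge0 y).
by move: (y * _) (y ^+ 2) => A B; lra.
Qed.

Lemma radius_const_gt0 {R : realType} (s r C : R) : 0 < r -> 0 <= C -> 0 < radius_const s r C.
Proof.
move=> r0 C0; rewrite /radius_const; have := powR_ge0 2 (2 * s); have := sqr_ge0 r.
move: (2 `^ _) (r ^+ 2) => A B B0 A0; have : 0 <= 4 * B * A by rewrite !mulr_ge0.
lra.
Qed.

Lemma powR_three_half {R : realType} (x : R) : 0 < x -> x `^ (3 / 2) = x * Num.sqrt x.
Proof.
move=> x0; have -> : 3 / 2 = 1 + 2^-1 :> R by field.
by rewrite powRD ?gt_eqF ?implybT// powRr1 ?ltW// powR12_sqrt// ltW.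
Qed.

Lemma reps_signal {R : realType} (d n1 nu : nat) (eps : R) (N := n1%:R * eps ^+ 2) z :
  0 < eps <= 1 -> 1 <= ln N -> (ncoord d nu)%:R <= z^-1 -> 12 * ln N * z^-1 <= N ->
  let q := reps d n1 (levels N) nu in
  (0 < q)%N /\ N <= 24 * ln N * (ncoord d nu)%:R * (q%:R * eps ^+ 2).
Proof.
move=> /andP[e0 e1] l1 Mz hz q.
have vl := levels_le l1; set V := levels N in vl q *; set M := ncoord d nu in Mz *.
have M0 : (0 < M)%N by exact: ncoord_gt0.
have e2 : 0 < eps ^+ 2 by rewrite exprn_gt0.
have e21 : eps ^+ 2 <= 1 by rewrite exprn_ile1// ltW.
have Nn : N <= n1%:R by rewrite /N ler_piMr.
have MR : 0 < M%:R :> R by rewrite ltr0n.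
have VM : (4 * V * M <= n1)%N.
  rewrite -(ler_nat R) !natrM; apply: le_trans Nn; apply: le_trans hz.
  rewrite -mulrA; apply: (@le_trans _ _ (4 * (3 * ln N * M%:R))).
    by rewrite ler_pM2l// ler_pM2r.
  rewrite (_ : 4 * _ = 12 * ln N * M%:R); last by ring.
  by rewrite ler_pM2l//; lra.
have := reps_lower (isT : (0 < V)%N) VM; rewrite -/q -/M => h.
have N0 : 0 < N.
  by rewrite ltNge; apply/negP => N0; move: l1; rewrite ln0//; lra.
have hq : n1%:R <= 24 * ln N * M%:R * q%:R.
  have : n1%:R <= 8 * V%:R * M%:R * q%:R :> R by rewrite -!natrM ler_nat.
  move/le_trans; apply; apply: ler_wpM2r => //.
  by apply: ler_wpM2r; [exact: ltW|lra].
split; last first.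
  by rewrite /N (mulrA _ q%:R) ler_pM2r.
rewrite lt0n; apply/eqP => q0; move: hq; rewrite q0 mulr0; lra.
Qed.

Lemma noninteractive_rate_power {R : realType} (d n1 n2 : nat) (r s p eps alpha beta : R)
    (fX fY : d.-tuple R -> R) (N := n1%:R * eps ^+ 2)
    (y := ln (ln N / (alpha * beta))) :
  0 < r -> 0 < s -> (0 < d)%N -> (n1 <= n2)%N -> 0 < eps <= 1 -> 1 <= p <= 2 ->
  0 < alpha < 1 -> 0 < beta < 1 -> alpha + beta <= 2^-1 ->
  2 ^+ 20 * ln ((alpha * beta)^-1) <= N ->
  (forall x, 0 <= fX x) -> (forall x, 0 <= fY x) -> sobolev_F s r fX -> sobolev_F s r fY ->
  ((radius_const s r (24 * 2 ^+ 17 * trig_sup d ^+ 2) *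
    (ln N * y ^+ 2 / N) `^ (2 * s / (4 * s + 3 * d%:R)))%:E <= lp_dist p fX fY)%E ->
  (prob_accept (rr_channel eps (@ni_obs R d n1 n2 (levels N)))
     (rr_channel eps (@ni_obs R d n1 n2 (levels N))) fX fY
     (level_reject (levels N) alpha (@ni_weight R d n1 n2 (levels N) beta)) <= beta%:E)%E.
Proof.
set V := levels N.
set C : R := 24 * 2 ^+ 17 * trig_sup d ^+ 2.
move=> r0 s0 d0 n12 eps01 p12 a01 b01 ab hN fX0 fY0 FX FY.
have C0 : 0 <= C by rewrite /C !mulr_ge0 ?sqr_ge0// exprn_ge0.
have [N20 l10 y7 Lby lv] := ln_budget a01 b01 ab hN.
rewrite -/y in y7 Lby lv; clearbody y.
have N0 : 0 < N by apply: lt_le_trans N20; rewrite exprn_gt0.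
have l0 : 0 < ln N by lra.
have l1 : 1 <= ln N by lra.
pose z := ln N * y ^+ 2 / N.
have ly0 : 0 < ln N * y ^+ 2 by rewrite mulr_gt0 ?exprn_gt0//; lra.
have z0 : 0 < z by rewrite divr_gt0.
have /andP[a0 _] := a01; have /andP[b0 b1] := b01.
(* Exponent [a = 3 / 2]: one factor [M] because the users are shared among the coordinates, and
   [sqrt M] from the noise of a sum over [M] coordinates. *)
rewrite (_ : 3 * d%:R = 2 * (3 / 2) * d%:R); last by field.
move=> /(energy_level _ s0 r0 C0 z0 d0 p12 FX FY)[]; first lra.
move=> nu [kz Mz hE].
have [_ dX] := FX; have [_ dY] := FY.
have zi : z^-1 = N / (ln N * y ^+ 2) by rewrite /z invf_div.
have yy : 12 <= y ^+ 2 by nra.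
have zN : 12 * ln N * z^-1 <= N.
  rewrite zi (_ : 12 * ln N * (N / _) = N * (12 / y ^+ 2)).
    by rewrite ler_piMr ?(ltW N0)// ler_pdivrMr ?mul1r//; lra.
  by field; rewrite !gt_eqF//; lra.
have [q0 hq] := reps_signal eps01 l1 Mz zN; rewrite -/N -/V in q0 hq.
have nV : (nu < V)%N.
  apply: lt_levels; apply: le_trans kz _; apply: le_trans zN.
  by rewrite ler_peMl ?invr_ge0 ?ltW//; lra.
have M0 : 0 < (ncoord d nu)%:R :> R by rewrite ltr0n ncoord_gt0.
apply: (noninteractive_power eps01 n12 b01 fX0 dX fY0 dY nV q0).
have W0 : 0 < Num.sqrt (ncoord d nu)%:R :> R by rewrite sqrtr_gt0.
have qR : 0 < (reps d n1 V nu)%:R :> R by rewrite ltr0n.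
have e2 : 0 < eps ^+ 2 by case/andP: eps01 => e0 _; rewrite exprn_gt0.
apply: (noninteractive_threshold (c := 2 ^+ 17) (y := y)) => //.
- lra.
- exact: trig_sup_gt0.
- apply/andP; split=> //; rewrite ln_ge0// ler_pdivlMr//; lra.
- by apply: le_trans Lby; rewrite ler_ln ?posrE ?divr_gt0// ler_pM2r ?invr_gt0//; lra.
- by apply: lv; rewrite ?ltr0n//; exact: levels_le.
- apply: (signal_of_energy (M := (ncoord d nu)%:R) (l := ln N) W0 N0 _ _ hq).
  + by rewrite exprn_ge0.
  + exact: sqr_ge0.
  + exact: mulr_gt0.
  + by move: hE; rewrite powR_three_half.
Qed.

Theorem noninteractive_rate {R : realType} (d : nat) (r : R) : 0 < r ->
  exists Cs : R -> R, (forall s : R, 0 < s -> 0 < Cs s) /\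
   forall (n1 n2 : nat) (eps p alpha beta : R),
     (1 <= n1)%N -> (n1 <= n2)%N ->
     0 < eps <= 1 -> 1 <= p <= 2 ->
     0 < alpha < 1 -> 0 < beta < 1 -> alpha + beta <= 2^-1 ->
     n1%:R * eps ^+ 2 >= 2 ^+ 20 * ln ((alpha * beta)^-1) ->
     exists (dT : measure_display) (T : measurableType dT)
            (QX QY : channels R d n1 n2 T)
            (Phi : set (n1.-tuple T * n2.-tuple T)),
       non_interactive_ldp eps QX QY /\ test_measurable Phi /\
       (forall f : d.-tuple R -> R, is_density f ->
          (prob_reject QX QY f f Phi <= alpha%:E)%E) /\
       (forall s : R, 0 < s ->
        forall fX fY : d.-tuple R -> R,
          sobolev_F s r fX -> sobolev_F s r fY ->
          (lp_dist p fX fY >=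
            (Cs s * ((ln (n1%:R * eps ^+ 2) *
                       (ln (ln (n1%:R * eps ^+ 2) / (alpha * beta))) ^+ 2)
                      / (n1%:R * eps ^+ 2)) `^ (2 * s / (4 * s + 3 * d%:R)))%:E)%E ->
          (prob_accept QX QY fX fY Phi <= beta%:E)%E).
Proof.
move=> r0; pose C : R := 24 * 2 ^+ 17 * trig_sup d ^+ 2.
have C0 : 0 <= C by rewrite /C !mulr_ge0 ?sqr_ge0// exprn_ge0.
exists (fun s => radius_const s r C); split.
  by move=> s s0; exact: radius_const_gt0.
move=> n1 n2 eps p alpha beta _ n12 eps01 p12 a01 b01 ab hN.
have [N20 l10 y7 Lby lv] := ln_budget a01 b01 ab hN.
set N := n1%:R * eps ^+ 2 in hN N20 l10 y7 Lby lv *; set y := ln (_ / (alpha * beta)) in y7 Lby lv *.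
pose V := levels N.
pose u := @ni_obs R d n1 n2 V.
exists _, bool, (rr_channel eps u), (rr_channel eps u),
  (level_reject V alpha (@ni_weight R d n1 n2 V beta)).
have u1 : forall i x zs ws, -1 <= u i x zs ws <= 1 by exact: ni_obs_itv.
have um i : measurable_fun setT
  (fun p : d.-tuple R * (n1.-tuple bool * n2.-tuple bool) => u i p.1 p.2.1 p.2.2).
  exact: ni_obs_measurable.
have uc x : causal_fun (fun i => u i x) by exact: ni_obs_causal.
have /andP[a0 _] := a01; have /andP[b0 b1] := b01; have /andP[p1 _] := p12.
split; last split; last split.
- split; split.
  + exact: rr_channel_measurable.
  + exact: rr_channel_measurable.
  + exact: rr_channel_ldp.
  + exact: rr_channel_ldp.
  + exact: rr_channel_non_interactive.
  + exact: rr_channel_non_interactive.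
- exact: measurable_bool_outcomes.
- move=> f df; apply: (prob_reject_level n12 eps01 u1 um uc) => //.
  by move=> nu; exact: quad_weight_causal.
move=> s s0; apply: accept_reduction; [lra| |move=> d0 fX fY fX0 fY0 FX FY].
  rewrite mulr_gt0 ?radius_const_gt0// powR_gt0// divr_gt0//.
    by rewrite mulr_gt0 ?exprn_gt0//; lra.
  by apply: lt_le_trans N20; rewrite exprn_gt0.
exact: noninteractive_rate_power.
Qed.

(** * Calibration of the clipped score *)

Lemma expR1_le4 {R : realType} : expR 1 <= 4 :> R.
Proof.
have h := expR_ge1Dx (- 2^-1 : R).
have hh : 2^-1 + 2^-1 = 1 :> R by field.
have : expR 2^-1 * expR (- 2^-1) = 1 :> R by rewrite -expRD subrr expR0.
rewrite -[in X in _ -> X <= _]hh expRD; have := expR_gt0 (2^-1 : R); move: h.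
move: (expR _) (expR _) => A B h B0 AB.
have A2 : A <= 2 by nra.
nra.
Qed.

(** [t Z] is the noise scale of the score, for which the constraint holds with equality. *)
Lemma noise_scale_cond {R : realType} (t q M Z : R) (theta := (t * Z)^-1) :
  0 < t -> 0 < Z -> Z ^+ 2 = 8 * q * M ->
  8 * q * theta ^+ 2 * t ^+ 2 * M <= 1.
Proof.
move=> t0 Z0 Z2; apply: eq_le; have -> : 8 * q * theta ^+ 2 * t ^+ 2 * M = 8 * q * M / Z ^+ 2.
  by rewrite /theta; field; rewrite !gt_eqF.
by rewrite -Z2 divff// gt_eqF// exprn_gt0.
Qed.

Lemma drift_cond {R : realType} (t q M Z e E l : R)
    (tau := 2 * l * t * Z) (kappa := e / (8 * t)) :
  0 < t -> 0 < q -> 0 < M -> Z ^+ 2 = 8 * q * M ->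
  q * e ^+ 2 * E <= 16 * 32 * t ^+ 2 * l ^+ 2 ->
  4 * q ^+ 2 * kappa ^+ 2 * t ^+ 2 * M * E <= tau ^+ 2.
Proof.
move=> t0 q0 M0 Z2 h.
have -> : 4 * q ^+ 2 * kappa ^+ 2 * t ^+ 2 * M * E = q * M / 16 * (q * e ^+ 2 * E).
  by rewrite /kappa; field; rewrite gt_eqF.
have -> : tau ^+ 2 = q * M / 16 * (16 * 32 * t ^+ 2 * l ^+ 2).
  rewrite /tau (_ : (2 * l * t * Z) ^+ 2 = 4 * l ^+ 2 * t ^+ 2 * Z ^+ 2); last by ring.
  by rewrite Z2; field.
by apply: ler_wpM2l => //; rewrite divr_ge0// mulr_ge0// ltW.
Qed.

Lemma signalE {R : realType} (t q e E : R) (kappa := e / (8 * t)) : 0 < t -> 0 < e ->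
  q * kappa * E / 8 = q * e ^+ 2 * E / (64 * t * e).
Proof. by move=> t0 e0; rewrite /kappa; field; rewrite !gt_eqF. Qed.

Lemma signal_ge {R : realType} (t q e E y l : R) (kappa := e / (8 * t)) :
  0 < t -> 0 < e <= 1 -> 7 / 2 <= y -> 3 <= l ->
  15 * 32 * 32 * t ^+ 2 * y * l <= q * e ^+ 2 * E ->
  8 * 30 * t * y * l <= q * kappa * E / 8.
Proof.
move=> t0 /andP[e0 e1] y1 l1 low.
have te : 0 < 64 * t * e by apply: mulr_gt0 => //; exact: mulr_gt0.
rewrite signalE// ler_pdivlMr//; apply: le_trans low.
have X0 : 0 <= t ^+ 2 * y * l.
  by apply: mulr_ge0; [apply: mulr_ge0; [exact: sqr_ge0|lra]|lra].
have := ler_wpM2l X0 e1; lra.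
Qed.

(** [theta tau / 2] is exactly the depth [l], so the clipping bias carries [expR (- l)]; by
    [n <= expR l * beta] this absorbs [1 / beta] together with [Z <= 3 n]. *)
Lemma tail_cond {R : realType} (t q Z e E y l beta n : R)
    (theta := (t * Z)^-1) (tau := 2 * l * t * Z) (kappa := e / (8 * t)) :
  0 < t -> 0 < Z -> 0 < e <= 1 -> 7 / 2 <= y -> 3 <= l ->
  15 * 32 * 32 * t ^+ 2 * y * l <= q * e ^+ 2 * E ->
  0 < beta -> 1 <= n -> n <= expR l * beta -> Z <= 3 * n ->
  theta^-1 * expR (- (theta * tau / 2)) * (12 * expR 1 / beta) <= q * kappa * E / 8.
Proof.
move=> t0 Z0 e01 y1 l1 low b0 n1 hn Zn.
have -> : theta * tau / 2 = l by rewrite /theta /tau; field; rewrite !gt_eqF//; lra.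
have x0 := expR_gt0 l.
have e3 := @expR1_le4 R.
apply: le_trans (signal_ge t0 e01 y1 l1 low).
have -> : theta^-1 * expR (- l) * (12 * expR 1 / beta) =
    12 * t * (Z * expR 1 / (expR l * beta)).
  by rewrite /theta expRN; field; rewrite !gt_eqF.
have h : Z * expR 1 / (expR l * beta) <= 12.
  rewrite ler_pdivrMr ?mulr_gt0//.
  have h1 : Z * expR 1 <= 3 * n * 4 by apply: ler_pM => //; exact: ltW.
  lra.
have yl : 10 <= y * l by nra.
have h2 := ler_wpM2l (ltW t0) yl.
have := ler_wpM2l (ltW t0) h; move: h2; move: (Z * expR 1 / _) => w; lra.
Qed.

Lemma linear_noise_cond {R : realType} (t q e E y l L3 : R) (kappa := e / (8 * t)) :
  0 < t -> 0 < e <= 1 -> 7 / 2 <= y -> 3 <= l ->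
  15 * 32 * 32 * t ^+ 2 * y * l <= q * e ^+ 2 * E ->
  L3 <= y -> 64 * L3 / kappa <= q * kappa * E / 8.
Proof.
move=> t0 /andP[e0 e1] y1 l1 low Ly; rewrite signalE// /kappa.
have -> : 64 * L3 / (e / (8 * t)) = 64 * 64 * 8 * t ^+ 2 * L3 / (64 * t * e).
  by field; rewrite !gt_eqF.
have te : 0 < 64 * t * e by apply: mulr_gt0 => //; exact: mulr_gt0.
rewrite ler_pM2r ?invr_gt0//; apply: le_trans low.
have yl : 3 * y <= y * l by nra.
have := ler_wpM2l (sqr_ge0 t) yl; have := ler_wpM2l (sqr_ge0 t) Ly.
have : 0 <= t ^+ 2 * y by apply: mulr_ge0; [exact: sqr_ge0|lra].
lra.
Qed.

Lemma block_signal_cond {R : realType} (t q Z e E y l sm L3 Th : R)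
    (tau := 2 * l * t * Z) (kappa := e / (8 * t)) :
  0 < t -> 0 < Z -> 0 < e <= 1 -> 7 / 2 <= y -> 3 <= l ->
  15 * 32 * 32 * t ^+ 2 * y * l <= q * e ^+ 2 * E ->
  0 < sm -> Z <= 3 * sm -> L3 <= y -> Th <= 2 * y ->
  Th + L3 + 16 <= sm * (e / 8) * (q * kappa * E) / (2 * tau).
Proof.
move=> t0 Z0 /andP[e0 e1] y1 l1 low sm0 Zs Ly Thy.
have -> : sm * (e / 8) * (q * kappa * E) / (2 * tau) =
   (q * e ^+ 2 * E) * sm / (8 * 32 * t ^+ 2 * l * Z).
  by rewrite /kappa /tau; field; rewrite !gt_eqF//; lra.
have D0 : 0 < 8 * 32 * t ^+ 2 * l * Z.
  apply: mulr_gt0 => //; apply: mulr_gt0; last by lra.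
  by apply: mulr_gt0 => //; exact: exprn_gt0.
(* This condition dictates the constant in [low]: [20 * 8 * 32 * 3 = 15 * 32 * 32]. *)
apply: (@le_trans _ _ (20 * y)); first by lra.
rewrite ler_pdivlMr//.
apply: le_trans (ler_wpM2r (ltW sm0) low).
have X0 : 0 <= t ^+ 2 * y * l.
  by apply: mulr_ge0; [apply: mulr_ge0; [exact: sqr_ge0|lra]|lra].
have := ler_wpM2l X0 Zs; lra.
Qed.

(* Among the levels whose signal [q e^2 E] reaches [Lo], the largest one has a signal
   within a factor [2 ^ d] of [Lo], because [q] drops by at most [2 ^ d] per level. *)
Lemma level_selection {R : realType} (d n1 V nu0 : nat) (eps B Lo : R) (E : nat -> R)
    (q := reps d n1 V) (N := n1%:R * eps ^+ 2) :
  (0 < d)%N -> 0 < eps <= 1 -> 0 < Lo -> B <= Lo ->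
  (forall k, E k <= E k.+1) -> (forall k, 0 <= E k <= B) ->
  (forall k, (2 ^ k)%:R <= N -> (k < V)%N) ->
  Lo <= (q nu0)%:R * eps ^+ 2 * E nu0 ->
  exists k, [/\ (k < V)%N, (0 < q k)%N, Lo <= (q k)%:R * eps ^+ 2 * E k &
    (q k)%:R * eps ^+ 2 * E k <= 2 ^+ d * (Lo + B)].
Proof.
move=> d0 /andP[e0 e1] Lo0 BLo Emon E0B VP.
pose P k := Lo <= (q k)%:R * eps ^+ 2 * E k; rewrite -/(P nu0) => Pnu0.
have e2 : 0 < eps ^+ 2 by rewrite exprn_gt0.
have e21 : eps ^+ 2 <= 1 by rewrite exprn_ile1// ltW.
have q0 k : P k -> (0 < q k)%N.
  by rewrite /P; case: posnP => // ->; rewrite !mul0r leNgt Lo0.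
(* [Lo M <= q M eps^2 E <= N Lo], using [E <= B <= Lo]; hence [M <= N] at every level that
   passes. *)
have PV k : P k -> (k < V)%N.
  move=> Pk; apply: VP; have M0 := ncoord_gt0 d k.
  have kM : (2 ^ k)%:R <= (ncoord d k)%:R :> R.
    by rewrite ler_nat /ncoord -{1}(expn1 (2 ^ k)) leq_pexp2l// expn_gt0.
  apply: le_trans kM _.
  have qM : (q k)%:R * (ncoord d k)%:R <= n1%:R :> R.
    by rewrite -natrM ler_nat (leq_trans (leq_trunc_div _ _))// leq_div.
  have MR : 0 < (ncoord d k)%:R :> R by rewrite ltr0n.
  have /andP[Ek0 EkB] := E0B k.
  move: Pk; rewrite /P /N; move: (q k)%:R (ncoord _ _)%:R (n1%:R) MR qM => Q M n MR qM Pk.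
  have h1 : Lo * M <= n * eps ^+ 2 * Lo.
    apply: (@le_trans _ _ (Q * eps ^+ 2 * E k * M)); first by rewrite ler_pM2r.
    rewrite (_ : _ * M = Q * M * (eps ^+ 2 * E k)); last by ring.
    apply: (@le_trans _ _ (n * (eps ^+ 2 * E k))).
      by rewrite ler_wpM2r// mulr_ge0// ltW.
    have n0 : 0 <= n * eps ^+ 2.
      rewrite mulr_ge0 ?(ltW e2)//; apply: le_trans qM; rewrite mulr_ge0 ?(ltW MR)//.
      have := lt_le_trans Lo0 Pk; rewrite -mulrA.
      have eE : 0 <= eps ^+ 2 * E k by rewrite mulr_ge0// ltW.
      by case: (ltP Q 0) => // Q0; rewrite ltNge mulr_le0_ge0// ltW.
    by rewrite mulrA ler_wpM2l//; lra.
  by move: h1; rewrite mulrC ler_pM2r.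
case: (ex_maxnP (ex_intro P _ Pnu0) (m := V)); first by move=> k /PV /ltnW.
move=> k Pk kmax; exists k; split=> //; [exact: PV|exact: q0|].
have nP : ~~ P k.+1 by apply/negP => /kmax; rewrite ltnn.
move: nP; rewrite /P -ltNge => nP.
(* [ncoord] grows by exactly [2 ^ d], so [q k.+1] is the floor of [q k / 2 ^ d]; the 1 lost in
   rounding is what adds [B] to the bound. *)
have qS : (q k <= 2 ^ d * (q k.+1).+1)%N.
  have -> : q k.+1 = (q k %/ 2 ^ d)%N.
    by rewrite /q /reps -divnMA; congr (_ %/ _)%N; rewrite /ncoord expnS expnMn mulnC.
  by rewrite mulnC ltnW// ltn_ceil// expn_gt0.
have qSR : (q k)%:R <= 2 ^+ d * ((q k.+1)%:R + 1) :> R.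
  by rewrite natr1 -natrX -natrM ler_nat.
have /andP[Ek0 EkB] := E0B k; have EE := Emon k.
move: (eps ^+ 2) e2 e21 nP => e ep e1' nP.
apply: (@le_trans _ _ (2 ^+ d * ((q k.+1)%:R + 1) * e * E k)).
  by rewrite ler_wpM2r// ler_pM2r.
rewrite -!mulrA ler_pM2l ?exprn_gt0// mulrDl mul1r; apply: lerD.
  apply: le_trans (ltW nP); rewrite mulrA ler_wpM2l//.
  by rewrite mulr_ge0// ltW.
by apply: le_trans EkB; rewrite ler_piMl.
Qed.

(** Two opposite demands on the depth [l]: the signal must reach [Lo], proportional to [y l], while
    clipping tolerates a signal of order [l ^ 2]. Having [l >= 60 D y] opens the window, as
    [15 * 32 * 32 / 60 = 8 * 32]; the summand [4 r ^ 2] of [a] absorbs the bound on the energy. *)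
Lemma interactive_window {R : realType} (D r lb y : R) (a := 60 * D + 4 * r ^+ 2)
    (l := a * lb * y) (Lo := 15 * 32 * 32 * D * y * l) :
  1 <= D -> 1 <= lb -> 7 / 2 <= y ->
  [/\ 0 < Lo, 4 * r ^+ 2 <= Lo, D * (Lo + 4 * r ^+ 2) <= 16 * 32 * D * l ^+ 2, 3 <= l & lb <= l].
Proof.
move=> D1 lb1 y1; have r0 := sqr_ge0 r.
have a60 : 60 * D <= a by rewrite /a; lra.
have ar : 4 * r ^+ 2 <= a by rewrite /a; lra.
move: (r ^+ 2) r0 ar => B B0 aB; clearbody a.
have al : a * lb <= l by rewrite /l ler_peMr//; nra.
have alb : a <= a * lb by rewrite ler_peMr//; lra.
have l3 : 60 <= l by lra.
have lbl : lb <= l by nra.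
have Dyl : 60 * (D * y) <= l.
  have h1 : 60 * D * y <= a * lb * y by apply: ler_wpM2r; lra.
  by rewrite /l; lra.
clearbody l.
have Dy : 7 / 2 <= D * y by nra.
have LoE : Lo = 15 * 32 * 32 * (D * y) * l by rewrite /Lo; ring.
have Ll : l <= Lo by rewrite LoE; nra.
have LL : Lo <= 8 * 32 * l ^+ 2.
  have l0 : 0 <= l by lra.
  have := ler_wpM2r l0 Dyl; rewrite LoE; lra.
have l2 : l <= l ^+ 2 by nra.
split; [lra|lra| |lra|lra].
have D0 : 0 <= D by lra.
have h : Lo + 4 * B <= 16 * 32 * l ^+ 2 by lra.
have := ler_wpM2l D0 h; lra.
Qed.

Lemma sqrt_nat_le {R : realType} (m n : nat) : (m <= n)%N -> Num.sqrt m%:R <= n%:R :> R.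
Proof.
move=> mn; have -> : n%:R = Num.sqrt (n%:R ^+ 2) :> R by rewrite sqrtr_sqr ger0_norm.
apply: ler_wsqrtr; rewrite -natrX ler_nat (leq_trans mn)//.
by case: n {mn} => // n; rewrite -{1}(expn1 n.+1) leq_pexp2l.
Qed.

(** [Lo] contains [ln (n2 / beta)] once, the rate its square; the slack is given away here. *)
Lemma interactive_entry {R : realType} (k D A lb y : R) :
  0 <= k -> 0 <= D -> 0 <= A -> 1 <= lb ->
  k * D * y * (A * lb * y) <= k * A * D * 1 * (lb * y) ^+ 2.
Proof.
move=> k0 D0 A0 lb1; rewrite mulr1.
have X0 : 0 <= k * A * D * y ^+ 2 by apply: mulr_ge0; [rewrite !mulr_ge0|exact: sqr_ge0].
have -> : k * D * y * (A * lb * y) = k * A * D * y ^+ 2 * lb by ring.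
have -> : k * A * D * (lb * y) ^+ 2 = k * A * D * y ^+ 2 * (lb * lb) by ring.
by apply: ler_wpM2l => //; rewrite ler_peMr//; lra.
Qed.

Section interactive_rate.
Context {R : realType} (d n1 n2 : nat) (r eps alpha beta : R).
Local Notation N := (n1%:R * eps ^+ 2).
Local Notation y := (ln (ln N / (alpha * beta))).
Local Notation a := (60 * trig_sup d ^+ 2 + 4 * r ^+ 2).
Local Notation l := (a * ln (n2%:R / beta) * y).

(** [2 l] times the noise scale of the score: half of the range is for the drift, half for the
    noise. It involves [r] but not [s]. *)
Definition clip_level (nu : nat) : R :=
  2 * l * trig_sup d *
    Num.sqrt (8 * (reps d n1 (levels N) nu)%:R * (ncoord d nu)%:R).

Lemma clip_sqrt_le nu :
  Num.sqrt (8 * (reps d n1 (levels N) nu)%:R * (ncoord d nu)%:R) <= 3 * Num.sqrt (bsize n1 (levels N))%:R :> R.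
Proof.
set q := reps _ _ _ _; have h : (q%:R * (ncoord d nu)%:R <= (bsize n1 (levels N))%:R :> R).
  by rewrite -natrM ler_nat; exact: leq_trunc_div.
have -> : 3 = Num.sqrt 9 :> R.
  by rewrite (_ : 9 = 3 ^+ 2) ?sqrtr_sqr ?ger0_norm//; ring.
rewrite -sqrtrM// ler_wsqrtr//.
have : 0 <= q%:R * (ncoord d nu)%:R :> R by rewrite mulr_ge0.
lra.
Qed.

Lemma interactive_rate_power (s p : R) (fX fY : d.-tuple R -> R) :
  0 < r -> 0 < s -> (0 < d)%N -> (1 <= n1)%N -> (n1 <= n2)%N -> 0 < eps <= 1 -> 1 <= p <= 2 ->
  0 < alpha < 1 -> 0 < beta < 1 -> alpha + beta <= 2^-1 ->
  2 ^+ 20 * ln ((alpha * beta)^-1) <= N ->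
  (forall x, 0 <= fX x) -> (forall x, 0 <= fY x) -> sobolev_F s r fX -> sobolev_F s r fY ->
  ((radius_const s r (24 * (15 * 32 * 32 * a) * trig_sup d ^+ 2) *
    (ln N * (ln (n2%:R / beta) * y) ^+ 2 / N) `^ (2 * s / (4 * s + 2 * d%:R)))%:E
      <= lp_dist p fX fY)%E ->
  (prob_accept (rr_channel eps (@si_obs R d n1 n2 (levels N) clip_level))
     (rr_channel eps (@si_obs R d n1 n2 (levels N) clip_level)) fX fY
     (level_reject (levels N) alpha (@si_weight R n1 n2 (levels N))) <= beta%:E)%E.
Proof.
move=> r0 s0 d0 n10 n12 eps01 p12 a01 b01 ab hN fX0 fY0 FX FY.
have [N20 l10 y7 Lby lv] := ln_budget a01 b01 ab hN.
have tau_def : forall nu, clip_level nu = 2 * l * trig_sup d *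
  Num.sqrt (8 * (reps d n1 (levels N) nu)%:R * (ncoord d nu)%:R) by [].
have Zle := clip_sqrt_le.
move: clip_level tau_def => tau tau_def.
set V := levels N in tau_def Zle *; set A := a in tau_def *.
set Y := y in y7 Lby lv tau_def *; set lb := ln (n2%:R / beta) in tau_def *.
have /andP[e0 e1] := eps01; have /andP[a0 a1] := a01; have /andP[b0 b1] := b01.
have L3Y : ln (3 / beta) <= Y.
  apply: le_trans Lby; rewrite ler_ln ?posrE ?divr_gt0// ler_pM2r ?invr_gt0//.
  by rewrite ler_nat.
have N0 : 0 < N by apply: lt_le_trans N20; rewrite exprn_gt0.
have l0 : 0 < ln N by lra.
have l1 : 1 <= ln N by lra.
have e2 : 0 < eps ^+ 2 by rewrite exprn_gt0.
have e21 : eps ^+ 2 <= 1 by rewrite exprn_ile1// ltW.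
have n2R : N <= n2%:R :> R.
  apply: (@le_trans _ _ n1%:R); last by rewrite ler_nat.
  by rewrite ler_piMr.
have n2b : n2%:R <= n2%:R / beta :> R by rewrite ler_peMr// invf_ge1// ltW.
have lb1 : 1 <= lb.
  apply: (le_trans l1); rewrite ler_ln ?posrE//; first exact: le_trans n2b.
  by apply: lt_le_trans N0 _; exact: le_trans n2b.
have D1 : 1 <= trig_sup d ^+ 2 :> R by rewrite trig_sup_sq exprn_ege1// ler1n.
have lbY : 7 / 2 <= lb * Y by nra.
have yy : 12 <= (lb * Y) ^+ 2 by nra.
pose z := ln N * (lb * Y) ^+ 2 / N.
have ly0 : 0 < ln N * (lb * Y) ^+ 2.
  by apply: mulr_gt0 => //; lra.
have z0 : 0 < z by rewrite divr_gt0.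
have zi : z^-1 = N / (ln N * (lb * Y) ^+ 2) by rewrite /z invf_div.
have zN : 12 * ln N * z^-1 <= N.
  rewrite zi (_ : 12 * ln N * (N / _) = N * (12 / (lb * Y) ^+ 2)).
    by rewrite ler_piMr ?(ltW N0)// ler_pdivrMr ?mul1r//; lra.
  by field; rewrite !gt_eqF//; lra.
have A0 : 0 <= A by rewrite addr_ge0// mulr_ge0// sqr_ge0.
rewrite (_ : 2 * d%:R = 2 * 1 * d%:R); last by rewrite mulr1.
set C := 24 * _ * _.
have C0 : 0 <= C by apply: mulr_ge0; [apply: mulr_ge0 => //; exact: mulr_ge0|exact: sqr_ge0].
move=> /(energy_level (lexx 1) s0 r0 C0 z0 d0 p12 FX FY)[nu0 [kz Mz hE]].
have [Sf dX] := FX; have [Sg dY] := FY.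
have [sh _ hB _] := sobolev_difference s0 dX.1 dY.1 Sf Sg.
have [Lo0 BLo Lo512 L3 lbL] := interactive_window r D1 lb1 y7.
rewrite -/A in Lo0 BLo Lo512 L3 lbL.
pose L := A * lb * Y; rewrite -/L in Lo0 BLo Lo512 L3 lbL tau_def.
set Lo := 15 * 32 * 32 * _ * _ * _ in Lo0 BLo Lo512.
have [q0 hq] := reps_signal eps01 l1 Mz zN; rewrite -/V in q0 hq.
have M0 : 0 < (ncoord d nu0)%:R :> R by rewrite ltr0n ncoord_gt0.
pose E k := energy (coef_diff fX fY) (2 ^ k).
have E0B k : 0 <= E k <= 4 * r ^+ 2 by rewrite energy_ge0 hB.
have Emon k : E k <= E k.+1 by apply: le_energy; rewrite leq_pexp2l.
have Lonu0 : Lo <= (reps d n1 V nu0)%:R * eps ^+ 2 * E nu0.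
  have D0 : 0 <= trig_sup d ^+ 2 :> R by exact: sqr_ge0.
  have k0 : 0 <= 15 * 32 * 32 :> R by rewrite !mulr_ge0.
  apply: le_trans (interactive_entry Y k0 D0 A0 lb1) _.
  apply: (signal_of_energy (M := (ncoord d nu0)%:R) (l := ln N) ltr01 N0 _ D0 hq).
  + exact: mulr_ge0.
  + by apply: mulr_gt0 => //; rewrite ltr0n.
  + by move: hE; rewrite powRr1 ?mulr1// ltW.
(* [nu0] only shows that some level passes the threshold; the test succeeds at [nu], whose signal
   also obeys the upper bound that clipping requires. *)
have [nu [nV qnu low up]] := level_selection d0 eps01 Lo0 BLo Emon E0B
  (fun k => @lt_levels R N k) Lonu0.
rewrite -trig_sup_sq in up; have {Lo512} up := le_trans up Lo512.
have L0 : 0 < L by apply: lt_le_trans L3.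
have t0 := @trig_sup_gt0 R d.
have qR : 0 < (reps d n1 V nu)%:R :> R by rewrite ltr0n.
have MR : 0 < (ncoord d nu)%:R :> R by rewrite ltr0n ncoord_gt0.
have Z8 : 0 < 8 * (reps d n1 V nu)%:R * (ncoord d nu)%:R :> R by rewrite !mulr_gt0.
have Zs := Zle nu; have tauE := tau_def nu.
have Z0 : 0 < Num.sqrt (8 * (reps d n1 V nu)%:R * (ncoord d nu)%:R) :> R by rewrite sqrtr_gt0.
have Z2 := sqr_sqrtr (ltW Z8).
move: (Num.sqrt (8 * _ * _)) Z0 Z2 Zs tauE => Z Z0 Z2 Zs tauE.
apply: (interactive_power (theta := (trig_sup d * Z)^-1) eps01 n12 b01 fX0 dX fY0 dY
  nV qnu sh).
- by rewrite tauE; apply: mulr_gt0 => //; apply: mulr_gt0 => //; exact: mulr_gt0.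
- by rewrite invr_gt0 mulr_gt0.
- exact: noise_scale_cond.
- by rewrite tauE; apply: drift_cond.
(* [n2] bounds the square root of the block size, and [l >= ln (n2 / beta)] gives
   [n2 <= expR l * beta]. *)
- rewrite tauE; apply: (tail_cond (n := n2%:R) t0 Z0 eps01 y7 L3 low b0).
  + by rewrite ler1n; exact: leq_trans n12.
  + rewrite -ler_pdivrMr//; have n2b0 : 0 < n2%:R / beta.
      by apply: lt_le_trans N0 _; exact: le_trans n2b.
    by rewrite -[leLHS]lnK ?posrE// ler_expR.
  + apply: le_trans Zs _; rewrite ler_pM2l//; apply: sqrt_nat_le.
    by apply: leq_trans n12; exact: leq_div.
- exact: (linear_noise_cond t0 eps01 y7 L3 low).
- rewrite tauE; apply: (block_signal_cond t0 Z0 eps01 y7 L3 low) => //.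
  + by rewrite sqrtr_gt0 ltr0n; exact: bsize_gt0 qnu.
  + by apply: lv; rewrite ?ltr0n//; exact: levels_le.
Qed.

End interactive_rate.

Theorem interactive_rate {R : realType} (d : nat) (r : R) : 0 < r ->
  exists Cs' : R -> R, (forall s : R, 0 < s -> 0 < Cs' s) /\
   forall (n1 n2 : nat) (eps p alpha beta : R),
     (1 <= n1)%N -> (n1 <= n2)%N ->
     0 < eps <= 1 -> 1 <= p <= 2 ->
     0 < alpha < 1 -> 0 < beta < 1 -> alpha + beta <= 2^-1 ->
     n1%:R * eps ^+ 2 >= 2 ^+ 20 * ln ((alpha * beta)^-1) ->
     exists (dT : measure_display) (T : measurableType dT)
            (QX QY : channels R d n1 n2 T)
            (Phi : set (n1.-tuple T * n2.-tuple T)),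
       seq_interactive_ldp eps QX QY /\ test_measurable Phi /\
       (forall f : d.-tuple R -> R, is_density f ->
          (prob_reject QX QY f f Phi <= alpha%:E)%E) /\
       (forall s : R, 0 < s ->
        forall fX fY : d.-tuple R -> R,
          sobolev_F s r fX -> sobolev_F s r fY ->
          (lp_dist p fX fY >=
            (Cs' s * ((ln (n1%:R * eps ^+ 2) *
                        (ln (n2%:R / beta) *
                         ln (ln (n1%:R * eps ^+ 2) / (alpha * beta))) ^+ 2)
                       / (n1%:R * eps ^+ 2)) `^ (2 * s / (4 * s + 2 * d%:R)))%:E)%E ->
          (prob_accept QX QY fX fY Phi <= beta%:E)%E).
Proof.
move=> r0; pose a : R := 60 * trig_sup d ^+ 2 + 4 * r ^+ 2.
have a0 : 0 <= a by rewrite addr_ge0// mulr_ge0// sqr_ge0.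
pose C : R := 24 * (15 * 32 * 32 * a) * trig_sup d ^+ 2.
have C0 : 0 <= C.
  by apply: mulr_ge0; [apply: mulr_ge0 => //; exact: mulr_ge0|exact: sqr_ge0].
exists (fun s => radius_const s r C); split.
  by move=> s s0; exact: radius_const_gt0.
move=> n1 n2 eps p alpha beta n10 n12 eps01 p12 a01 b01 ab hN.
have [N20 l10 y7 _ _] := ln_budget a01 b01 ab hN.
pose u := @si_obs R d n1 n2 (levels (n1%:R * eps ^+ 2)) (clip_level d n1 n2 r eps alpha beta).
exists _, bool, (rr_channel eps u), (rr_channel eps u),
  (level_reject (levels (n1%:R * eps ^+ 2)) alpha
     (@si_weight R n1 n2 (levels (n1%:R * eps ^+ 2)))).
have u1 : forall i x zs ws, -1 <= u i x zs ws <= 1 by exact: si_obs_itv.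
have um i : measurable_fun setT
  (fun p : d.-tuple R * (n1.-tuple bool * n2.-tuple bool) => u i p.1 p.2.1 p.2.2).
  exact: si_obs_measurable.
have uc x : causal_fun (fun i => u i x) by exact: si_obs_causal.
have /andP[al0 _] := a01; have /andP[p1 _] := p12.
split; last split; last split.
- split; split.
  + exact: rr_channel_measurable.
  + exact: rr_channel_measurable.
  + exact: rr_channel_ldp.
  + exact: rr_channel_ldp.
  + exact: rr_channel_causal.
  + exact: rr_channel_causal.
- exact: measurable_bool_outcomes.
- by move=> f df; apply: (prob_reject_level n12 eps01 u1 um uc).
have N0 : 0 < n1%:R * eps ^+ 2 by apply: lt_le_trans N20; rewrite exprn_gt0.
have lb0 : 0 < ln (n2%:R / beta).
  have /andP[b0 b1] := b01; apply: ln_gt0; rewrite ltr_pdivlMr// mul1r.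
  by apply: (lt_le_trans b1); rewrite ler1n; exact: leq_trans n12.
move=> s s0; apply: accept_reduction; [lra| |move=> d0 fX fY fX0 fY0 FX FY].
  rewrite mulr_gt0 ?radius_const_gt0// powR_gt0// divr_gt0//.
  apply: mulr_gt0; first lra.
  by apply: exprn_gt0; apply: mulr_gt0 => //; lra.
exact: interactive_rate_power.
Qed.

Theorem theorem7 (R : realType) :
  exists C0 : R, 0 < C0 /\
  forall (d : nat) (r : R), 0 < r ->
  (* part (i): non-interactive mechanism *)
  (exists Cs : R -> R, (forall s : R, 0 < s -> 0 < Cs s) /\
   forall (n1 n2 : nat) (eps p alpha beta : R),
     (1 <= n1)%N -> (n1 <= n2)%N ->
     0 < eps <= 1 -> 1 <= p <= 2 ->
     0 < alpha < 1 -> 0 < beta < 1 -> alpha + beta <= 2^-1 ->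
     n1%:R * eps ^+ 2 >= C0 * ln ((alpha * beta)^-1) ->
     exists (dT : measure_display) (T : measurableType dT)
            (QX QY : channels R d n1 n2 T)
            (Phi : set (n1.-tuple T * n2.-tuple T)),
       non_interactive_ldp eps QX QY /\ test_measurable Phi /\
       (forall f : d.-tuple R -> R, is_density f ->
          (prob_reject QX QY f f Phi <= alpha%:E)%E) /\
       (forall s : R, 0 < s ->
        forall fX fY : d.-tuple R -> R,
          sobolev_F s r fX -> sobolev_F s r fY ->
          (lp_dist p fX fY >=
            (Cs s * ((ln (n1%:R * eps ^+ 2) *
                       (ln (ln (n1%:R * eps ^+ 2) / (alpha * beta))) ^+ 2)
                      / (n1%:R * eps ^+ 2)) `^ (2 * s / (4 * s + 3 * d%:R)))%:E)%E ->
          (prob_accept QX QY fX fY Phi <= beta%:E)%E)) /\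
  (* part (ii): sequentially interactive mechanism *)
  (exists Cs' : R -> R, (forall s : R, 0 < s -> 0 < Cs' s) /\
   forall (n1 n2 : nat) (eps p alpha beta : R),
     (1 <= n1)%N -> (n1 <= n2)%N ->
     0 < eps <= 1 -> 1 <= p <= 2 ->
     0 < alpha < 1 -> 0 < beta < 1 -> alpha + beta <= 2^-1 ->
     n1%:R * eps ^+ 2 >= C0 * ln ((alpha * beta)^-1) ->
     exists (dT : measure_display) (T : measurableType dT)
            (QX QY : channels R d n1 n2 T)
            (Phi : set (n1.-tuple T * n2.-tuple T)),
       seq_interactive_ldp eps QX QY /\ test_measurable Phi /\
       (forall f : d.-tuple R -> R, is_density f ->
          (prob_reject QX QY f f Phi <= alpha%:E)%E) /\
       (forall s : R, 0 < s ->
        forall fX fY : d.-tuple R -> R,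
          sobolev_F s r fX -> sobolev_F s r fY ->
          (lp_dist p fX fY >=
            (Cs' s * ((ln (n1%:R * eps ^+ 2) *
                        (ln (n2%:R / beta) *
                         ln (ln (n1%:R * eps ^+ 2) / (alpha * beta))) ^+ 2)
                       / (n1%:R * eps ^+ 2)) `^ (2 * s / (4 * s + 2 * d%:R)))%:E)%E ->
          (prob_accept QX QY fX fY Phi <= beta%:E)%E)).
Proof.
exists (2 ^+ 20); split; first by rewrite exprn_gt0.
by move=> d r r0; split; [exact: noninteractive_rate|exact: interactive_rate].
Qed.
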